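(* Let $S$ be a locally compact topological Clifford semigroup such that every maximal subgroup $G_e$ is an NSS topological group, and such that $E(S)$ is Hausdorff in the subspace topology. Then every maximal subgroup $G_e$, $e\in E(S)$, is a finite-dimensional Lie group.
   Context: A Clifford semigroup is an inverse semigroup (each $x$ has a unique $x^{-1}$ with $xx^{-1}x=x$, $x^{-1}xx^{-1}=x^{-1}$) with $xx^{-1}=x^{-1}x$ for all $x$; topological means multiplication and inversion are continuous. $E(S)$ is the set of idempotents; $G_e:=\{x: xx^{-1}=e\}$ with the subspace topology. A topological group is NSS (''no small subgroups'') if it has a neighbourhood of the identity containing no nontrivial subgroup. *)

(* Defs.v *)
From HB Require Import structures.
From mathcomp Require Import all_boot all_order all_algebra.
From mathcomp Require Import all_classical all_reals all_analysis.
From mathcomp Require Import Rstruct Rstruct_topology.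
Set Implicit Arguments. Unset Strict Implicit. Unset Printing Implicit Defensive.
Import Order.TTheory GRing.Theory Num.Theory.
Import numFieldNormedType.Exports.
Local Open Scope classical_set_scope.
Local Open Scope ring_scope.

Notation RR := Rdefinitions.R.

Definition clifford_semigroup (S : Type) (mul : S -> S -> S) (inv : S -> S)
  : Prop :=
  [/\ (forall x y z, mul x (mul y z) = mul (mul x y) z),
      (forall x, mul (mul x (inv x)) x = x),
      (forall x, mul (mul (inv x) x) (inv x) = inv x),
      (forall x y, mul (mul x y) x = x -> mul (mul y x) y = y -> y = inv x) &
      (forall x, mul x (inv x) = mul (inv x) x)].

Definition topological_ops (S : topologicalType) (mul : S -> S -> S)
  (inv : S -> S) : Prop :=
  continuous (fun p : S * S => mul p.1 p.2) /\ continuous inv.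

Definition locally_compact_space (S : topologicalType) : Prop :=
  forall x : S, exists K : set S, compact K /\ nbhs x K.

Definition idempotents (S : Type) (mul : S -> S -> S) : set S :=
  [set e | mul e e = e].

Definition Gmax (S : Type) (mul : S -> S -> S) (inv : S -> S) (e : S)
  : set S := [set x | mul x (inv x) = e].

Definition hausdorff_subspace (S : topologicalType) (A : set S) : Prop :=
  forall x y, A x -> A y -> x <> y ->
    exists U V : set S, [/\ open U, open V, U x, V y & U `&` V `&` A = set0].

Definition is_subgroup_of_Gmax (S : Type) (mul : S -> S -> S) (inv : S -> S)
  (e : S) (H : set S) : Prop :=
  [/\ H `<=` Gmax mul inv e, H e,
      (forall x y, H x -> H y -> H (mul x y)) &
      (forall x, H x -> H (inv x))].

Definition NSS_Gmax (S : topologicalType) (mul : S -> S -> S) (inv : S -> S)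
  (e : S) : Prop :=
  exists U : set S, [/\ open U, U e &
    forall H : set S, is_subgroup_of_Gmax mul inv e H ->
      H `<=` U `&` Gmax mul inv e -> H = [set e]].

Fixpoint iderive (m k : nat) (f : 'rV[RR]_m -> 'rV[RR]_k)
  (vs : seq 'rV[RR]_m) : 'rV[RR]_m -> 'rV[RR]_k :=
  match vs with
  | [::] => f
  | v :: vs' => fun x => 'D_v (iderive f vs') x
  end.

Definition smooth_on (m k : nat) (D : set 'rV[RR]_m)
  (f : 'rV[RR]_m -> 'rV[RR]_k) : Prop :=
  [/\ open D,
      (forall vs v x, D x -> derivable (iderive f vs) x v) &
      (forall vs, {within D, continuous (iderive f vs)})].

(* The group G (a subset of S, with the subspace topology, multiplication mul
   and inversion inv) is a finite-dimensional real Lie group: it is Hausdorff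
   and carries a smooth atlas of some finite dimension n, compatible with
   the subspace topology, for which multiplication and inversion are smooth.
   A chart i is a homeomorphism phi i : U i -> phi i @` U i (inverse psi i)
   from a relatively open subset U i of G onto an open subset of R^n. *)
Definition Lie_group (S : topologicalType) (mul : S -> S -> S)
  (inv : S -> S) (G : set S) : Prop :=
  exists (n : nat) (I : Type) (U : I -> set S)
         (phi : I -> S -> 'rV[RR]_n) (psi : I -> 'rV[RR]_n -> S),
  hausdorff_subspace G /\
      (forall i, exists O : set S, open O /\ U i = O `&` G) /\
      G `<=` \bigcup_(i in [set: I]) U i /\
      (forall i, [/\ open (phi i @` U i),
                     (forall x, U i x -> psi i (phi i x) = x),
                     (forall y, (phi i @` U i) y -> phi i (psi i y) = y),
                     {within U i, continuous phi i} &
                     {within phi i @` U i, continuous psi i}]) /\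
      (forall i j, smooth_on (phi i @` (U i `&` U j)) (phi j \o psi i)) /\
      (forall i j k,
         smooth_on
           [set z : 'rV[RR]_(n + n) |
              [/\ (phi i @` U i) (lsubmx z), (phi j @` U j) (rsubmx z) &
                  U k (mul (psi i (lsubmx z)) (psi j (rsubmx z)))]]
           (fun z => phi k (mul (psi i (lsubmx z)) (psi j (rsubmx z))))) /\
      (forall i j,
         smooth_on [set y | (phi i @` U i) y /\ U j (inv (psi i y))]
                   (fun y => phi j (inv (psi i y)))).

(* Main.v *)
(** Each $G_e$ is closed in $S$, being the fibre over $e$ of $x \mapsto x x^{-1} \in E(S)$,
so it is a locally compact NSS group and the statement becomes Gleason's theorem on such
groups.

Let $U$ be a small compact neighbourhood of the identity and $|g| = 1/n$ with $n$ the least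
exponent such that $g^n \notin U$.  If $|g_1 \cdots g_k| \le M \sum |g_i|$ holds for some
$M$ (after adding $\varepsilon$ to each term), then smoothing a bump function along such
products and convolving shows that it holds with $C + M/2$; hence it holds with $2C$.
With $d_g f(x) = f(g^{-1}x) - f(x)$, the same convolution then gives a bump $\phi$ whose
first differences are of order $|g|$ and whose second differences are of order $|g||h|$.
So $N(g) = \sup |d_g \phi|$ is a norm defining the topology, and the values of $d_g \phi$ at
finitely many points form a map $F : G \to \mathbb R^d$ with
$|F(gh) - F(g) - F(h)| \le C\,N(g)N(h)$ and $N \asymp |F|$ near the identity.

Limits of powers produce one-parameter subgroups $X_1,\dots,X_n$ whose tangent vectors span
all values of $F$ to first order, and $E(t) = X_1(t_1)\cdots X_n(t_n)$ is a chart.  The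
conjugation $g \mapsto h^{-1}gh$ has a differential $\mathrm{Ad}(h)$, multiplicative in $h$,
and every coefficient of $\mathrm{Ad}(X_i(t))$ is differentiable in $t$ with a derivative
that is a linear combination of coefficients.  A coordinate change, a product or an inverse
is a map $f$ with $E(f(z))$ equal to a word in constants and in the $X_i$ of linear forms in
$z$, so its differential is a polynomial in such coefficients and in the inverse Jacobian of
$E$ at $f(z)$.  These functions form an algebra stable under differentiation, which makes
$f$ smooth without solving any differential equation. *)

Require Import Defs.
From HB Require Import structures.
From mathcomp Require Import all_boot all_order all_algebra.
From mathcomp Require Import all_classical all_reals all_analysis.
From mathcomp Require Import Rstruct Rstruct_topology.
From mathcomp Require Import ring lra zify.
Set Implicit Arguments. Unset Strict Implicit. Unset Printing Implicit Defensive.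
Import Order.TTheory GRing.Theory Num.Theory.
Import numFieldNormedType.Exports.
Local Open Scope classical_set_scope.
Local Open Scope ring_scope.

(** * Topological groups *)

(** Compactness is exploited through ultrafilters: covering ratios, powers of shrinking elements and
    difference quotients all converge along one. Integration is a left invariant functional on
    nonnegative compactly supported functions, built from Haar covering numbers. Calculus is carried
    out with first order expansions whose remainder is quadratic: this is what an almost
    homomorphism supplies, it is stable under the algebraic operations, and iterating it gives
    directional derivatives of all orders.

    Two circularities have to be broken. No constant [M] is available for escape lengths at the
    start; the added [eps] makes [eps^-1] admissible, and the bound reached by self-improvement no
    longer depends on [eps]. The image of the chart must be open before its inverse can be studied;
    for this the distance to a target is minimised over a compact ball, and an approximate Newton
    step would improve a minimiser that misses the target. Coordinate changes are then
    differentiated from the equation they satisfy, the lower Lipschitz bound of the chart making its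
    Jacobian invertible. *)

HB.mixin Record Group_isTopGroup G of Group G & Topological G := {
  mulg_continuous : continuous (fun p : G * G => (p.1 * p.2)%g);
  invg_continuous : continuous (fun x : G => x^-1%g)
}.

#[short(type="topGroupType")]
HB.structure Definition TopGroup :=
  {G of Group G & Topological G & Group_isTopGroup G}.

Section TopGroupTheory.
Variables (G : topGroupType).
Implicit Types (x y : G) (A B K : set G).

Lemma cvgMg {T} (F : set_system T) {FF : Filter F} (f g : T -> G) x y :
  f @ F --> x -> g @ F --> y -> (fun t => f t * g t)%g @ F --> (x * y)%g.
Proof.
move=> fx gy.
by apply: continuous2_cvg fx gy; exact: (@mulg_continuous G (x, y)).
Qed.

Lemma cvgVg {T} (F : set_system T) {FF : Filter F} (f : T -> G) x :
  f @ F --> x -> (fun t => (f t)^-1)%g @ F --> (x^-1)%g.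
Proof. by move=> fx; apply: continuous_cvg fx; exact: invg_continuous. Qed.

Lemma cvgXg {T} (F : set_system T) {FF : Filter F} (f : T -> G) x n :
  f @ F --> x -> (fun t => f t ^+ n)%g @ F --> (x ^+ n)%g.
Proof.
move=> fx; elim: n => [|n IH]; first exact: cvg_cst.
under eq_fun do rewrite expgS.
by rewrite expgS; apply: cvgMg.
Qed.

Definition mulset A B : set G := [set z | exists a b, [/\ A a, B b & z = (a * b)%g]].

Fixpoint expset A n : set G :=
  if n is n'.+1 then mulset A (expset A n') else [set 1%g].

Lemma nbhs1_mul (U : set G) : nbhs 1%g U ->
  exists V : set G, nbhs 1%g V /\ forall x y, V x -> V y -> U (x * y)%g.
Proof.
move=> U1.
have := @mulg_continuous G (1%g, 1%g) U; rewrite /= mulg1 => /(_ U1).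
case=> -[A B] /= [A1 B1] AB; exists (A `&` B); split; first exact: filterI.
by move=> x y [Ax _] [_ By]; exact: (AB (x, y)).
Qed.

Lemma nbhs1_exp (U : set G) n : nbhs 1%g U ->
  exists V : set G, nbhs 1%g V /\ expset V n `<=` U.
Proof.
elim: n U => [|n IH] U U1.
  by exists setT; split; [exact: filterT|move=> _ ->; exact: nbhs_singleton].
have [W [W1 WW]] := nbhs1_mul U1; have [V [V1 VW]] := IH _ W1.
exists (V `&` W); split; first exact: filterI.
move=> _ [a [b [[_ Wa] bV ->]]]; apply: WW => //; apply: VW; move: bV; clear.
elim: n b => [|n IH] b //= [c [d [[Vc _] dV ->]]].
by exists c, d; split => //; exact: IH.
Qed.

Lemma nbhs1_inv (U : set G) : nbhs 1%g U -> nbhs 1%g [set x | U x^-1%g].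
Proof. by move=> U1; apply: (@invg_continuous G 1%g); rewrite invg1. Qed.

Lemma nbhs_mulgl (U : set G) x y : nbhs (x * y)%g U -> nbhs y [set z | U (x * z)%g].
Proof.
by move=> Uxy; apply: (cvgMg (@cvg_cst _ x _ (nbhs y) _) cvg_id).
Qed.

End TopGroupTheory.

(** * Uniform continuity of compactly supported functions, and bump functions *)

Section UniformContinuity.
Variables (R : realType) (G : topGroupType).
Implicit Types (f : G -> R) (K : set G).

Definition supported f K := forall x, ~ K x -> f x = 0.

(** Convolutions need uniformity over the conjugates [h ^ y] with [y] in a compact set: moving [h]
    past the integration variable [y] conjugates it. *)
Lemma supported_unif_left f K L (e : R) : continuous f -> compact K ->
  supported f K -> compact L -> 0 < e ->
  \forall h \near (1%g : G), forall y, L y -> forall z, `|f ((h ^ y) * z)%g - f z| <= e.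
Proof.
move=> cf cK sK cL e0.
have H : \forall h \near (1%g : G), (L `*` K) `<=` fun p => `|f ((h ^ p.1) * p.2)%g - f p.2| <= e.
  have /compact_near_coveringP/(_ _ (nbhs (1%g : G))
    (fun h p => `|f ((h ^ p.1) * p.2)%g - f p.2| <= e) _) := compact_setX cL cK.
  apply=> -[y z] _ /=.
  have c1 : (fun q : (G * G) * G => f ((q.2 ^ q.1.1) * q.1.2)%g - f q.1.2) @
      nbhs ((y, z), 1%g : G) --> f z - f z.
    apply: cvgB; last first.
      by apply: continuous_cvg; [exact: cf|exact: (cvg_comp _ _ cvg_fst cvg_snd)].
    apply: continuous_cvg; first exact: cf.
    suff: (fun q : (G * G) * G => (q.2 ^ q.1.1) * q.1.2)%g @ nbhs ((y, z), 1%g : G)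
        --> ((y^-1 * (1 * y)) * z)%g by rewrite mul1g mulVg mul1g.
    have h1 : (fun q : (G * G) * G => q.1.1) @ nbhs ((y, z), 1%g : G) --> y.
      exact: (cvg_comp _ _ cvg_fst cvg_fst).
    have h2 : (fun q : (G * G) * G => q.1.2) @ nbhs ((y, z), 1%g : G) --> z.
      exact: (cvg_comp _ _ cvg_fst cvg_snd).
    by apply: cvgMg => //; apply: cvgMg; [exact: (cvgVg h1)|apply: cvgMg => //; exact: cvg_snd].
  have /cvgr_distC_le : (fun q : (G * G) * G => f ((q.2 ^ q.1.1) * q.1.2)%g - f q.1.2) @
      nbhs ((y, z), 1%g : G) --> (0 : R) by rewrite -(subrr (f z)).
  move=> /(_ e e0); apply: filterS => q /=.
  by rewrite subr0.
(* The covering argument treats [z] in [K]. If only [(h ^ y) * z] lies in [K], the estimate is used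
   at that point with [h^-1]; if neither does, both values vanish. *)
have Hi := nbhs1_inv H.
apply: filterS2 H Hi => h Hh Hih y Ly z.
have [Kz|nKz] := pselect (K z).
  by exact: (Hh (y, z)).
have [Khz|nKhz] := pselect (K ((h ^ y) * z)%g); last by rewrite !sK // subrr normr0 ltW.
have /= := Hih (y, (h ^ y) * z)%g (conj Ly Khz).
by rewrite conjVg mulKg distrC.
Qed.

Lemma supported_unif_right f K (e : R) : continuous f -> compact K ->
  supported f K -> 0 < e ->
  \forall h \near (1%g : G), forall z, `|f (z * h)%g - f z| <= e.
Proof.
move=> cf cK sK e0.
have H : \forall h \near (1%g : G), K `<=` fun z => `|f (z * h)%g - f z| <= e.
  have /compact_near_coveringP/(_ _ (nbhs (1%g : G))
    (fun h z => `|f (z * h)%g - f z| <= e) _) := cK.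
  apply=> z _ /=.
  have /cvgr_distC_le : (fun q : G * G => f (q.1 * q.2)%g - f q.1) @
      nbhs (z, 1%g : G) --> (0 : R).
    rewrite -(subrr (f z)); apply: cvgB; last by apply: continuous_cvg; [exact: cf|exact: cvg_fst].
    apply: continuous_cvg; first exact: cf.
    by rewrite -{2}(mulg1 z); apply: cvgMg; [exact: cvg_fst|exact: cvg_snd].
  move=> /(_ e e0); apply: filterS => q /=.
  by rewrite subr0.
have Hi := nbhs1_inv H.
apply: filterS2 H Hi => h Hh Hih z.
have [Kz|nKz] := pselect (K z).
  by exact: Hh.
have [Khz|nKhz] := pselect (K (z * h)%g); last by rewrite !sK // subrr normr0 ltW.
by have /= := Hih (z * h)%g Khz; rewrite mulgK distrC.
Qed.

Lemma cvg_of_unif_right f : (forall e, 0 < e ->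
  \forall h \near (1%g : G), forall z, `|f (z * h)%g - f z| <= e) -> continuous f.
Proof.
move=> H x; apply/cvgrPdist_le => e e0.
have := H e e0; rewrite -(mulVg x) => /nbhs_mulgl.
by apply: filterS => z /= /(_ x); rewrite mulVKg distrC.
Qed.

Lemma bump_function (U K0 : set G) : hausdorff_space G -> compact K0 -> nbhs 1%g K0 ->
  nbhs 1%g U -> exists f : G -> R,
  [/\ continuous f, (forall x, 0 <= f x <= 1), f 1%g = 1 & forall x, f x != 0 -> U x].
Proof.
move=> hG cK0 K01 U1.
have lc : locally_compact [set: G].
  move=> x _; exists [set y | K0 (x^-1 * y)%g].
    have : nbhs (x^-1 * x)%g K0 by rewrite mulVg.
    by move/nbhs_mulgl; apply: filterS => y /= + _.
  have -> : [set y | K0 (x^-1 * y)%g] = (fun y => (x * y)%g) @` K0.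
    rewrite predeqE => y; split=> [|[z Kz <-] /=]; last by rewrite mulKg.
    by exists (x^-1 * y)%g => //; rewrite mulVKg.
  have cc : compact ((fun y => (x * y)%g) @` K0).
    apply: continuous_compact => //; apply: continuous_subspaceT => y.
    by apply: cvgMg; [exact: cvg_cst|exact: cvg_id].
  by split => //; exact: compact_closed.
have /(_ 1%g (~` U°)) := locally_compact_completely_regular (R := R) lc hG.
move=> /(_ (open_closedC (open_interior U)) (fun h => h U1)).
move=> /(uniform_separatorP (R := R))[f [cf f01 f0 f1]].
exists (fun x => 1 - f x); split.
- by move=> x; apply: cvgB; [exact: cvg_cst|exact: cf].
- move=> x; have := f01 (f x) (ex_intro2 _ _ x I erefl); rewrite /= in_itv /= => /andP[? ?].
  by apply/andP; split; lra.
- by rewrite (f0 (f 1%g)) ?subr0 //; exists 1%g.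
- move=> x; apply: contra_neqP => nUx.
  rewrite (f1 (f x)) ?subrr //; exists x => //=.
  by move=> /interior_subset.
Qed.

End UniformContinuity.

(** * Invariant integration *)

Lemma cvg_le {R : realType} {T} {F : set_system T} {PF : ProperFilter F} (f g : T -> R) (a b : R) :
  f @ F --> a -> g @ F --> b -> (\forall t \near F, f t <= g t) -> a <= b.
Proof.
move=> fa gb fg; rewrite -subr_ge0.
apply: (closed_cvg (fun x : R => 0 <= x) (@closed_ge R 0) _ (b - a) (cvgB gb fa)).
by apply: filterS fg => t; rewrite subr_ge0.
Qed.

Section Haar.
Variables (R : realType) (G : topGroupType).
Implicit Types (f g : G -> R) (K V : set G) (s t : seq (R * G)).

Definition Cc f := [/\ continuous f, (forall x, 0 <= f x) &
  exists2 K, compact K & supported f K].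

Lemma CcD f g : Cc f -> Cc g -> Cc (fun x => f x + g x).
Proof.
move=> [cf f0 [K cK sK]] [cg g0 [L cL sL]]; split.
- by move=> x; apply: cvgD; [exact: cf|exact: cg].
- by move=> x; rewrite addr_ge0.
- exists (K `|` L); first exact: compactU.
  by move=> x /not_orP[nK nL]; rewrite sK // sL // addr0.
Qed.

Lemma CcZ c f : 0 <= c -> Cc f -> Cc (fun x => c * f x).
Proof.
move=> c0 [cf f0 [K cK sK]]; split.
- by move=> x; apply: cvgM; [exact: cvg_cst|exact: cf].
- by move=> x; rewrite mulr_ge0.
- by exists K => // x nK; rewrite sK // mulr0.
Qed.

Lemma CcM f g : Cc f -> continuous g -> (forall x, 0 <= g x) -> Cc (fun x => f x * g x).
Proof.
move=> [cf f0 [K cK sK]] cg g0; split.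
- by move=> x; apply: cvgM; [exact: cf|exact: cg].
- by move=> x; rewrite mulr_ge0.
- by exists K => // x nK; rewrite sK // mul0r.
Qed.

Lemma Cc_transl a f : Cc f -> Cc (fun x => f (a^-1 * x)%g).
Proof.
move=> [cf f0 [K cK sK]]; split => //.
- move=> x; apply: (continuous_comp (f := fun x => (a^-1 * x)%g) (g := f)); last exact: cf.
  by apply: cvgMg; [exact: cvg_cst|exact: cvg_id].
- exists ((fun x => a * x)%g @` K).
    apply: continuous_compact => //; apply: continuous_subspaceT => x.
    by apply: cvgMg; [exact: cvg_cst|exact: cvg_id].
  move=> x nK; apply: sK => Kx; apply: nK.
  by exists (a^-1 * x)%g => //; rewrite mulVKg.
Qed.

Lemma compact_bounded_above f K : continuous f -> compact K ->
  exists2 B : R, 0 < B & forall x, K x -> f x <= B.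
Proof.
move=> cf /compact_near_coveringP/(_ _ (+oo : set_system R) (fun b x => f x <= b) _) cK.
have /cK : forall x, K x -> \forall x' \near x & b \near +oo, f x' <= b.
  move=> x _; exists ([set x' | f x' < f x + 1], [set b | f x + 1 <= b]) => /=.
    split; last exact/nbhs_pinfty_ge/num_real.
    by apply: (cvgr_lt (f x) (cf x)); rewrite ltrDl.
  by move=> [x' b] /= [h1 h2]; apply: le_trans (ltW h1) h2.
move=> H; near (+oo : set_system R) => b; exists b => //.
by move=> x Kx; move: x Kx; near: b; exact: H.
Unshelve. all: by end_near. Qed.

Lemma finite_translates K V : compact K -> nbhs 1%g V ->
  exists r : seq G, forall x, K x -> exists2 y, y \in r & V (y^-1 * x)%g.
Proof.
move=> cK V1.
(* Finite lists ordered by inclusion: the near-covering form of compactness then collects the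
   finitely many centres. *)
pose F : set_system (seq G) := filter_from setT (fun r : seq G => [set s : seq G | {subset r <= s}]).
have FF : Filter F.
  apply: filter_from_filter; first by exists [::].
  move=> r1 r2 _ _; exists (r1 ++ r2) => //= s0 sub; split=> y yr;
    by apply: sub; rewrite mem_cat yr ?orbT.
have /compact_near_coveringP/(_ _ F
  (fun (s : seq G) x => exists2 y, y \in s & V (y^-1 * x)%g) FF) [] := cK.
  move=> x Kx; exists ([set x' | V (x^-1 * x')%g], [set s : seq G | {subset [:: x] <= s}]) => /=.
    split; last by exists [:: x].
    by apply: nbhs_mulgl; rewrite mulVg.
  by move=> [x' s0] /= [Vx xs]; exists x => //; apply: xs; rewrite mem_head.
by move=> r _ /(_ r (fun y yr => yr)) H; exists r.
Qed.

Definition comb (F : G -> R) s x := \sum_(p <- s) p.1 * F (p.2^-1 * x)%g.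
Definition mass s : R := \sum_(p <- s) p.1.
Definition posw s := forall p, p \in s -> 0 <= p.1.
Definition cover_of (F f : G -> R) s := posw s /\ forall x, f x <= comb F s x.
(** Haar's covering number (f : F), with real weights. The infimum of an empty set is a default
    value, so lower bounds ask for some cover as a witness. *)
Definition cnum (F f : G -> R) := inf [set mass s | s in cover_of F f].

Lemma mass_ge0 s : posw s -> 0 <= mass s.
Proof. by move=> sp; rewrite /mass big_seq sumr_ge0. Qed.

Lemma comb_ge0 F s x : posw s -> (forall x, 0 <= F x) -> 0 <= comb F s x.
Proof. by move=> sp F0; rewrite /comb big_seq sumr_ge0 // => p /sp ?; rewrite mulr_ge0. Qed.

Lemma posw_cat s t : posw s -> posw t -> posw (s ++ t).
Proof. by move=> ps pt p; rewrite mem_cat => /orP[/ps|/pt]. Qed.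

Lemma cover_lb F f : has_lbound [set mass s | s in cover_of F f].
Proof. by exists 0 => _ [s [sp _] <-]; exact: mass_ge0. Qed.

Lemma cnum_le F f s : cover_of F f s -> cnum F f <= mass s.
Proof. by move=> sc; apply: (ge_inf (cover_lb F f)); exists s. Qed.

Lemma cnum_ge F f s0 c : cover_of F f s0 ->
  (forall s, cover_of F f s -> c <= mass s) -> c <= cnum F f.
Proof.
move=> sc H; apply: lb_le_inf; first by exists (mass s0); exists s0.
by move=> _ [s /H + <-].
Qed.

Lemma cnum_approx F f s0 e : cover_of F f s0 -> 0 < e ->
  exists2 s, cover_of F f s & mass s < cnum F f + e.
Proof.
move=> sc e0.
have hi : has_inf [set mass s | s in cover_of F f].
  by split; [exists (mass s0); exists s0|exact: cover_lb].
by have [_ [s cs <-] ?] := inf_adherent e0 hi; exists s.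
Qed.

Lemma cnum_mono F f g s : (forall x, f x <= g x) -> cover_of F g s ->
  cnum F f <= cnum F g.
Proof.
move=> fg sg; apply: (cnum_ge sg) => t [tp tg]; apply: cnum_le; split => // x.
exact: le_trans (fg x) (tg x).
Qed.

Lemma cnumD F f g s t : cover_of F f s -> cover_of F g t ->
  cnum F (fun x => f x + g x) <= cnum F f + cnum F g.
Proof.
move=> sf tg; apply/ler_addgt0Pr => e e0; have e2 : 0 < e / 2 by rewrite divr_gt0.
have [s' [ps cs] ms] := cnum_approx sf e2; have [t' [pt ct] mt] := cnum_approx tg e2.
have : cover_of F (fun x => f x + g x) (s' ++ t').
  by split; [exact: posw_cat|move=> x; rewrite /comb big_cat lerD].
by move/cnum_le; rewrite /mass big_cat /=; rewrite /mass in ms mt; lra.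
Qed.

Lemma cnumZ F f s c : 0 <= c -> cover_of F f s -> cnum F (fun x => c * f x) <= c * cnum F f.
Proof.
move=> c0 sf; apply/ler_addgt0Pr => e e0.
have e2 : 0 < e / (c + 1) by rewrite divr_gt0 // ltr_wpDl.
have [t [pt ct] mt] := cnum_approx sf e2.
have : cover_of F (fun x => c * f x) [seq (c * p.1, p.2) | p <- t].
  split; first by move=> _ /mapP[p /pt p0 ->]; rewrite mulr_ge0.
  move=> x; rewrite /comb big_map /=; under eq_bigr do rewrite -mulrA.
  by rewrite -mulr_sumr ler_wpM2l.
move/cnum_le => /le_trans; apply.
rewrite /mass big_map -mulr_sumr -/(mass t).
apply: (@le_trans _ _ (c * (cnum F f + e / (c + 1)))); first by rewrite ler_wpM2l // ltW.
rewrite mulrDr lerD2l mulrCA ger_pMr // ler_pdivrMr ?mul1r ?lerDl // ltr_wpDl //.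
Qed.

Lemma cover_transl F f s a : cover_of F f s ->
  cover_of F (fun x => f (a^-1 * x)%g) [seq (p.1, a * p.2)%g | p <- s].
Proof.
move=> [ps cs]; split; first by move=> _ /mapP[p /ps p0 ->].
move=> x; rewrite /comb big_map /=; under eq_bigr do rewrite invgM -mulgA.
exact: cs.
Qed.

Lemma cnum_transl_le F f s a : cover_of F f s ->
  cnum F (fun x => f (a^-1 * x)%g) <= cnum F f.
Proof.
move=> sf; apply: (cnum_ge sf) => t /(cover_transl a)/cnum_le.
by rewrite /mass big_map.
Qed.

Lemma cnum_transl F f s a : cover_of F f s ->
  cnum F (fun x => f (a^-1 * x)%g) = cnum F f.
Proof.
move=> sf; apply/eqP; rewrite eq_le (cnum_transl_le a sf) /=.
have := cnum_transl_le a^-1%g (cover_transl a sf); rewrite invgK.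
by under [X in cnum F X <= _]eq_fun do rewrite mulKg.
Qed.

Lemma cnum_comb F f s t : posw s -> cover_of F f t ->
  exists t', cover_of F (comb f s) t' /\ cnum F (comb f s) <= mass s * cnum F f.
Proof.
move=> ps tf.
elim: s ps => [|p s IH] ps.
  exists [::]; split.
    by split=> // x; rewrite /comb !big_nil.
  rewrite /mass big_nil mul0r -[leRHS](_ : mass [::] = 0) ?cnum_le ?/mass ?big_nil//.
  by split=> // x; rewrite /comb !big_nil.
have p0 : 0 <= p.1 by apply: ps; rewrite mem_head.
have [|t' [ct mt]] := IH; first by move=> q qs; apply: ps; rewrite in_cons qs orbT.
have -> : comb f (p :: s) = fun x => p.1 * f (p.2^-1 * x)%g + comb f s x.
  by apply/funext => x; rewrite /comb big_cons.
have [pt2 c2] := cover_transl p.2 tf; set t2 := map _ _ in pt2 c2.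
have ct2 : cover_of F (fun x => p.1 * f (p.2^-1 * x)%g) [seq (p.1 * q.1, q.2) | q <- t2].
  split; first by move=> _ /mapP[q /pt2 q0 ->]; rewrite mulr_ge0.
  move=> x; rewrite /comb big_map /=; under eq_bigr do rewrite -mulrA.
  by rewrite -mulr_sumr ler_wpM2l //; exact: c2.
exists ([seq (p.1 * q.1, q.2) | q <- t2] ++ t'); split.
  split; first by apply: posw_cat; [exact: ct2.1|exact: ct.1].
  by move=> x; rewrite /comb big_cat lerD //; [exact: ct2.2|exact: ct.2].
apply: le_trans (cnumD ct2 ct) _.
rewrite /mass big_cons -/(mass s) mulrDl lerD //.
apply: le_trans (cnumZ p0 (cover_transl p.2 tf)) _.
by rewrite (cnum_transl _ tf).
Qed.

(** Covering [g] by translates of [f] and each of these by translates of [F] gives (g : F) <= (g :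
    f)(f : F). This is what bounds the normalised ratios above and below, uniformly in the covering
    neighbourhood. *)
Lemma cnum_trans F f g s t : cover_of f g s -> cover_of F f t ->
  cnum F g <= mass s * cnum F f.
Proof.
move=> [ps gs] tf; have [t' [ct]] := cnum_comb ps tf.
exact/le_trans/(cnum_mono gs ct).
Qed.

Lemma comb_ge_mem F s p x : posw s -> (forall x, 0 <= F x) -> p \in s ->
  p.1 * F (p.2^-1 * x)%g <= comb F s x.
Proof.
move=> + F0; rewrite /comb; elim: s => // q s IH ps; rewrite in_cons big_cons => /orP[/eqP->|ins].
  by rewrite lerDl (comb_ge0 (s := s)) // => r rs; apply: ps; rewrite in_cons rs orbT.
rewrite -[leLHS]add0r lerD // ?mulr_ge0 ?ps ?mem_head // IH // => r rs.
by apply: ps; rewrite in_cons rs orbT.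
Qed.

Lemma cover_exists F g (c B : R) (x0 : G) K : (forall x, 0 <= F x) -> 0 < c -> 0 <= B ->
  nbhs x0 [set x | c <= F x] -> compact K -> (forall x, g x <= B) ->
  (forall x, ~ K x -> g x <= 0) -> exists s, cover_of F g s.
Proof.
move=> F0 c0 B0; rewrite -[x0 in nbhs x0]mulg1 => /nbhs_mulgl x0c cK gB gK.
have [r Hr] := finite_translates cK x0c.
have ps : posw [seq (B / c, (y * x0^-1)%g) | y <- r].
  by move=> _ /mapP[y _ ->] /=; rewrite divr_ge0 // ltW.
exists [seq (B / c, (y * x0^-1)%g) | y <- r]; split=> // x.
have [Kx|/gK gx] := pselect (K x); last by apply: le_trans gx _; exact: comb_ge0.
have [y yr /= Fy] := Hr x Kx.
apply: le_trans (comb_ge_mem (p := (B / c, (y * x0^-1)%g)) x ps F0 _); last exact: map_f.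
rewrite /= invgM invgK -mulgA; apply: le_trans (gB x) _.
by rewrite mulrAC ler_pdivlMr // ler_wpM2l.
Qed.

End Haar.

Lemma ultra_fmap {T U} (f : T -> U) (F : set_system T) :
  UltraFilter F -> UltraFilter (f @ F).
Proof.
move=> FU; split; first exact: fmap_proper_filter.
move=> H HP FH; rewrite eqEsubset; split=> // A HA.
have [//|nFA] := in_ultra_setVsetC (f @^-1` A) FU.
have /FH HnA : (f @ F) (~` A) by [].
have := filterI HA HnA; rewrite setICr => H0.
by have [] := @filter_ex _ _ HP _ (H0 _).
Qed.

Definition haar_functional (R : realType) (G : topGroupType) (I : (G -> R) -> R) :=
  [/\ (forall f g, Cc f -> Cc g -> I (fun x => f x + g x) = I f + I g),
      (forall f c, Cc f -> 0 <= c -> I (fun x => c * f x) = c * I f),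
      (forall f g, Cc f -> Cc g -> (forall x, f x <= g x) -> I f <= I g),
      (forall f a, Cc f -> I (fun x => f (a^-1 * x)%g) = I f) &
      (forall f x, Cc f -> 0 < f x -> 0 < I f)].

(** * Existence of a left invariant positive functional *)

Section HaarExistence.
Variables (R : realType) (G : topGroupType) (K0 : set G).
Hypotheses (hG : hausdorff_space G) (cK0 : compact K0) (K01 : nbhs 1%g K0).
Implicit Types (f g : G -> R) (K V : set G).

Lemma Cc_above K : compact K -> exists f, Cc f /\ forall x, K x -> 1 <= f x.
Proof.
move=> cK; have [k [ck k01 k1 kK0]] := bump_function R hG cK0 K01 K01.
have V1 : nbhs (1%g : G) [set x | 1 / 2 <= k x].
  have := cvgr_ge (k 1%g) (ck 1%g); apply; rewrite k1; lra.
have [r Hr] := finite_translates cK V1.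
exists (fun x => \sum_(y <- r) 2 * k (y^-1 * x)%g); split.
  have Ck : Cc (fun x => 2 * k x).
    apply: CcZ => //; split=> //; first by move=> x; have /andP[] := k01 x.
    by exists K0 => // x nK; apply/eqP; apply: contra_notT nK; exact: kK0.
  elim: r {Hr} => [|y r IH].
    under eq_fun do rewrite big_nil.
    by split=> //; [move=> x; exact: cvg_cst|exists set0 => //; exact: compact0].
  under eq_fun do rewrite big_cons.
  by apply: CcD => //; exact: (Cc_transl y Ck).
move=> x /Hr[y yr /= ky]; rewrite (big_rem y) //=.
apply: (@le_trans _ _ (2 * k (y^-1 * x)%g)); first lra.
by rewrite lerDl sumr_ge0 // => z _; have /andP[? ?] := k01 (z^-1 * x)%g; rewrite mulr_ge0.
Qed.

Lemma indic_ge0 V (x : G) : 0 <= \1_V x :> R.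
Proof. by rewrite indicE. Qed.

Lemma Cc_bounded f : Cc f -> exists2 B : R, 0 < B & forall x, f x <= B.
Proof.
move=> [cf f0 [K cK sK]]; have [B B0 fB] := compact_bounded_above cf cK.
exists B => // x; have [Kx|nKx] := pselect (K x); first exact: fB.
by rewrite sK // ltW.
Qed.

Lemma nbhs_indic V : nbhs 1%g V -> nbhs (1%g : G) [set x | 1 <= \1_V x :> R].
Proof. by apply: filterS => x Vx /=; rewrite indicE mem_set. Qed.

Lemma Cc_cover V f : nbhs 1%g V -> Cc f -> exists s, cover_of (\1_V) f s.
Proof.
move=> V1 Cf; have [B B0 fB] := Cc_bounded Cf; have [_ _ [K cK sK]] := Cf.
apply: (cover_exists (indic_ge0 V) ltr01 (ltW B0) (nbhs_indic V1) cK fB).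
by move=> x /sK->.
Qed.

Lemma indic_cover F (c : R) (x0 : G) : (forall x, 0 <= F x) -> 0 < c -> nbhs x0 [set x | c <= F x] ->
  exists s, cover_of F (\1_K0 : G -> R) s.
Proof.
move=> F0 c0 Fc; apply: (cover_exists F0 c0 ler01 Fc cK0).
  by move=> x; rewrite indicE; case: (x \in K0).
by move=> x nK; rewrite indicE memNset.
Qed.

(** Covering numbers by [V] may blow up as [V] shrinks; division by that of the reference set [K0]
    keeps them bounded. *)
Definition cratio V f := cnum (\1_V) f / cnum (\1_V) (\1_K0 : G -> R).

Lemma cnumK0_ge1 V : nbhs 1%g V -> 1 <= cnum (\1_V) (\1_K0 : G -> R).
Proof.
move=> V1; have [s0 cs0] := indic_cover (indic_ge0 V) ltr01 (nbhs_indic V1).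
apply: (cnum_ge cs0) => s [ps cs].
have := cs 1%g; rewrite indicE mem_set; last exact: nbhs_singleton.
move=> /le_trans; apply; rewrite /comb /mass !big_seq ler_sum // => p /ps p0.
by rewrite ler_piMr // indicE; case: (_ \in _).
Qed.

Lemma cratio_ge0 V f : nbhs 1%g V -> Cc f -> 0 <= cratio V f.
Proof.
move=> V1 Cf; apply: divr_ge0; last exact: le_trans ler01 (cnumK0_ge1 V1).
by have [s cs] := Cc_cover V1 Cf; apply: (cnum_ge cs) => t [pt _]; exact: mass_ge0.
Qed.

Lemma cratio_bounded f : Cc f -> exists2 B : R, 0 < B & forall V, nbhs 1%g V -> cratio V f <= B.
Proof.
move=> Cf; have [B B0 fB] := Cc_bounded Cf; have [_ _ [K cK sK]] := Cf.
have [s cs] : exists s, cover_of (\1_K0) f s.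
  apply: (cover_exists (indic_ge0 K0) ltr01 (ltW B0) (nbhs_indic K01) cK fB).
  by move=> x /sK->.
exists (mass s + 1); first by rewrite ltr_wpDl // mass_ge0 //; case: cs.
move=> V V1; have [t ct] := indic_cover (indic_ge0 V) ltr01 (nbhs_indic V1).
have c1 := cnumK0_ge1 V1; rewrite ler_pdivrMr ?(lt_le_trans _ c1) //.
apply: le_trans (cnum_trans cs ct) _.
by rewrite ler_wpM2r ?lerDl // (le_trans ler01).
Qed.

Lemma cratio_lower f x0 : Cc f -> 0 < f x0 -> exists2 c : R, 0 < c &
  forall V, nbhs 1%g V -> c <= cratio V f.
Proof.
move=> Cf fx0; have [cf f0 _] := Cf.
have [s cs] : exists s, cover_of f (\1_K0 : G -> R) s.
  apply: (@indic_cover f (f x0 / 2) x0) => //; first by rewrite divr_gt0.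
  apply: (cvgr_ge (f x0) (cf x0)); lra.
have m0 : 0 < mass s + 1 by rewrite ltr_wpDl // mass_ge0 //; case: cs.
exists (mass s + 1)^-1; first by rewrite invr_gt0.
move=> V V1; have [t ct] := Cc_cover V1 Cf; have c1 := cnumK0_ge1 V1.
have d0 := lt_le_trans ltr01 c1.
rewrite /cratio ler_pdivlMr // mulrC ler_pdivrMr // mulrC.
apply: le_trans (cnum_trans cs ct) _.
rewrite ler_wpM2r ?lerDl //.
by apply: (cnum_ge ct) => u [pu _]; exact: mass_ge0.
Qed.

(** A cover of [f1 + f2 + d * f3] is split by giving each weight the proportion [f1 / D] or [f2 / D]
    at its centre, plus [d]. On a small translate these proportions vary by at most [d], so [f1] and
    [f2] are both covered, and the two shares of a weight add up to at most [1 + 2 * d] times it.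
    Since [f3] is at least 1 on [K], the term [d * f3] absorbs the constant [d] that keeps [D]
    positive. *)
Lemma cnum_almost_additive f1 f2 f3 K (d : R) : Cc f1 -> Cc f2 -> Cc f3 -> 0 < d ->
  compact K -> supported f1 K -> supported f2 K -> (forall x, K x -> 1 <= f3 x) ->
  exists2 W, nbhs 1%g W & forall V, nbhs 1%g V -> V `<=` W ->
    cnum (\1_V) f1 + cnum (\1_V) f2 <=
    (1 + 2 * d) * (cnum (\1_V) (fun x => f1 x + f2 x) + d * cnum (\1_V) f3).
Proof.
move=> C1 C2 C3 d0 cK s1 s2 f3K.
have [c1 p1 _] := C1; have [c2 p2 _] := C2; have [c3 p3 _] := C3.
pose D x := f1 x + f2 x + d.
have D0 x : 0 < D x by rewrite ltr_wpDl // addr_ge0.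
have cD : continuous D.
  by move=> x; apply: cvgD; [apply: cvgD; [exact: c1|exact: c2]|exact: cvg_cst].
have cq f : continuous f -> continuous (fun x => f x / D x).
  by move=> cf x; apply: cvgM; [exact: cf|apply: cvgV; [rewrite gt_eqF|exact: cD]].
have sq f : supported f K -> supported (fun x => f x / D x) K.
  by move=> sf x nK; rewrite sf // mul0r.
have U1 := supported_unif_right (cq _ c1) cK (sq _ s1) d0.
have U2 := supported_unif_right (cq _ c2) cK (sq _ s2) d0.
eexists; first exact: filterI U1 U2.
move=> V V1 VW; set I := \1_V : G -> R.
pose h0 x := f1 x + f2 x + d * f3 x.
have Ch0 : Cc h0 by apply: CcD; [exact: CcD|apply: CcZ => //; exact: ltW].
have [t ct] := Cc_cover V1 Ch0.
have [t12 ct12] := Cc_cover V1 (CcD C1 C2); have [t3 ct3] := Cc_cover V1 C3.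
have ct3' := Cc_cover V1 (CcZ (ltW d0) C3).
suff H : cnum I f1 + cnum I f2 <= (1 + 2 * d) * cnum I h0.
  apply: le_trans H _; rewrite ler_wpM2l ?addr_ge0 ?mulr_ge0 ?(ltW d0) //.
  have [t3' {}ct3'] := ct3'.
  apply: le_trans (cnumD ct12 ct3') _; rewrite lerD2l; exact: (cnumZ (ltW d0) ct3).
have piece f (pf : forall x, 0 <= f x) : supported f K ->
    (forall h, V h -> forall z, `|f (z * h)%g / D (z * h)%g - f z / D z| <= d) ->
    forall s, cover_of I h0 s ->
    cnum I f <= \sum_(p <- s) p.1 * (f p.2 / D p.2 + d).
  move=> sf fu s [ps cs].
  have := @cnum_le R G I f [seq (p.1 * (f p.2 / D p.2 + d), p.2) | p <- s].
  rewrite /mass big_map; apply; split.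
    move=> _ /mapP[p /ps pp ->] /=; rewrite mulr_ge0 // addr_ge0 ?(ltW d0) //.
    by rewrite divr_ge0 // ltW.
  move=> x; rewrite /comb big_map /=.
  have [Kx|nKx] := pselect (K x); last first.
    rewrite sf // big_seq sumr_ge0 // => p /ps pp; rewrite mulr_ge0 ?indic_ge0 //.
    by rewrite mulr_ge0 // addr_ge0 ?(ltW d0) // divr_ge0 // ltW.
  have -> : f x = f x / D x * D x by rewrite mulfVK // gt_eqF.
  apply: (@le_trans _ _ (f x / D x * comb I s x)).
    rewrite ler_wpM2l ?divr_ge0 ?(ltW (D0 x)) //.
    apply: le_trans (cs x); rewrite /D /h0 lerD2l ler_peMr ?(ltW d0) //; exact: f3K.
  rewrite /comb mulr_sumr !big_seq ler_sum // => p /ps pp.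
  rewrite mulrCA -mulrA ler_wpM2l //.
  have [Vp|nVp] := pselect (V (p.2^-1 * x)%g); last by rewrite /I indicE memNset // !mulr0.
  rewrite ler_wpM2r ?indic_ge0 //.
  have := fu _ Vp p.2; rewrite mulVKg ler_norml => /andP[_]; lra.
apply/ler_addgt0Pr => e e0.
have e2 : 0 < e / (1 + 2 * d) by rewrite divr_gt0 // addr_gt0 // mulr_gt0.
have [s cs ms] := cnum_approx ct e2; have [ps _] := cs.
have P1 := piece f1 p1 s1 (fun h Vh => (VW h Vh).1) s cs.
have P2 := piece f2 p2 s2 (fun h Vh => (VW h Vh).2) s cs.
apply: le_trans (lerD P1 P2) _; rewrite -big_split /=.
apply: (@le_trans _ _ ((1 + 2 * d) * mass s)).
  rewrite /mass mulr_sumr !big_seq ler_sum // => p /ps pp.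
  rewrite -mulrDr mulrC ler_wpM2r // addrACA lerD //; last by rewrite mulr2n mulrDl !mul1r.
  rewrite -mulrDl ler_pdivrMr // mul1r /D lerDl; exact: ltW.
apply: (@le_trans _ _ ((1 + 2 * d) * (cnum I h0 + e / (1 + 2 * d)))).
  by rewrite ler_wpM2l ?(ltW ms) // addr_ge0 // mulr_ge0 // ltW.
by rewrite mulrDr mulrCA divff ?mulr1 // gt_eqF // addr_gt0 // mulr_gt0.
Qed.

Lemma cratio_almost_additive f1 f2 (e : R) : Cc f1 -> Cc f2 -> 0 < e ->
  \forall V \near powerset_filter_from (nbhs (1%g : G)),
    cratio V f1 + cratio V f2 <= cratio V (fun x => f1 x + f2 x) + e.
Proof.
move=> C1 C2 e0; have [_ _ [K1 cK1 s1]] := C1; have [_ _ [K2 cK2 s2]] := C2.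
have cK : compact (K1 `|` K2) by exact: compactU.
have [f3 [C3 f3K]] := Cc_above cK.
have [B B0 hB] := cratio_bounded (CcD C1 C2); have [B' B'0 hB'] := cratio_bounded C3.
(* Expanding the product leaves the error [2 * d * B + d * B' + 2 * d ^ 2 * B'], at most
   [d * (2 * B + 3 * B')] when [d <= 1]. *)
pose d := Num.min 1 (e / (2 * B + 3 * B')).
have q0 : 0 < 2 * B + 3 * B' by rewrite addr_gt0 ?mulr_gt0.
have d0 : 0 < d by rewrite lt_min ltr01 divr_gt0.
have d1 : d <= 1 by rewrite ge_min lexx.
have de : d * (2 * B + 3 * B') <= e by rewrite -ler_pdivlMr // ge_min lexx orbT.
have s1' : supported f1 (K1 `|` K2) by move=> x nK; apply: s1 => ?; apply: nK; left.
have s2' : supported f2 (K1 `|` K2) by move=> x nK; apply: s2 => ?; apply: nK; right.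
have [W W1 HW] := cnum_almost_additive C1 C2 C3 d0 cK s1' s2' f3K.
near=> V.
have V1 : nbhs (1%g : G) V by near: V; exact: near_small_set.
have VW : V `<=` W by near: V; exact: small_set_sub.
have c0 : 0 < cnum (\1_V) (\1_K0 : G -> R) := lt_le_trans ltr01 (cnumK0_ge1 V1).
have : cratio V f1 + cratio V f2 <=
    (1 + 2 * d) * (cratio V (fun x => f1 x + f2 x) + d * cratio V f3).
  rewrite /cratio -mulrDl mulrA -mulrDl mulrA ler_wpM2r ?invr_ge0 ?(ltW c0) //.
  exact: HW.
have := hB V V1; have := hB' V V1.
have := cratio_ge0 V1 (CcD C1 C2); have := cratio_ge0 V1 C3.
set x := cratio _ _; set y := cratio _ _; set u := cratio _ _; set v := cratio _ _.
move=> x0 y0 xB yB /le_trans; apply.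
rewrite mulrDl mul1r -addrA lerD2l; apply: le_trans de.
have : d * y <= d * B by rewrite ler_wpM2l // ltW.
have : d * x <= d * B' by rewrite ler_wpM2l // ltW.
have : d * (d * x) <= 1 * (d * x) by rewrite ler_wpM2r // mulr_ge0 // ltW.
lra.
Unshelve. all: by end_near. Qed.

Lemma haar_exists : exists I : (G -> R) -> R, haar_functional I.
Proof.
(* An ultrafilter of shrinking neighbourhoods: every bounded ratio converges along it, and almost
   additivity becomes additivity in the limit. *)
have [U [UU sU]] := ultraFilterLemma (powerset_filter_from_filter (F := nbhs (1%g : G)) _).
have U1 : \forall V \near U, nbhs (1%g : G) V by apply: sU; exact: near_small_set.
pose I f := lim (cratio V f @[V --> U]).
have Icvg f : Cc f -> cratio V f @[V --> U] --> I f.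
  move=> Cf; have [B B0 hB] := cratio_bounded Cf.
  have : compact `[0, B]%classic by exact: segment_compact.
  rewrite compact_ultra => /(_ _ (ultra_fmap (cratio ^~ f) UU)) [].
    apply: filterS U1 => V V1 /=; rewrite in_itv /= cratio_ge0 //=; exact: hB.
  by move=> l [_ cl]; apply: cvgP cl.
have Ile f g : Cc f -> Cc g -> (\forall V \near U, cratio V f <= cratio V g) -> I f <= I g.
  by move=> Cf Cg; apply: cvg_le; exact: Icvg.
have cr_mono f g V : nbhs 1%g V -> Cc f -> Cc g -> (forall x, f x <= g x) -> cratio V f <= cratio V g.
  move=> V1 Cf Cg fg; rewrite ler_wpM2r ?invr_ge0 ?(le_trans ler01) ?cnumK0_ge1 //.
  by have [s cs] := Cc_cover V1 Cg; exact: cnum_mono fg cs.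
have IZle f c : Cc f -> 0 <= c -> I (fun x => c * f x) <= c * I f.
  move=> Cf c0; apply: (cvg_le (Icvg _ (CcZ c0 Cf)) (cvgM (cvg_cst c) (Icvg f Cf))).
  apply: filterS U1 => V V1 /=; rewrite /cratio mulrA ler_wpM2r ?invr_ge0 ?(le_trans ler01) ?cnumK0_ge1 //.
  by have [s cs] := Cc_cover V1 Cf; exact: cnumZ cs.
exists I; split.
- move=> f g Cf Cg; apply/eqP; rewrite eq_le; apply/andP; split.
    apply: (cvg_le (Icvg _ (CcD Cf Cg)) (cvgD (Icvg f Cf) (Icvg g Cg))).
    apply: filterS U1 => V V1 /=; rewrite /cratio -mulrDl ler_wpM2r ?invr_ge0 ?(le_trans ler01) ?cnumK0_ge1 //.
    by have [s cs] := Cc_cover V1 Cf; have [t ct] := Cc_cover V1 Cg; exact: cnumD cs ct.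
  apply/ler_addgt0Pr => e e0.
  apply: (cvg_le (cvgD (Icvg f Cf) (Icvg g Cg)) (cvgD (Icvg _ (CcD Cf Cg)) (cvg_cst e))).
  by apply: sU; exact: cratio_almost_additive.
- move=> f c Cf; rewrite le_eqVlt => /predU1P[<-|c0].
    apply/eqP; rewrite mul0r eq_le; apply/andP; split.
      by have := IZle f 0 Cf (lexx 0); rewrite mul0r.
    have C0 := CcZ (lexx 0) Cf.
    apply: (cvg_le (cvg_cst 0) (Icvg _ C0)); apply: filterS U1 => V V1 /=.
    exact: cratio_ge0.
  apply/eqP; rewrite eq_le IZle ?(ltW c0) //=.
  have Cc1 := CcZ (ltW c0) Cf; have ci : 0 <= c^-1 by rewrite invr_ge0 ltW.
  have := IZle _ c^-1 Cc1 ci; rewrite ler_pdivlMl //.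
  suff -> : (fun x => c^-1 * (c * f x)) = f by [].
  by apply/funext => x; rewrite mulKf // gt_eqF.
- move=> f g Cf Cg fg; apply: Ile => //.
  by apply: filterS U1 => V V1 /=; exact: cr_mono.
- move=> f a Cf; apply: (cvg_lim (@Rhausdorff R)).
  apply: cvg_trans (Icvg f Cf); apply: near_eq_cvg; apply: filterS U1 => V V1.
  by have [s cs] := Cc_cover V1 Cf; rewrite /cratio (cnum_transl _ cs).
- move=> f x Cf fx; have [c c0 hc] := cratio_lower Cf fx; apply: lt_le_trans c0 _.
  apply: (cvg_le (cvg_cst c) (Icvg _ Cf)); apply: filterS U1 => V V1 /=; exact: hc.
Qed.

End HaarExistence.

(** * The escape function and the Gleason norm *)

Section Escape.
Variables (R : realType) (G : topGroupType) (U0 : set G).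
Implicit Types (A V W : set G) (g h : G).

Definition nss_set := forall H : set G, H 1%g ->
  (forall x y, H x -> H y -> H (x * y)%g) -> (forall x, H x -> H x^-1%g) ->
  H `<=` U0 -> H `<=` [set 1%g].

Definition symset A := forall g, A g -> A g^-1%g.

Hypotheses (hG : hausdorff_space G) (cU0 : compact U0) (U01 : nbhs 1%g U0)
  (sU0 : symset U0) (nssU0 : nss_set).

Definition esc A g : nat :=
  if pselect (exists n, ~~ `[< A (g ^+ n)%g >]) is left ex then ex_minn ex else 0.

(* [esc A 1 = 0], and [0^-1 = 0] makes this the right value at [g = 1]. *)
Definition escn A g : R := (esc A g)%:R^-1.

Lemma nss_escape g : g != 1%g -> exists n, ~ U0 (g ^+ n)%g.
Proof.
move=> g1; apply: contrapT => nex.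
have Hg n : U0 (g ^+ n)%g by apply: contrapT => ?; apply: nex; exists n.
(* Quotients of natural powers form the subgroup generated by [g], which would lie in [U0]. *)
pose H : set G := [set x | exists m n : nat, x = (g ^+ m / g ^+ n)%g].
have H1 : H 1%g by exists 0%N, 0%N; rewrite mulgV.
have HM x y : H x -> H y -> H (x * y)%g.
  move=> [m [n ->]] [m' [n' ->]]; exists (m + m')%N, (n' + n)%N.
  rewrite !expgnDr invgM -!mulgA; congr (_ * _)%g; rewrite !mulgA; congr (_ * _)%g.
  by apply: commute_sym; apply/commuteV; apply: commuteX2; exact: commute_refl.
have HV x : H x -> H x^-1%g.
  by move=> [m [n ->]]; exists n, m; rewrite invgF.
have HU : H `<=` U0.
  move=> _ [m [n ->]]; have [mn|/ltnW nm] := leqP m n; last by rewrite -expgnFr.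
  by rewrite -invgF -expgnFr //; exact: sU0.
have Hg1 : H g by exists 1%N, 0%N; rewrite expg1 expg0 divg1.
by have /= := nssU0 H1 HM HV HU Hg1; exact/eqP.
Qed.

Lemma esc1 A : A 1%g -> esc A 1%g = 0%N.
Proof.
move=> A1; rewrite /esc; case: pselect => // ex.
by exfalso; have [n] := ex; rewrite expg1n => /negP; apply; apply/asboolP.
Qed.

Lemma escP A g : A `<=` U0 -> g != 1%g ->
  ~ A (g ^+ esc A g)%g /\ forall i, (i < esc A g)%N -> A (g ^+ i)%g.
Proof.
move=> AU /nss_escape[m mU]; rewrite /esc; case: pselect => [ex|nex]; last first.
  exfalso; apply: nex; exists m; apply/asboolP => /AU; exact: mU.
case: ex_minnP => n /asboolP nA min; split=> // i ilt; apply: contrapT => nAi.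
by have := min i (introN (asboolP _) nAi); rewrite leqNgt ilt.
Qed.

Lemma esc_gt0 A g : A `<=` U0 -> A 1%g -> g != 1%g -> (0 < esc A g)%N.
Proof.
move=> AU A1 g1; have [+ _] := escP AU g1.
by rewrite lt0n; apply: contra_notN => /eqP->; rewrite expg0.
Qed.

Lemma esc_le A g n : A `<=` U0 -> g != 1%g -> ~ A (g ^+ n)%g -> (esc A g <= n)%N.
Proof.
by move=> AU g1 nA; rewrite leqNgt; apply/negP => /((escP AU g1).2 _).
Qed.

Lemma escn_ge0 A g : 0 <= escn A g.
Proof. by rewrite invr_ge0. Qed.

Lemma escn1 A : A 1%g -> escn A 1%g = 0.
Proof. by move=> A1; rewrite /escn esc1 // invr0. Qed.

Lemma escn_le1 A g : escn A g <= 1.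
Proof.
rewrite /escn; case: (esc A g) => [|n]; first by rewrite invr0.
by rewrite invf_le1 ?ltr0n // ler1n.
Qed.

Lemma escV A g : A `<=` U0 -> A 1%g -> symset A -> esc A g^-1%g = esc A g.
Proof.
move=> AU A1 sA; have [->|g1] := eqVneq g 1%g; first by rewrite invg1.
have half h : h != 1%g -> (esc A h^-1%g <= esc A h)%N.
  move=> h1; apply: esc_le => //; first by rewrite invg_eq1.
  by rewrite expVgn => /sA; rewrite invgK; exact: (escP AU h1).1.
apply/eqP; rewrite eqn_leq half //= -{1}(invgK g).
by apply: half; rewrite invg_eq1.
Qed.

Lemma escn_lt1 A g : A `<=` U0 -> A 1%g -> escn A g < 1 -> A g.
Proof.
move=> AU A1; have [->//|g1] := eqVneq g 1%g.
have e0 := esc_gt0 AU A1 g1; rewrite invf_lt1 ?ltr0n // ltr1n => e1.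
by have := (escP AU g1).2 _ e1; rewrite expg1.
Qed.

(** Each [g] in [U0] other than 1 has a power outside [U0], which is an open condition because [U0]
    is closed; near 1 the conclusion [V g] holds outright. Compactness of [U0] makes the exponent
    uniform. *)
Lemma nss_trap V : nbhs 1%g V -> exists k, (0 < k)%N /\
  forall g, (forall i, (i <= k)%N -> U0 (g ^+ i)%g) -> V g.
Proof.
move=> V1; have clU0 := compact_closed hG cU0.
have /compact_near_coveringP/(_ _ \oo
  (fun k g => V g \/ exists2 i, (i <= k)%N & ~ U0 (g ^+ i)%g) _) := cU0.
case.
  move=> g Ug; have [->|g1] := eqVneq g 1%g.
    exists (V, setT) => /=; first by split=> //; exact: filterT.
    by move=> [x k] /= [Vx _]; left.
  have [i ni] := nss_escape g1.
  exists ([set x | ~ U0 (x ^+ i)%g], [set k | (i <= k)%N]) => /=.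
    split; last by exists i.
    have : nbhs (g ^+ i)%g (~` U0).
      by apply: open_nbhs_nbhs; split => //; exact: closed_openC.
    by move/(cvgXg (F := nbhs g) (f := id) (n := i) cvg_id).
  by move=> [x k] /= [nx ik]; right; exists i.
move=> k0 _ Hk; exists k0.+1; split=> // g Hg.
have /= := Hk k0.+1 (leqnSn _) g; case; first by have := Hg 1%N isT; rewrite expg1.
  by [].
by move=> [i ik []]; exact: Hg.
Qed.

(** If [e] is the escape time from [V], then [g ^ e] is not trapped, so some [g ^ (e * i)] with
    [i <= k] leaves [U0] and hence [B]. The factor [k] does not depend on [B]. *)
Lemma escn_compare V : nbhs 1%g V -> V `<=` U0 ->
  exists2 k : R, 1 <= k & forall g B, B `<=` U0 -> B 1%g -> escn V g <= k * escn B g.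
Proof.
move=> V1 VU; have [k [k0 Hk]] := nss_trap V1.
have V11 := nbhs_singleton V1.
exists k%:R; first by rewrite ler1n.
move=> g B BU B1; have [->|g1] := eqVneq g 1%g; first by rewrite !escn1 // mulr0.
have eV := esc_gt0 VU V11 g1; have eB := esc_gt0 BU B1 g1.
rewrite /escn ler_pdivlMr ?ltr0n // ler_pdivrMl ?ltr0n // -natrM ler_nat.
have [i ik ni] : exists2 i, (i <= k)%N & ~ U0 (g ^+ (esc V g * i))%g.
  apply: contrapT => nex; apply: (escP VU g1).1; apply: Hk => i ik.
  by rewrite -expgnA; apply: contrapT => ?; apply: nex; exists i.
have /leq_trans : (esc B g <= esc V g * i)%N by apply: esc_le => // /BU.
by apply; rewrite leq_mul2l ik orbT.
Qed.

End Escape.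

(** * Differences of convolutions *)

Section Convolution.
Variables (R : realType) (G : topGroupType) (I : (G -> R) -> R).
Hypothesis HI : haar_functional I.
Implicit Types (f psi eta theta : G -> R) (g h x y : G).

Definition dl f g x := f (g^-1 * x)%g - f x.
Definition conv psi eta x := I (fun y => psi y * eta (y^-1 * x)%g).

Lemma Cc_conv psi eta x : Cc psi -> Cc eta -> Cc (fun y => psi y * eta (y^-1 * x)%g).
Proof.
move=> Cp [ce e0 _]; apply: CcM => // y.
apply: (continuous_comp (f := fun y => (y^-1 * x)%g) (g := eta)); last exact: ce.
by apply: cvgMg; [apply: cvgVg; exact: cvg_id|exact: cvg_cst].
Qed.

(** Left invariance shifts the translation onto [psi], so that a first difference in [g] is paid by
    [psi] and a second one in [h] is left for [eta]. *)
Lemma conv_transl psi eta g x : Cc psi -> Cc eta ->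
  conv psi eta (g^-1 * x)%g = I (fun y => psi (g^-1 * y)%g * eta (y^-1 * x)%g).
Proof.
case: HI => _ _ _ inv _ Cp Ce; rewrite /conv -(inv _ g); last exact: Cc_conv.
by congr I; apply/funext => y; rewrite invgM invgK -mulgA mulVKg.
Qed.

(** The functional is only controlled on nonnegative functions, so an estimate of signed differences
    is rearranged until both sides are sums of such functions. *)
Lemma haar_le_add f1 f2 f3 f4 theta (c : R) : Cc f1 -> Cc f2 -> Cc f3 -> Cc f4 -> Cc theta ->
  0 <= c -> (forall y, f1 y + f2 y <= f3 y + f4 y + c * theta y) ->
  I f1 + I f2 <= I f3 + I f4 + c * I theta.
Proof.
case: HI => add scale mono _ _ C1 C2 D1 D2 Ct c0 H.
rewrite -(scale theta) // -!add //; try exact: CcD; try exact: CcZ.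
apply: mono => //; first exact: CcD.
by apply: CcD; [exact: CcD|exact: CcZ].
Qed.

(* [dl (dl f g) h] only sees [psi] through [dl psi g] and [eta] through [dl eta]
   at conjugates of [h], whence a bound by the product. *)
Lemma conv_second_diff psi eta theta g h x (r s : R) :
  Cc psi -> Cc eta -> Cc theta -> 0 <= r -> 0 <= s ->
  (forall y, `|dl psi g y| <= r) ->
  (forall y, psi y != 0 \/ psi (g^-1 * y)%g != 0 ->
     1 <= theta y /\ forall z, `|eta ((h^-1 ^ y) * z)%g - eta z| <= s) ->
  `|dl (dl (conv psi eta) g) h x| <= r * s * I theta.
Proof.
move=> Cp Ce Ct r0 s0 Hp He.
have [_ t0 _] := Ct.
have Cpg := Cc_transl g Cp.
have -> : dl (dl (conv psi eta) g) h x =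
    I (fun y => psi (g^-1 * y)%g * eta (y^-1 * (h^-1 * x))%g)
    - I (fun y => psi y * eta (y^-1 * (h^-1 * x))%g)
    - (I (fun y => psi (g^-1 * y)%g * eta (y^-1 * x)%g)
    - I (fun y => psi y * eta (y^-1 * x)%g)).
  by rewrite /dl (conv_transl g (h^-1 * x)%g Cp Ce) (conv_transl g x Cp Ce).
have key y : `|(psi (g^-1 * y)%g - psi y) * (eta (y^-1 * (h^-1 * x))%g - eta (y^-1 * x)%g)|
    <= r * s * theta y.
  have [nz|] := pselect (psi y != 0 \/ psi (g^-1 * y)%g != 0).
    have [th es] := He y nz; rewrite normrM -[leLHS]mulr1.
    apply: ler_pM => //; try exact: mulr_ge0.
    apply: ler_pM => //; first exact: Hp.
    by have := es (y^-1 * x)%g; rewrite conjgE !mulgA mulgK.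
  move=> /not_orP[/negP/negPn/eqP -> /negP/negPn/eqP ->].
  by rewrite subrr mul0r normr0 !mulr_ge0.
have rs := mulr_ge0 r0 s0.
have C1 := Cc_conv (h^-1 * x)%g Cpg Ce; have C2 := Cc_conv x Cp Ce.
have C3 := Cc_conv (h^-1 * x)%g Cp Ce; have C4 := Cc_conv x Cpg Ce.
have H1 := haar_le_add C1 C2 C3 C4 Ct rs.
have H2 := haar_le_add C3 C4 C1 C2 Ct rs.
rewrite ler_norml; apply/andP; split.
  suff /H2 : forall y, psi y * eta (y^-1 * (h^-1 * x))%g + psi (g^-1 * y)%g * eta (y^-1 * x)%g
    <= psi (g^-1 * y)%g * eta (y^-1 * (h^-1 * x))%g + psi y * eta (y^-1 * x)%g
       + r * s * theta y by lra.
  by move=> y; have := key y; rewrite ler_norml => /andP[+ _]; rewrite mulrBl !mulrBr; lra.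
suff /H1 : forall y, psi (g^-1 * y)%g * eta (y^-1 * (h^-1 * x))%g + psi y * eta (y^-1 * x)%g
  <= psi y * eta (y^-1 * (h^-1 * x))%g + psi (g^-1 * y)%g * eta (y^-1 * x)%g
     + r * s * theta y by lra.
by move=> y; have := key y; rewrite ler_norml => /andP[_ +]; rewrite mulrBl !mulrBr; lra.
Qed.

Lemma conv_first_diff psi eta theta g x (r : R) :
  Cc psi -> Cc eta -> Cc theta -> 0 <= r -> (forall y, eta y <= 1) ->
  (forall y, `|dl psi g y| <= r) ->
  (forall y, psi y != 0 \/ psi (g^-1 * y)%g != 0 -> 1 <= theta y) ->
  `|dl (conv psi eta) g x| <= r * I theta.
Proof.
move=> Cp Ce Ct r0 e1 Hp He; have [_ t0 _] := Ct; have [_ e0 _] := Ce.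
have [add scale mono _ _] := HI; have Cpg := Cc_transl g Cp.
have key y : `|(psi (g^-1 * y)%g - psi y) * eta (y^-1 * x)%g| <= r * theta y.
  have [/He th|] := pselect (psi y != 0 \/ psi (g^-1 * y)%g != 0).
    rewrite normrM; apply: ler_pM => //; first exact: Hp.
    by rewrite ger0_norm //; apply: le_trans th.
  move=> /not_orP[/negP/negPn/eqP -> /negP/negPn/eqP ->].
  by rewrite subrr mul0r normr0 mulr_ge0.
have C1 := Cc_conv x Cpg Ce; have C2 := Cc_conv x Cp Ce; have C3 := CcZ r0 Ct.
rewrite /dl conv_transl // -scale // ler_norml /conv; apply/andP; split.
  rewrite lerBrDl lerBlDl -add //; apply: mono => //; first exact: CcD.
  by move=> y; have := key y; rewrite ler_norml => /andP[+ _]; rewrite mulrBl; lra.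
rewrite lerBlDl -add //; apply: mono => //; first exact: CcD.
by move=> y; have := key y; rewrite ler_norml => /andP[_ +]; rewrite mulrBl; lra.
Qed.

End Convolution.

(** * Lipschitz regularization of a bump along words *)

Section Regularization.
Variables (R : realType) (G : topGroupType) (U : set G) (kappa Q : G -> R) (M eps : R).
Hypotheses (k01 : forall x, 0 <= kappa x <= 1) (kU : forall x, kappa x != 0 -> U x).
Hypotheses (Q0 : forall g, 0 <= Q g) (QV : forall g, Q g^-1%g = Q g)
  (QU : forall g, Q g < 1 -> U g) (M0 : 0 <= M) (eps0 : 0 <= eps).

Definition cost (s : seq G) : R := \sum_(g <- s) (Q g + eps).
Definition gprod (s : seq G) : G := (\prod_(g <- s) g)%g.

Hypothesis MQ : forall s, Q (gprod s) <= M * cost s.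

(** [reg] is a sup-convolution of [kappa] with the word length [M * cost]. Prepending [g] to a word
    lowers its weight by at most [M * (Q g + eps)], so [reg] is Lipschitz for this length by
    construction. *)
Definition reg0 s x := Num.max 0 (1 - M * cost s) * kappa ((gprod s)^-1 * x)%g.
Definition reg x := sup [set reg0 s x | s in setT].

Let kge0 x : 0 <= kappa x. Proof. by have /andP[] := k01 x. Qed.
Let kle1 x : kappa x <= 1. Proof. by have /andP[] := k01 x. Qed.

Lemma cost_ge0 s : 0 <= cost s.
Proof. by rewrite /cost sumr_ge0 // => g _; rewrite addr_ge0. Qed.

Let reg0_ge0 s x : 0 <= reg0 s x.
Proof. by rewrite mulr_ge0 // le_max lexx. Qed.

Let max01 s : 0 <= Num.max 0 (1 - M * cost s) <= 1.
Proof.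
by rewrite le_max lexx /= ge_max ler01 gerBl mulr_ge0 // cost_ge0.
Qed.

Let reg0_le1 s x : reg0 s x <= 1.
Proof. by have /andP[? ?] := max01 s; rewrite -[leRHS]mulr1 ler_pM. Qed.

Lemma reg_ge s x : reg0 s x <= reg x.
Proof.
apply: ub_le_sup; last by exists s.
by exists 1 => _ [t _ <-].
Qed.

Lemma reg_le x c : (forall s, reg0 s x <= c) -> reg x <= c.
Proof.
move=> H; apply: ge_sup; first by exists (reg0 [::] x); exists [::].
by move=> _ [t _ <-].
Qed.

Lemma reg_ge_kappa x : kappa x <= reg x.
Proof.
have := reg_ge [::] x; rewrite /reg0 /cost /gprod !big_nil mulr0 subr0 invg1 mul1g.
by rewrite max_r // mul1r.
Qed.

Lemma reg_ge0 x : 0 <= reg x.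
Proof. exact: le_trans (kge0 x) (reg_ge_kappa x). Qed.

Lemma reg_le1 x : reg x <= 1.
Proof. exact: reg_le. Qed.

(** A word that contributes has [M * cost s < 1], so [MQ] gives its product a length below 1 and
    places it in [U]. *)
Lemma reg_supp x : reg x != 0 -> exists y z, [/\ U y, U z & x = (y * z)%g].
Proof.
apply: contra_neqP => nex; apply/eqP; rewrite eq_le reg_ge0 andbT.
apply: reg_le => s; apply: contrapT => /negP; rewrite -ltNge => pos; apply: nex.
have c1 : M * cost s < 1.
  rewrite ltNge; apply: contraL pos => c1.
  by rewrite /reg0 max_l ?mul0r ?ltxx // subr_le0.
have k0 : kappa ((gprod s)^-1 * x)%g != 0.
  by apply: contraTneq pos => k0; rewrite /reg0 k0 mulr0 ltxx.
exists (gprod s), ((gprod s)^-1 * x)%g; split; last by rewrite mulVKg.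
  exact/QU/(le_lt_trans (MQ s)).
exact: kU.
Qed.

Let reg_half g x : reg (g^-1 * x)%g <= reg x + M * (Q g + eps).
Proof.
apply: reg_le => s; rewrite -lerBlDr; apply: le_trans (reg_ge (g :: s) x).
rewrite /reg0 /cost /gprod !big_cons invgM -mulgA -/(cost s).
set k := kappa _; have k0 : 0 <= k := kge0 _; have k1 : k <= 1 := kle1 _.
have d0 : 0 <= M * (Q g + eps) by rewrite mulr_ge0 // addr_ge0.
apply: (@le_trans _ _ ((Num.max 0 (1 - M * cost s) - M * (Q g + eps)) * k)).
  by rewrite mulrBl lerD2l lerN2 ler_piMr.
rewrite ler_wpM2r // lerBlDr ge_max addr_ge0 ?le_max ?lexx //= -lerBlDr.
by rewrite le_max; apply/orP; right; lra.
Qed.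

Lemma reg_dl g x : `|dl reg g x| <= M * (Q g + eps).
Proof.
rewrite ler_norml /dl; apply/andP; split; last by rewrite lerBlDl reg_half.
by have := reg_half g^-1%g (g^-1 * x)%g; rewrite invgK mulVKg QV; lra.
Qed.

Lemma reg_continuous K : continuous kappa -> compact K -> supported kappa K ->
  continuous reg.
Proof.
move=> ck cK sK; apply: cvg_of_unif_right => e e0.
have := supported_unif_right ck cK sK e0; apply: filterS => h Hh z.
have half s z' : reg0 s (z' * h)%g <= reg0 s z' + e /\ reg0 s z' <= reg0 s (z' * h)%g + e.
  have /andP[m0 m1] := max01 s.
  have := Hh ((gprod s)^-1 * z')%g; rewrite ler_norml -mulgA /reg0 => /andP[].
  set m := Num.max _ _ in m0 m1 *; set u := kappa _; set v := kappa _ => l1 l2.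
  have : m * (u - v) <= m * e by rewrite ler_wpM2l //; lra.
  have : m * (v - u) <= m * e by rewrite ler_wpM2l //; lra.
  have : m * e <= e by rewrite ler_piMl // ltW.
  by split; lra.
rewrite ler_norml; apply/andP; split.
  rewrite lerBrDl lerBlDl.
  by apply: reg_le => s; have := (half s z).2; have := reg_ge s (z * h)%g; lra.
rewrite lerBlDl; apply: reg_le => s.
by have := (half s z).1; have := reg_ge s z; lra.
Qed.

End Regularization.

Lemma coord_le_rVnorm (R : realType) n (x : 'rV[R]_n) i : `|x 0 i| <= `|x|.
Proof.
rewrite [leRHS]mx_normrE.
exact: (le_bigmax _ (fun ij : 'I_1 * 'I_n => `|x ij.1 ij.2|) (0, i)).
Qed.

Lemma rVnorm_le (R : realType) n (x : 'rV[R]_n) c :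
  0 <= c -> (forall i, `|x 0 i| <= c) -> `|x| <= c.
Proof.
move=> c0 H; rewrite [leLHS]mx_normrE; apply: bigmax_le => // -[a b] _ /=.
by rewrite ord1.
Qed.

Record group_norm (R : realType) (G : topGroupType) (N : G -> R) : Prop := GroupNorm {
  gn_ge0 : forall g, 0 <= N g;
  gn1 : N 1%g = 0;
  gnV : forall g, N g^-1%g = N g;
  gnM : forall g h, N (g * h)%g <= N g + N h;
  gn_small : forall r, 0 < r -> \forall g \near (1%g : G), N g < r;
  gn_nbhs : forall W : set G, nbhs 1%g W -> exists2 r, 0 < r & forall g, N g < r -> W g }.

(** Plays the role of a logarithm near 1. *)
Record almost_hom (R : realType) (G : topGroupType) (N : G -> R) d (F : G -> 'rV[R]_d)
    (C r : R) : Prop := AlmostHom {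
  ah_C : 0 < C;
  ah_r : 0 < r;
  ahM : forall g h, N g < r -> N h < r -> `|F (g * h)%g - F g - F h| <= C * (N g * N h);
  ah_le : forall g, N g < r -> `|F g| <= C * N g;
  ah_ge : forall g, N g < r -> N g <= C * `|F g| }.

Ltac nonneg := repeat first [assumption | apply: mulr_ge0 | apply: addr_ge0].

(** * Gleason's estimates for escape lengths and the resulting norm *)

Section Gleason.
Variables (R : realType) (G : topGroupType) (U0 U : set G).
Hypotheses (hG : hausdorff_space G) (cU0 : compact U0) (sU0 : symset U0)
  (nssU0 : nss_set U0) (U1 : nbhs 1%g U) (sU : symset U) (UU0 : expset U 5 `<=` U0).
Implicit Types (f phi : G -> R) (g h x y : G).

Lemma expsetM m n x y : expset U m x -> expset U n y -> expset U (m + n) (x * y)%g.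
Proof.
elim: m x => [|m IH] x /=; first by move=> ->; rewrite mul1g.
move=> [a [b [Ua bm ->]]] yn; exists a, (b * y)%g; rewrite mulgA; split=> //; exact: IH.
Qed.

Lemma expset_mem x : U x -> expset U 1 x.
Proof. by move=> Ux; exists x, 1%g; rewrite mulg1. Qed.

Lemma expset_le m n : (m <= n)%N -> expset U m `<=` expset U n.
Proof.
have U11 := nbhs_singleton U1.
move=> mn; rewrite -(subnK mn); elim: (n - m)%N => [//|k IH] x /IH xk.
by exists 1%g, x; rewrite mul1g.
Qed.

Lemma expsetV n : symset (expset U n).
Proof.
elim: n => [x ->|n IH x]; first by rewrite /= invg1.
move=> [a [b [/sU/expset_mem Ua /IH bn ->]]]; rewrite invgM -addn1.
exact: expsetM.
Qed.

Let E n : set G := expset U n.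
Let EU0 n : (n <= 5)%N -> E n `<=` U0.
Proof. by move=> n5; apply: subset_trans UU0; exact: expset_le. Qed.
Let E1 n : E n 1%g.
Proof. by apply: (expset_le (leq0n n)). Qed.
Let UsubU0 : U `<=` U0.
Proof. by move=> x /expset_mem; exact: (@EU0 1). Qed.
Let U11 : U 1%g := nbhs_singleton U1.

Variables (I : (G -> R) -> R) (kappa theta : G -> R).
Hypotheses (HI : haar_functional I) (ck : continuous kappa)
  (k01 : forall x, 0 <= kappa x <= 1) (k1 : kappa 1%g = 1)
  (kU : forall x, kappa x != 0 -> U x) (Ct : Cc theta)
  (theta1 : forall x, U0 x -> 1 <= theta x).

Local Notation Q := (@escn R G U).
Let Q0 g : 0 <= Q g := escn_ge0 R U g.
Let Qle1 g : Q g <= 1 := escn_le1 R U g.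
Let QV g : Q g^-1%g = Q g.
Proof. by rewrite /escn (escV sU0 nssU0 g UsubU0 U11 sU). Qed.
Let QU g : Q g < 1 -> U g.
Proof. exact: (escn_lt1 sU0 nssU0 UsubU0 U11). Qed.
Let Q_out g : ~ U g -> Q g = 1.
Proof. by move=> nU; apply/eqP; rewrite eq_le Qle1 leNgt; apply/negP => /QU. Qed.

Let sk : supported kappa U0.
Proof.
move=> x nx; apply/eqP; apply: contra_notT nx => /kU; exact: UsubU0.
Qed.

Lemma Cc_kappa : Cc kappa.
Proof. by split=> //; [move=> x; have /andP[] := k01 x|exists U0]. Qed.

Let c1 := I theta.
Let c0 := conv I kappa kappa 1%g.

Lemma c0_gt0 : 0 < c0.
Proof.
case: HI => _ _ _ _ pos; apply: (pos _ 1%g); first exact: (Cc_conv _ Cc_kappa Cc_kappa).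
by rewrite mulg1 invg1 k1 mul1r.
Qed.

(** The left translate of [phi] by [g ^ n] differs from [phi] by [n] first differences along the
    orbit, each equal to [dl phi g x] up to a second difference. For bounded [phi] this gains a
    factor [1 / n]. *)
Lemma telescope phi g x n (t : R) : (forall i, (i < n)%N -> `|dl (dl phi g) (g ^+ i)%g x| <= t) ->
  n%:R * `|dl phi g x| <= `|phi ((g ^+ n)^-1 * x)%g - phi x| + n%:R * t.
Proof.
move=> H; suff : `|phi ((g ^+ n)^-1 * x)%g - phi x - n%:R * dl phi g x| <= n%:R * t.
  move=> h; rewrite -{1}(ger0_norm (ler0n R n)) -normrM.
  have -> : n%:R * dl phi g x = phi ((g ^+ n)^-1 * x)%g - phi x
    - (phi ((g ^+ n)^-1 * x)%g - phi x - n%:R * dl phi g x) by ring.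
  by apply: le_trans (ler_normB _ _) _; rewrite lerD2l.
elim: n H => [|n IH] H; first by rewrite expg0 invg1 mul1g subrr !mul0r subr0 normr0.
have {}IH := IH (fun i il => H i (leq_trans il (leqnSn n))).
have -> : phi ((g ^+ n.+1)^-1 * x)%g - phi x - n.+1%:R * dl phi g x =
  (phi ((g ^+ n)^-1 * x)%g - phi x - n%:R * dl phi g x) + dl (dl phi g) (g ^+ n)%g x.
  rewrite /dl expgSr invgM -mulgA -natr1; ring.
rewrite -natr1 mulrDl mul1r; apply: le_trans (ler_normD _ _) _.
by rewrite lerD // H.
Qed.

Lemma dl_list phi (w : G -> R) s x : (forall g x, `|dl phi g x| <= w g) ->
  `|phi ((gprod s)^-1 * x)%g - phi x| <= \sum_(g <- s) w g.
Proof.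
move=> H; elim: s x => [|g s IH] x; first by rewrite /gprod !big_nil invg1 mul1g subrr normr0.
rewrite /gprod !big_cons -/(gprod s) invgM -mulgA.
have -> : phi ((gprod s)^-1 * (g^-1 * x))%g - phi x =
  (phi ((gprod s)^-1 * (g^-1 * x))%g - phi (g^-1 * x)%g) + dl phi g x by rewrite /dl; ring.
by rewrite addrC; apply: le_trans (ler_normD _ _) _; rewrite lerD.
Qed.

Definition quasi_norm (eps M : R) := forall s, Q (gprod s) <= M * cost Q eps s.

Section RegularizedBump.
Variables (eps M : R) (eta : G -> R).
Hypotheses (eps0 : 0 <= eps) (M0 : 0 <= M) (QM : quasi_norm eps M)
  (Ceta : Cc eta) (eta1 : forall x, eta x <= 1) (keta : forall x, kappa x <= eta x).

Let psi := reg kappa Q M eps.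
(** [eta] stays a parameter: it is [kappa] while the constant [M] is being improved, and [psi]
    itself for the final bump. *)
Let phi := conv I psi eta.

Lemma reg_E2 x : psi x != 0 -> E 2 x.
Proof.
move=> /(reg_supp k01 kU Q0 QU M0 eps0 QM)[y [z [Uy Uz ->]]].
by apply: (@expsetM 1 1); exact: expset_mem.
Qed.

Lemma Cc_reg : Cc psi.
Proof.
split; first exact: (reg_continuous k01 Q0 M0 eps0 ck cU0 sk).
  by move=> x; exact: (reg_ge0 k01 Q0 M0 eps0).
exists U0 => // x nx; apply/eqP; apply: contra_notT nx => /reg_E2; exact: EU0.
Qed.

Lemma reg_near_supp g y : U g -> psi y != 0 \/ psi (g^-1 * y)%g != 0 -> U0 y.
Proof.
move=> Ug [/reg_E2|/reg_E2 Ey]; first exact: EU0.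
rewrite -(mulVKg g y); apply: (@EU0 3) => //.
by apply: (@expsetM 1 2) => //; exact: expset_mem.
Qed.

Let eta0 x : 0 <= eta x. Proof. by case: Ceta. Qed.

Lemma bump_ge0 x : 0 <= phi x.
Proof.
case: HI => _ scale mono _ _; have C := Cc_conv x Cc_reg Ceta.
have [_ p0 _] := C; have := scale _ 0 C (lexx 0); rewrite mul0r => <-.
by apply: mono => //; [exact: CcZ|move=> y; rewrite mul0r].
Qed.

Lemma bump_le x : phi x <= c1.
Proof.
case: HI => _ scale mono _ _; apply: mono => //; first exact: Cc_conv _ Cc_reg Ceta.
move=> y; have [_ t0 _] := Ct; have [->|/reg_E2/(@EU0 2 isT)/theta1] := eqVneq (psi y) 0.
  by rewrite mul0r.
apply: le_trans; rewrite -[leRHS]mulr1 ler_pM //.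
  exact: (reg_ge0 k01 Q0 M0 eps0).
exact: (reg_le1 k01 Q0 M0 eps0).
Qed.

Lemma bump_1 : c0 <= phi 1%g.
Proof.
case: HI => _ scale mono _ _; have Ck := Cc_kappa.
apply: mono; [exact: Cc_conv|exact: Cc_conv _ Cc_reg Ceta|move=> y].
have /andP[? ?] := k01 y; have /andP[? ?] := k01 (y^-1 * 1)%g.
by apply: ler_pM => //; exact: (reg_ge_kappa k01 Q0 M0 eps0).
Qed.

Lemma bump_supp n x : (forall y, eta y != 0 -> E n y) -> phi x != 0 -> E (2 + n) x.
Proof.
move=> etan; apply: contra_neqP => nx; rewrite /phi /conv.
have -> : (fun y => psi y * eta (y^-1 * x)%g) = (fun y => 0 * theta y).
  apply/funext => y; rewrite mul0r; apply/eqP; rewrite mulf_eq0; apply/negPn/negP.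
  rewrite negb_or => /andP[/reg_E2 E2y /etan Eny]; apply: nx.
  by rewrite -(mulVKg y x); exact: expsetM.
by case: HI => _ scale _ _ _; rewrite scale // mul0r.
Qed.

Lemma bump_second_diff g h x (s : R) : U g -> 0 <= s ->
  (forall y, U0 y -> forall z, `|eta ((h^-1 ^ y) * z)%g - eta z| <= s) ->
  `|dl (dl phi g) h x| <= M * (Q g + eps) * s * c1.
Proof.
move=> Ug s0 He.
apply: (@conv_second_diff R G I HI psi eta theta g h x (M * (Q g + eps)) s) => //.
- exact: Cc_reg.
- by rewrite mulr_ge0 // addr_ge0.
- exact: (reg_dl k01 Q0 QV M0 eps0).
- by move=> y /(reg_near_supp Ug) U0y; split; [exact: theta1|exact: He].
Qed.

Lemma bump_first_diff g x : U g -> `|dl phi g x| <= M * (Q g + eps) * c1.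
Proof.
move=> Ug.
apply: (@conv_first_diff R G I HI psi eta theta g x (M * (Q g + eps))) => //.
- exact: Cc_reg.
- by rewrite mulr_ge0 // addr_ge0.
- exact: (reg_dl k01 Q0 QV M0 eps0).
- by move=> y /(reg_near_supp Ug) U0y; exact: theta1.
Qed.

Lemma bump_diff_le x y : `|phi x - phi y| <= c1.
Proof.
have := bump_ge0 x; have := bump_ge0 y; have := bump_le x; have := bump_le y.
by move=> *; rewrite ler_norml; apply/andP; split; lra.
Qed.

End RegularizedBump.

Let c1_gt0 : 0 < c1.
Proof.
have [_ t0 _] := Ct; case: HI => _ _ _ _ pos; apply: (pos _ 1%g) => //.
exact: lt_le_trans ltr01 (theta1 (UsubU0 U11)).
Qed.

Lemma cost_nseq (eps : R) s m : cost Q eps (flatten (nseq m s)) = m%:R * cost Q eps s.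
Proof.
rewrite /cost big_flatten /= big_nseq; elim: m => [|m IH]; first by rewrite mul0r.
by rewrite iterS IH -natr1 mulrDl mul1r addrC.
Qed.

Lemma gprod_nseq (s : seq G) m : gprod (flatten (nseq m s)) = (gprod s ^+ m)%g.
Proof.
rewrite /gprod big_flatten /= big_nseq; elim: m => [//|m IH].
by rewrite iterS IH expgS.
Qed.

(** Telescoping over the powers of [g] until it escapes a small [W] bounds [dl phi g] by a multiple
    of the escape length from [W], free of [M], plus second differences that carry the factor
    [M * d]. The modulus of continuity [d] of [kappa] is at disposal, so the part proportional to
    [M] can be halved, with [C] independent of [eps] and [M]. *)
Lemma gleason_step : exists2 C, 0 <= C & forall eps M, 0 <= eps -> 0 <= M ->
  quasi_norm eps M -> quasi_norm eps (C + M / 2).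
Proof.
have E3U0 := @EU0 3 isT.
have [k3 k31 Hk3] := escn_compare R hG cU0 sU0 nssU0 U1 UsubU0.
have k30 : 0 < k3 := lt_le_trans ltr01 k31.
have c00 := c0_gt0.
(* Makes [k3 * (c1 * d * M) / c0] equal to [M / 2]. *)
pose d := c0 / (2 * k3 * c1).
have d0 : 0 < d by rewrite divr_gt0 // !mulr_gt0.
have W1 := supported_unif_left ck cU0 sk cU0 d0.
set W0 := fun h : G => _ in W1.
pose W := [set h | [/\ W0 h^-1%g, U h & True]].
have nW : nbhs 1%g W by apply: filterS2 (nbhs1_inv W1) U1 => h Wh Uh; split.
have WU0 : W `<=` U0 by move=> h [_ /UsubU0].
have [kW kW1 HkW] := escn_compare R hG cU0 sU0 nssU0 nW WU0.
have W11 := nbhs_singleton nW.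
have kW0 : 0 <= kW := le_trans ler01 kW1.
have k3n := ltW k30; have c0n := ltW c00; have c1n := ltW c1_gt0; have dn := ltW d0.
exists (k3 * (c1 * kW) / c0).
  by rewrite divr_ge0 //; nonneg.
move=> eps M eps0 M0 QM.
have Ck := Cc_kappa; have kle x : kappa x <= 1 by have /andP[] := k01 x.
have krefl x : kappa x <= kappa x by [].
pose phi := conv I (reg kappa Q M eps) kappa.
pose M1 := c1 * kW + c1 * d * M.
have M10 : 0 <= M1 by nonneg.
have first_diff g x : `|dl phi g x| <= M1 * (Q g + eps).
  have c1k : c1 * escn R W g <= c1 * kW * Q g by rewrite -mulrA ler_wpM2l // HkW.
  have rest : 0 <= c1 * kW * eps + c1 * d * M * (Q g + eps).
    by have := Q0 g => q0; nonneg.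
  have [->|g1] := eqVneq g 1%g.
    by rewrite /dl invg1 mul1g subrr normr0 mulr_ge0 // addr_ge0.
  (* Outside [U] the length [Q g] is 1 and the oscillation bound [c1] suffices, because
     [kW >= 1]. *)
  have [Ug|nUg] := pselect (U g); last first.
    have := bump_diff_le eps0 M0 QM Ck kle (g^-1 * x)%g x.
    rewrite -/phi -/(dl phi g x) => /le_trans; apply.
    rewrite /M1 mulrDl mulrDr Q_out // mulr1 -addrA; rewrite Q_out // in rest.
    by rewrite -[leLHS]addr0 lerD // ler_peMr.
  have en0 := esc_gt0 sU0 nssU0 WU0 W11 g1.
  have [_ eW] := escP sU0 nssU0 WU0 g1.
  have := @telescope phi g x (esc W g) (M * (Q g + eps) * d * c1).
  have step i : (i < esc W g)%N -> `|dl (dl phi g) (g ^+ i)%g x| <= M * (Q g + eps) * d * c1.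
    move=> /eW[Wi _ _]; apply: (bump_second_diff eps0 M0 QM Ck x Ug (ltW d0)) => y Uy z.
    exact: Wi.
  move=> /(_ step) tel.
  have n0 : 0 < (esc W g)%:R :> R by rewrite ltr0n.
  have : (esc W g)%:R * `|dl phi g x| <= c1 + (esc W g)%:R * (M * (Q g + eps) * d * c1).
    apply: le_trans tel _; rewrite lerD2r.
    exact: (bump_diff_le eps0 M0 QM Ck kle).
  rewrite -ler_pdivlMl // mulrDr mulKf ?gt_eqF // => /le_trans; apply.
  rewrite mulrC -/(escn R W g) /M1.
  have : 0 <= c1 * kW * eps by nonneg.
  lra.
(* A word this cheap cannot bring [phi] from at least [c0] at 1 down to 0, so the inverse of its
   product is still in the support. *)
have trap s : M1 * cost Q eps s < c0 -> E 3 (gprod s).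
  move=> lt0; have := @dl_list phi (fun g => M1 * (Q g + eps)) s 1%g first_diff.
  rewrite -mulr_sumr -/(cost Q eps s) mulg1 ler_norml => /andP[lo _].
  have b1 := bump_1 eps0 M0 QM Ck krefl; rewrite -/phi in b1.
  have : phi (gprod s)^-1%g != 0 by rewrite gt_eqF //; lra.
  move=> /(bump_supp eps0 M0 QM (fun y ky => expset_mem (kU ky))) /expsetV.
  by rewrite invgK.
move=> s; have [->|p1] := eqVneq (gprod s) 1%g.
  rewrite escn1 // mulr_ge0 ?cost_ge0 // addr_ge0 // divr_ge0 //; nonneg.
have e0 := esc_gt0 sU0 nssU0 E3U0 (E1 3) p1.
(* Repeating the word [m] times multiplies its cost by [m] and raises its product to the power [m],
   which therefore stays in [E 3] as long as [m * (M1 * cost)] is below [c0]. *)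
have key : c0 <= (esc (E 3) (gprod s))%:R * (M1 * cost Q eps s).
  rewrite leNgt; apply/negP => lt0; apply: (escP sU0 nssU0 E3U0 p1).1.
  rewrite -gprod_nseq; apply: trap; rewrite cost_nseq mulrCA; exact: lt0.
apply: le_trans (Hk3 (gprod s) _ E3U0 (E1 3)) _.
have n0 : 0 < (esc (E 3) (gprod s))%:R :> R by rewrite ltr0n.
have : escn R (E 3) (gprod s) <= M1 * cost Q eps s / c0.
  by rewrite ler_pdivlMr // /escn ler_pdivrMl.
move=> /(ler_wpM2l (ltW k30)) /le_trans; apply.
rewrite le_eqVlt; apply/orP; left; apply/eqP; rewrite /M1 /d.
by field; rewrite !gt_eqF.
Qed.

Lemma quasi_norm_bounded : exists2 C, 0 <= C & quasi_norm 0 C.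
Proof.
have [C C0 step] := gleason_step.
exists (2 * C); first by rewrite mulr_ge0.
have bound eps : 0 < eps -> quasi_norm eps (2 * C).
  move=> e0; have e0' := ltW e0; have cge := cost_ge0 Q0 e0'.
  pose T : set R := [set M | 0 <= M /\ quasi_norm eps M].
  (* [Q] is at most 1 and a nonempty word costs at least [eps]. *)
  have Ti : T eps^-1.
    split; first by rewrite invr_ge0 ltW.
    move=> [|g s]; first by rewrite /gprod big_nil escn1 // mulr_ge0 ?invr_ge0.
    apply: le_trans (Qle1 _) _; rewrite ler_pdivlMl // mulr1 /cost big_cons -/(cost Q eps s).
    by rewrite addrAC lerDr addr_ge0.
  have lbT : has_lbound T by exists 0 => M [].
  have m0 : 0 <= inf T by apply: lb_le_inf; [exists eps^-1|move=> M []].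
  (* The infimum is itself admissible, so the step applies to it and gives
     [inf T <= C + inf T / 2]. *)
  have Tm : T (inf T).
    split=> // s; have := cge s; rewrite le_eqVlt => /predU1P[s0|s0].
      by have := Ti.2 s; rewrite -s0 !mulr0.
    rewrite -ler_pdivrMr //; apply: lb_le_inf; first by exists eps^-1.
    by move=> M [_ QM]; rewrite ler_pdivrMr.
  have Ts : T (C + inf T / 2).
    by split; [rewrite addr_ge0 // divr_ge0|exact: step Tm.2].
  have := ge_inf lbT Ts => le; move=> s; apply: le_trans (Tm.2 s) _.
  by rewrite ler_wpM2r //; lra.
move=> s; apply/ler_addgt0Pr => e e0.
(* For a fixed word, [eps] is taken so small against its length that the additional cost contributes
   at most [e]. *)
have k0 : 0 < 2 * C * (size s)%:R + 1 by rewrite ltr_wpDl // !mulr_ge0.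
have := bound (e / (2 * C * (size s)%:R + 1)) (divr_gt0 e0 k0) s.
have -> : forall eps, cost Q eps s = cost Q 0 s + eps * (size s)%:R.
  move=> eps; rewrite /cost; elim: s {k0} => [|g s IH] /=.
    by rewrite !big_nil mulr0 addr0.
  by rewrite !big_cons IH -natr1; ring.
move=> /le_trans; apply; rewrite mulrDr lerD2l.
rewrite [leLHS](_ : _ = e * ((2 * C * (size s)%:R) / (2 * C * (size s)%:R + 1))).
  by rewrite ger_pMr // ler_pdivrMr // mul1r lerDl.
by field; rewrite gt_eqF.
Qed.

(** Let [V] collect the elements of [U] whose conjugates by [U0] all lie in [U]. Powers commute with
    conjugation, so [h ^ y] escapes [U] no earlier than [h] escapes [V], and [escn_compare] relates
    [V] to [U]. *)
Lemma conj_escn : exists2 k : R, 0 <= k & forall h y, U0 y -> Q (h ^ y)%g <= k * Q h.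
Proof.
have : \forall h \near (1%g : G), U0 `<=` fun y => U (h ^ y)%g.
  have /compact_near_coveringP/(_ _ (nbhs (1%g : G)) (fun h y => U (h ^ y)%g) _) := cU0.
  apply=> y _ /=.
  suff : (fun q : G * G => q.2 ^ q.1)%g @ nbhs (y, 1%g : G) --> (1 ^ y)%g.
    by rewrite conj1g => /(_ _ U1).
  have h1 : (fun q : G * G => q.1) @ nbhs (y, 1%g : G) --> y by exact: cvg_fst.
  apply: cvgMg; first exact: (cvgVg h1).
  by apply: cvgMg => //; exact: cvg_snd.
move=> HV; pose V : set G := [set h | U h /\ U0 `<=` fun y => U (h ^ y)%g].
have V1 : nbhs 1%g V by apply: filterS2 U1 HV => h.
have VU0 : V `<=` U0 by move=> h [/UsubU0].
have [k k_1 Hk] := escn_compare R hG cU0 sU0 nssU0 V1 VU0.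
exists k; first exact: le_trans ler01 k_1.
move=> h y Uy; apply: le_trans (Hk h U UsubU0 U11).
have V11 := nbhs_singleton V1.
have [->|h1] := eqVneq h 1%g; first by rewrite conj1g !escn1.
have hy1 : (h ^ y)%g != 1%g by rewrite conjg_eq1.
rewrite /escn lef_pV2 ?posrE ?ltr0n ?(esc_gt0 sU0 nssU0 _ _ h1) ?(esc_gt0 sU0 nssU0 _ _ hy1) //.
rewrite ler_nat leqNgt; apply/negP => lt.
apply: (escP sU0 nssU0 UsubU0 hy1).1; rewrite -conjXg.
by have [_ /(_ y Uy)] := (escP sU0 nssU0 VU0 h1).2 _ lt.
Qed.

(** With [eps = 0] and both factors of the convolution equal to the Lipschitz function [psi], a
    second difference picks up [Q g] from one factor and, through [conj_escn], [Q h] from the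
    other. *)
Lemma group_norm_exists : exists N : G -> R, group_norm N /\
  exists d (F : G -> 'rV[R]_d) C r, almost_hom N F C r.
Proof.
have [M M0 QM] := quasi_norm_bounded.
have [kc kc0 Hkc] := conj_escn.
have e0 := lexx (0 : R).
pose psi := reg kappa Q M 0; pose phi := conv I psi psi.
have Cpsi : Cc psi by exact: Cc_reg.
have psi1 x : psi x <= 1 by exact: (reg_le1 k01 Q0 M0 e0).
have kpsi x : kappa x <= psi x by exact: (reg_ge_kappa k01 Q0 M0 e0).
have c1n := ltW c1_gt0.
have c0p := c0_gt0; have c1p := c1_gt0.
have b1 : c0 <= phi 1%g := bump_1 e0 M0 QM Cpsi kpsi.
have bdiff x y : `|phi x - phi y| <= c1 := bump_diff_le e0 M0 QM Cpsi psi1 x y.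
have supp x : phi x != 0 -> E 4 x.
  exact: (bump_supp e0 M0 QM (fun y => @reg_E2 0 M e0 M0 QM y)).
pose K := M ^+ 2 * kc * c1.
have K0 : 0 <= K by rewrite /K expr2; nonneg.
have second g h x : U g -> `|dl (dl phi g) h x| <= K * (Q g * Q h).
  move=> Ug; have MQh : 0 <= M * (kc * Q h) by have := Q0 h => ?; nonneg.
  have : forall y, U0 y -> forall z, `|psi ((h^-1 ^ y) * z)%g - psi z| <= M * (kc * Q h).
    move=> y Uy z; rewrite conjVg -/(dl psi (h ^ y)%g z).
    apply: le_trans (reg_dl k01 Q0 QV M0 e0 _ _) _.
    by rewrite addr0 ler_wpM2l // Hkc.
  move/(bump_second_diff e0 M0 QM Cpsi x Ug MQh); rewrite addr0 => /le_trans; apply.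
  by rewrite /K le_eqVlt; apply/orP; left; apply/eqP; ring.
pose L := (M + 1) * c1.
have L0 : 0 < L by rewrite mulr_gt0 // ltr_wpDl.
have first g x : `|dl phi g x| <= L * Q g.
  have [Ug|nUg] := pselect (U g); last first.
    rewrite Q_out // mulr1; apply: le_trans (bdiff _ _) _.
    by rewrite /L mulrDl mul1r lerDr mulr_ge0.
  apply: le_trans (bump_first_diff e0 M0 QM Cpsi psi1 x Ug) _.
  by rewrite addr0 /L mulrAC ler_wpM2r // ler_wpM2r // lerDl.
pose N g := sup [set `|dl phi g x| | x in setT].
have dlN g x : `|dl phi g x| <= N g.
  apply: ub_le_sup; last by exists x.
  by exists (L * Q g) => _ [y _ <-].
have Nle g c : (forall x, `|dl phi g x| <= c) -> N g <= c.
  move=> H; apply: ge_sup; first by exists `|dl phi g 1%g|; exists 1%g.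
  by move=> _ [x _ <-].
have Nge0 g : 0 <= N g := le_trans (normr_ge0 _) (dlN g 1%g).
have NQ g : N g <= L * Q g by exact: Nle.
have NV g : N g^-1%g = N g.
  have half k : N k^-1%g <= N k.
    apply: Nle => x; have := dlN k (k * x)%g.
    by rewrite /dl mulKg invgK distrC.
  by apply/eqP; rewrite eq_le half -{1}(invgK g) half.
have NM g h : N (g * h)%g <= N g + N h.
  apply: Nle => x; rewrite /dl invgM -mulgA.
  have -> : phi (h^-1 * (g^-1 * x))%g - phi x = dl phi h (g^-1 * x)%g + dl phi g x.
    by rewrite /dl; ring.
  by rewrite addrC; apply: le_trans (ler_normD _ _) _; rewrite lerD.
have N1 : N 1%g = 0.
  by apply/eqP; rewrite eq_le Nge0 andbT; have := NQ 1%g; rewrite escn1 // mulr0.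
have NX g n : N (g ^+ n)%g <= n%:R * N g.
  elim: n => [|n IH]; first by rewrite expg0 N1 mul0r.
  by rewrite expgS -natr1 mulrDl mul1r addrC; apply: le_trans (NM _ _) _; rewrite lerD.
have E4U0 := @EU0 4 isT.
have [k4 k41 Hk4] := escn_compare R hG cU0 sU0 nssU0 U1 UsubU0.
have k40 : 0 <= k4 := le_trans ler01 k41.
(* [phi] is at least [c0] at 1 and vanishes at [g ^ e], where [e] is the escape time from [E 4];
   hence [c0 <= N (g ^ e) <= e * N g]. *)
have QN g : Q g <= k4 / c0 * N g.
  apply: le_trans (Hk4 g _ E4U0 (E1 4)) _; rewrite -mulrA ler_wpM2l //.
  have [->|g1] := eqVneq g 1%g; first by rewrite escn1 // N1 mulr0.
  have en0 : 0 < (esc (E 4) g)%:R :> R by rewrite ltr0n (esc_gt0 sU0 nssU0 E4U0 (E1 4) g1).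
  rewrite /escn mulrC ler_pdivlMr // ler_pdivrMl //.
  apply: le_trans (NX g _); rewrite -NV; apply: le_trans (dlN _ 1%g).
  rewrite /dl invgK mulg1.
  have -> : phi (g ^+ esc (E 4) g)%g = 0.
    apply/eqP; apply: contra_notT (escP sU0 nssU0 E4U0 g1).1; exact: supp.
  by rewrite sub0r normrN; apply: le_trans b1 _; exact: ler_norm.
pose k := k4 / c0; have k0 : 0 < k by rewrite divr_gt0 // (lt_le_trans ltr01).
have NU g : N g < k^-1 -> U g.
  move=> Ng; apply: QU; apply: le_lt_trans (QN g) _.
  by rewrite -/k -ltr_pdivlMl // mulr1.
(* If the powers of [g] up to [n] stay in [U] then [Q g < 1 / n], and finitely many powers are
   controlled by continuity at 1. *)
have small r : 0 < r -> \forall g \near (1%g : G), N g < r.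
  move=> r0; have [n rn] : exists n, L / r < n%:R.
    by exists (Num.truncn (L / r)).+1; exact: truncnS_gt.
  have : \forall g \near (1%g : G), forall i : 'I_n.+1, U (g ^+ i)%g.
    apply: filter_forall => i.
    have : nbhs (1 ^+ i)%g U by rewrite expg1n.
    by move/(cvgXg (F := nbhs (1%g : G)) (f := id) (n := i) cvg_id).
  apply: filterS => g Hg; apply: le_lt_trans (NQ g) _.
  have [->|g1] := eqVneq g 1%g; first by rewrite escn1 // mulr0.
  have n_e : (n < esc U g)%N.
    rewrite ltnNge; apply/negP => en; apply: (escP sU0 nssU0 UsubU0 g1).1.
    exact: (Hg (Ordinal (en : (esc U g < n.+1)%N))).
  rewrite /escn ltr_pdivrMr ?ltr0n ?(leq_ltn_trans _ n_e) // -ltr_pdivrMl // mulrC.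
  by apply: lt_trans rn _; rewrite ltr_nat.
exists N; split.
  split=> //.
  - move=> W W1; have [m [m0 Hm]] := nss_trap hG cU0 sU0 nssU0 W1.
    have m1 : 0 < m%:R :> R by rewrite ltr0n.
    exists (k * m%:R)^-1; first by rewrite invr_gt0 mulr_gt0.
    move=> g Ng; have [->|g1] := eqVneq g 1%g; first exact: nbhs_singleton W1.
    apply: Hm => i im; apply: UsubU0; apply: (escP sU0 nssU0 UsubU0 g1).2.
    apply: leq_ltn_trans im _.
    have := le_lt_trans (QN g) (_ : _ < m%:R^-1); rewrite -/k.
    rewrite /escn ltf_pV2 ?posrE ?ltr0n ?(esc_gt0 sU0 nssU0 UsubU0 U11 g1) // ltr_nat.
    by apply; rewrite -ltr_pdivlMl // -invfM mulrC mulrC.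
pose C2 := K * k ^+ 2.
have C20 : 0 <= C2 by rewrite mulr_ge0 // exprn_ge0 // ltW.
have secondN g h x : U g -> `|dl (dl phi g) h x| <= C2 * (N g * N h).
  move=> Ug; apply: le_trans (second g h x Ug) _.
  rewrite /C2 -mulrA ler_wpM2l // expr2 mulrACA; apply: ler_pM => //; exact: QN.
(* Sampling scale: a move of the sample point of [N]-size [d] changes [dl phi g] by at most
   [C2 * d * N g <= N g / 2], so the samples determine [N g] up to a factor 2. *)
pose d := 1 / (2 * (C2 + 1)).
have d0 : 0 < d by rewrite divr_gt0 // mulr_gt0 // ltr_wpDl.
have [r Hr] := finite_translates cU0 (small d d0).
(* The sample points are inverted because [finite_translates] makes a right factor [y^-1 * x] small,
   whereas [dl] compares points that differ by a left factor. *)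
pose F g : 'rV[R]_(size r) := \row_(i < size r) dl phi g (nth 1%g r i)^-1%g.
exists (size r), F, (C2 + 2), k^-1; split.
- by rewrite ltr_wpDl.
- by rewrite invr_gt0.
- move=> g h Ng Nh; apply: rVnorm_le; first by rewrite mulr_ge0 ?mulr_ge0 // addr_ge0.
  move=> i; rewrite !mxE; set x := (_^-1)%g.
  have -> : dl phi (g * h)%g x - dl phi g x - dl phi h x = dl (dl phi h) g x.
    by rewrite /dl invgM -mulgA; ring.
  apply: le_trans (secondN h g x (NU h Nh)) _.
  by rewrite [N h * _]mulrC ler_wpM2r ?mulr_ge0 // lerDl.
- move=> g Ng; apply: rVnorm_le; first by rewrite mulr_ge0 // addr_ge0.
  move=> i; rewrite mxE; apply: le_trans (dlN _ _) _.
  by rewrite ler_peMl // -[leLHS]add0r lerD // ler1n.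
- move=> g Ng; have Ug := NU g Ng.
  suff : N g <= `|F g| + N g / 2.
    have : 0 <= C2 * `|F g| by rewrite mulr_ge0.
    by have := normr_ge0 (F g); lra.
  apply: Nle => x; have [U0x|nU0x] := pselect (U0 x); last first.
    rewrite /dl.
    have -> : phi x = 0 by apply/eqP; apply: contra_notT nU0x => /supp; exact: E4U0.
    have -> : phi (g^-1 * x)%g = 0.
      apply/eqP; apply: contra_notT nU0x => /supp Ex; rewrite -(mulVKg g x).
      by apply: (@EU0 5) => //; apply: (@expsetM 1 4) => //; exact: expset_mem.
    by rewrite subrr normr0 addr_ge0 ?divr_ge0.
  have [y yr /= Ny] := Hr _ (sU0 U0x).
  have yi : (index y r < size r)%N by rewrite index_mem.
  have dF : `|dl phi g y^-1%g| <= `|F g|.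
    have := coord_le_rVnorm (F g) (Ordinal yi).
    by rewrite mxE /= nth_index.
  have -> : dl phi g x = dl phi g y^-1%g + dl (dl phi g) (y^-1 * x^-1)%g y^-1%g.
    by rewrite {3}/dl invgM !invgK mulgK; ring.
  apply: le_trans (ler_normD _ _) _; rewrite lerD //.
  apply: le_trans (secondN g _ _ Ug) _; rewrite mulrCA ler_wpM2l //.
  apply: (@le_trans _ _ (C2 * d)); first by rewrite ler_wpM2l // ltW.
  rewrite /d mulrA mulr1 ler_pdivrMr ?mulr_gt0 ?ltr_wpDl // mulrA mulVf ?mul1r ?lerDl //.
Qed.

End Gleason.

Lemma nss_setS (G : topGroupType) (A B : set G) : A `<=` B -> nss_set B -> nss_set A.
Proof. by move=> AB nB H H1 HM HV HA; apply: nB => // x /HA; exact: AB. Qed.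

Lemma expsetS (G : topGroupType) (A B : set G) n : A `<=` B -> expset A n `<=` expset B n.
Proof.
move=> AB; elim: n => [//|n IH] _ [a [b [Aa bn ->]]].
by exists a, b; split=> //; [exact: AB|exact: IH].
Qed.

Lemma nss_group_norm (R : realType) (G : topGroupType) (K0 W : set G) :
  hausdorff_space G -> compact K0 -> nbhs 1%g K0 -> nbhs 1%g W -> nss_set W ->
  exists N : G -> R, group_norm N /\
  exists d (F : G -> 'rV[R]_d) C r, almost_hom N F C r.
Proof.
move=> hG cK0 K01 W1 nssW.
have [f [cf f01 f1 fW]] := bump_function R hG cK0 K01 W1.
pose A : set G := K0 `&` [set x | 1 / 2 <= f x].
have A1 : nbhs 1%g A.
  by apply: filterI => //; apply: (cvgr_ge (f 1%g) (cf 1%g)); rewrite f1; lra.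
have cA : compact A.
  apply: compact_closedI => //.
  have := (iffLR (continuous_closedP f)) cf _ (@closed_ge R (1 / 2)).
  exact.
have AW : A `<=` W.
  by move=> x [_ /= fx]; apply: fW; rewrite gt_eqF //; lra.
pose U0 : set G := A `&` (fun x => x^-1%g) @` A.
have imE : (fun x : G => x^-1%g) @` A = [set x | A x^-1%g].
  by rewrite predeqE => x; split=> [[y Ay <-]|Ax] /=; rewrite ?invgK //; exists x^-1%g; rewrite ?invgK.
have cU0 : compact U0.
  apply: compact_closedI => //; apply: compact_closed => //.
  apply: continuous_compact => //; apply: continuous_subspaceT; exact: invg_continuous.
have U01 : nbhs 1%g U0 by apply: filterI => //; rewrite imE; exact: nbhs1_inv.
have sU0 : symset U0.
  by move=> x; rewrite /U0 imE /= => -[Ax Ax']; split=> //=; rewrite invgK.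
have nU0 : nss_set U0 by apply: nss_setS nssW => x [/AW].
(* The regularized bump lives on [expset U 2], its convolution square on [expset U 4], and a
   translation by an element of [U] takes a fifth factor. *)
have [V [V1 VU0]] := nbhs1_exp 5 U01.
pose U : set G := V `&` [set x | V x^-1%g].
have U1 : nbhs 1%g U by apply: filterI => //; exact: nbhs1_inv.
have sU : symset U by move=> x [Vx Vx']; split=> //=; rewrite invgK.
have UU0 : expset U 5 `<=` U0.
  by apply: subset_trans VU0; apply: expsetS => x [].
have [I HI] := haar_exists R hG cK0 K01.
have [k [ck k01 k1 kU]] := bump_function R hG cK0 K01 U1.
have [theta [Ct theta1]] := Cc_above R hG cK0 K01 cU0.
exact: (group_norm_exists hG cU0 sU0 nU0 U1 sU UU0 HI ck k01 k1 kU Ct theta1).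
Qed.

(** * One-parameter subgroups and coordinates *)

Section OneParameter.
Variables (R : realType) (G : topGroupType) (N : G -> R) (K0 : set G).
Hypotheses (hG : hausdorff_space G) (HN : group_norm N)
  (cK0 : compact K0) (K01 : nbhs 1%g K0).
Implicit Types (g h : G).

Let N0 := gn_ge0 HN.
Let NV := gnV HN.
Let NM := gnM HN.

Definition zexp g (z : int) : G :=
  match z with Posz n => (g ^+ n)%g | Negz n => (g ^- n.+1)%g end.

Lemma zexpS g z : zexp g (z + 1) = (zexp g z * g)%g.
Proof.
case: z => [n|[|n]].
- have -> : Posz n + 1 = Posz n.+1 by lia.
  by rewrite /= expgSr.
- by rewrite /zexp /= mulVg.
have -> : Negz n.+1 + 1 = Negz n by lia.
by rewrite /= (expgS _ n.+1) invgM mulgVK.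
Qed.

Lemma zexpD g a b : zexp g (a + b) = (zexp g a * zexp g b)%g.
Proof.
have nat k c : zexp g (c + Posz k) = (zexp g c * g ^+ k)%g.
  elim: k c => [|k IH] c; first by rewrite addr0 mulg1.
  by rewrite -addn1 PoszD addrA zexpS IH addn1 expgSr mulgA.
case: b => k; first by rewrite nat.
have -> : zexp g a = (zexp g (a + Negz k) * g ^+ k.+1)%g.
  by rewrite -nat NegzE -addrA addNr addr0.
by rewrite /= mulgK.
Qed.

Lemma NX g n : N (g ^+ n)%g <= n%:R * N g.
Proof.
elim: n => [|n IH]; first by rewrite expg0 (gn1 HN) mul0r.
by rewrite expgS -natr1 mulrDl mul1r addrC; apply: le_trans (NM _ _) _; rewrite lerD.
Qed.

Lemma Nzexp g z : N (zexp g z) <= `|z|%:~R * N g.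
Proof.
case: z => n; first exact: NX.
by rewrite /= NV; exact: NX.
Qed.

Lemma cvg_gnorm1 {T} (F : set_system T) {FF : Filter F} (f : T -> G) x :
  (fun t => N (x^-1 * f t)%g) @ F --> 0 -> f @ F --> x.
Proof.
move=> H W Wx; have W1 : nbhs (x * 1)%g W by rewrite mulg1.
have [r r0 Hr] := gn_nbhs HN (nbhs_mulgl W1).
pose proof (cvgr0_norm_lt _ H _ r0) as Hn; change (\forall t \near F, W (f t)).
move: Hn; apply: filterS => t /=.
by rewrite ger0_norm // => /Hr; rewrite /= mulVKg.
Qed.

Lemma cvg_gnorm {T} (F : set_system T) {FF : Filter F} (f : T -> G) x :
  f @ F --> x -> (fun t => N (x^-1 * f t)%g) @ F --> 0.
Proof.
move=> H; apply/cvgr0Pnorm_le => e e0.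
have /nbhs_mulgl h : nbhs (x^-1 * x)%g [set g | N g < e] by rewrite mulVg; exact: gn_small.
have : \forall t \near F, N (x^-1 * f t)%g < e := H _ h.
by apply: filterS => t /= /ltW; rewrite ger0_norm.
Qed.

Lemma gnorm_continuous : continuous N.
Proof.
move=> x; apply/cvgrPdist_le => e e0.
pose proof (cvgr0_norm_le _ (cvg_gnorm (@cvg_id _ (nbhs x))) _ e0) as Hn.
move: Hn; apply: filterS => y; rewrite ger0_norm // => ye.
rewrite ler_norml; apply/andP; split.
  by have := NM x (x^-1 * y)%g; rewrite mulVKg; lra.
by have := NM y (x^-1 * y)^-1%g; rewrite NV invgM invgK mulVKg; lra.
Qed.

(** The Lipschitz bound for [N] stands in for continuity. *)
Definition one_param (X : R -> G) :=
  (forall s t, X (s + t) = (X s * X t)%g) /\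
  exists2 c, 0 <= c & forall t, N (X t) <= c * `|t|.

Definition is_tangent d (F : G -> 'rV[R]_d) (X : R -> G) v :=
  exists c r, 0 < r /\ forall t, `|t| < r -> `|F (X t) - t *: v| <= c * t ^+ 2.

Lemma one_param0 X : one_param X -> X 0 = 1%g.
Proof.
by move=> [XD _]; apply: (mulgI (X 0)); rewrite -XD addr0 mulg1.
Qed.

Lemma one_paramN X t : one_param X -> X (- t) = (X t)^-1%g.
Proof.
move=> oX; have [XD _] := oX; apply: (mulgI (X t)).
by rewrite -XD subrr mulgV one_param0.
Qed.

Section AlmostHom.
Variables (d : nat) (F : G -> 'rV[R]_d) (C r : R).
Hypothesis HF : almost_hom N F C r.
Let C0 := ah_C HF.
Let r0 := ah_r HF.

Lemma ah1 : F 1%g = 0.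
Proof.
have := ahM HF (g := 1%g) (h := 1%g); rewrite (gn1 HN) mulg1 mul0r mulr0.
move=> /(_ r0 r0); rewrite subrr sub0r normrN normr_le0 => /eqP; exact.
Qed.

Lemma ahV g : N g < r -> `|F g^-1%g + F g| <= C * N g ^+ 2.
Proof.
move=> gr; have := ahM HF (g := g) (h := g^-1%g); rewrite NV mulgV ah1 sub0r => /(_ gr gr).
by rewrite -opprD normrN addrC.
Qed.

Lemma ahX g n : n%:R * N g < r -> `|F (g ^+ n)%g - n%:R *: F g| <= C * (n%:R * N g) ^+ 2.
Proof.
elim: n => [|n IH] nr; first by rewrite expg0 ah1 scale0r subrr normr0 !mul0r expr0n mulr0.
have Ng := N0 g.
have n1 : n%:R * N g < r by apply: le_lt_trans nr; rewrite ler_wpM2r // ler_nat.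
have g1 : N g < r by apply: le_lt_trans nr; rewrite ler_peMl // ler1n.
have := ahM HF (g := (g ^+ n)%g) (h := g) (le_lt_trans (NX g n) n1) g1.
rewrite -expgSr -natr1 scalerDl scale1r => h.
have -> : F (g ^+ n.+1)%g - (n%:R *: F g + F g) =
  (F (g ^+ n.+1)%g - F (g ^+ n)%g - F g) + (F (g ^+ n)%g - n%:R *: F g).
  by rewrite [RHS]addrA (addrAC _ (- F g)) subrK opprD addrA addrAC.
apply: le_trans (ler_normD _ _) _.
apply: (@le_trans _ _ (C * (n%:R * N g * N g) + C * (n%:R * N g) ^+ 2)).
  apply: lerD; last exact: IH.
  by apply: le_trans h _; rewrite ler_wpM2l ?(ltW C0) // ler_wpM2r // NX.
rewrite -mulrDr ler_wpM2l ?(ltW C0) //.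
have : 0 <= n%:R * N g * N g by rewrite !mulr_ge0.
have : 0 <= N g * N g by rewrite mulr_ge0.
by rewrite !expr2; nra.
Qed.

Lemma ahZ g z : `|z|%:~R * N g < r ->
  `|F (zexp g z) - z%:~R *: F g| <= 2 * C * (`|z|%:~R * N g) ^+ 2.
Proof.
have sq0 (x : R) : 0 <= C * x ^+ 2 by rewrite mulr_ge0 ?sqr_ge0 // ltW.
case: z => n zr /=.
  by apply: le_trans (ahX zr) _; rewrite -mulrA [leRHS]mulr_natl mulr2n lerDl.
have {}zr : n.+1%:R * N g < r := zr.
have nr := le_lt_trans (NX g n.+1) zr.
have h1 := ahV nr; have h2 := ahX zr.
have -> : F (g ^- n.+1)%g - (Negz n)%:~R *: F g =
  (F (g ^- n.+1)%g + F (g ^+ n.+1)%g) - (F (g ^+ n.+1)%g - n.+1%:R *: F g).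
  by rewrite NegzE mulrNz scaleNr opprK opprB addrA [RHS]addrAC addrK.
apply: le_trans (ler_normB _ _) _.
rewrite -mulrA [leRHS]mulr_natl mulr2n lerD //; apply: le_trans h1 _.
rewrite ler_wpM2l ?(ltW C0) // ler_sqr ?nnegrE ?mulr_ge0 //; exact: NX.
Qed.

Lemma ah_cvg {T} (FF : set_system T) {FFF : Filter FF} (f : T -> G) x : N x < r ->
  f @ FF --> x -> (F \o f) @ FF --> F x.
Proof.
move=> xr fx; pose proof (cvg_gnorm fx) as cN.
apply/cvgrPdist_le => e e0.
pose k := C + C * r + 1.
have k0 : 0 < k by rewrite !addr_gt0 // mulr_gt0.
have ek : 0 < e / k by rewrite divr_gt0.
pose proof (cvgr0_norm_le _ cN _ ek) as H1.
pose proof (cvgr0_norm_lt _ cN _ r0) as H2.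
apply: filterS2 H1 H2 => t; rewrite !ger0_norm // => h1 h2.
have := ahM HF xr h2; rewrite mulVKg => h3; have h4 := ah_le HF h2.
rewrite -normrN opprB.
have -> : F (f t) - F x = (F (f t) - F x - F (x^-1 * f t)%g) + F (x^-1 * f t)%g by rewrite subrK.
apply: le_trans (ler_normD _ _) _.
set n := N (x^-1 * _)%g in h1 h2 h3 h4; have n0 : 0 <= n := N0 _.
apply: (@le_trans _ _ (k * n)); last by rewrite -ler_pdivlMl // mulrC.
have : N x * n <= r * n by rewrite ler_wpM2r // ltW.
move=> /(ler_wpM2l (ltW C0)); rewrite /k /=; lra.
Qed.

(** [X t] is the limit of [g i] raised to the floor of [t * m i]. Floors are additive up to 0 or 1
    and [g i] tends to 1, so the limit is a homomorphism. The bound on [m i * N (g i)] confines the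
    powers to [K0] for small [t] and turns the error of [ahZ] into [O(t^2)]. *)
Lemma one_param_limit T (FF : set_system T) (g : T -> G) (m : T -> R) (B : R) v :
  UltraFilter FF -> 0 <= B -> (fun i => N (g i)) @ FF --> 0 ->
  (\forall i \near FF, 0 <= m i /\ m i * N (g i) <= B) ->
  (fun i => m i *: F (g i)) @ FF --> v ->
  exists X, one_param X /\ is_tangent F X v.
Proof.
move=> FU B0 gN mB Fv.
pose e (t : R) i : int := Num.floor (t * m i).
have eP t i : (e t i)%:~R <= t * m i < (e t i)%:~R + 1.
  by have /andP[? ?] := floor_itv (t * m i); rewrite -intrD1; apply/andP.
have eN t : \forall i \near FF, `|e t i|%:~R * N (g i) <= `|t| * B + N (g i).
  apply: filterS mB => i [m0 mi]; have /andP[e1 e2] := eP t i.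
  have : `|(e t i)%:~R| <= `|t| * m i + 1 :> R.
    have := ler_norm (t * m i); have := ler_norm (- (t * m i)).
    rewrite normrN normrM (ger0_norm m0) => h1 h2.
    by rewrite ler_norml; apply/andP; split; lra.
  rewrite -intr_norm => /(ler_wpM2r (N0 (g i))) /le_trans; apply.
  by rewrite mulrDl mul1r lerD2r -mulrA ler_wpM2l.
have g1 : g @ FF --> 1%g by apply: cvg_gnorm1; under eq_fun do rewrite invg1 mul1g.
have eD s t i : exists2 k : int, (k = 0 \/ k = 1) & e (s + t) i = e s i + e t i + k.
  have /andP[s1 s2] := eP s i; have /andP[t1 t2] := eP t i; have /andP[u1 u2] := eP (s + t) i.
  exists (e (s + t) i - (e s i + e t i)); last by rewrite [RHS]addrC subrK.
  rewrite mulrDl in u1 u2.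
  have : ((e (s + t) i - (e s i + e t i))%:~R : R) < 2%:~R by rewrite intrB intrD; lra.
  have : (-1)%:~R < ((e (s + t) i - (e s i + e t i))%:~R : R) by rewrite intrB intrD; lra.
  rewrite !ltr_int; lia.
pose cv (t : R) := exists x : G, (fun i => zexp (g i) (e t i)) @ FF --> x.
have cvD s t x y : (fun i => zexp (g i) (e s i)) @ FF --> x ->
    (fun i => zexp (g i) (e t i)) @ FF --> y ->
    (fun i => zexp (g i) (e (s + t) i)) @ FF --> (x * y)%g.
  move=> cx cy.
  have c1 : (fun i => zexp (g i) (e (s + t) i - (e s i + e t i))) @ FF --> 1%g.
    apply: cvg_gnorm1; apply/cvgr0Pnorm_le => eps eps0.
    pose proof (cvgr0_norm_le _ gN _ eps0) as Hn; move: Hn; apply: filterS => i.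
    have [k k01 ->] := eD s t i; rewrite addrAC subrr add0r !ger0_norm // invg1 mul1g.
    by move=> h; case: k01 => ->; rewrite /= ?expg0 ?expg1 ?(gn1 HN) // ltW.
  have -> : (fun i => zexp (g i) (e (s + t) i)) = (fun i => zexp (g i) (e s i) *
      zexp (g i) (e t i) * zexp (g i) (e (s + t) i - (e s i + e t i)))%g.
    by apply/funext => i; rewrite -!zexpD; congr zexp; rewrite [RHS]addrC subrK.
  by rewrite -[(x * y)%g]mulg1; apply: cvgMg => //; exact: cvgMg.
have [rho rho0 Hrho] := gn_nbhs HN K01.
have cv_small t : `|t| * B < rho -> cv t.
  move=> tB; have d0 : 0 < rho - `|t| * B by rewrite subr_gt0.
  have := cK0; rewrite compact_ultra => /(_ _ (ultra_fmap (fun i => zexp (g i) (e t i)) FU)) [].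
    pose proof (cvgr0_norm_lt _ gN _ d0) as H1.
    apply: filterS2 H1 (eN t) => i; rewrite ger0_norm // => h1 h2.
    apply: Hrho; apply: le_lt_trans (Nzexp _ _) _; apply: le_lt_trans h2 _; lra.
  by move=> x [_ cx]; exists x.
(* For large [t] the powers may leave [K0]; convergence at [t / n] propagates to [t] by
   additivity. *)
have cv_all t : cv t.
  have [n ng] : exists n : nat, `|t| * B / rho < n.+1%:R.
    by exists (Num.truncn (`|t| * B / rho)); exact: truncnS_gt.
  have n0 : 0 < n.+1%:R :> R by rewrite ltr0n.
  have c1 : cv (t / n.+1%:R).
    apply: cv_small; rewrite normrM normfV (ger0_norm (ltW n0)).
    by rewrite mulrAC ltr_pdivrMr // [rho * _]mulrC -ltr_pdivrMr.
  suff : cv (n.+1%:R * (t / n.+1%:R)) by rewrite mulrCA mulfV ?mulr1 // gt_eqF.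
  elim: {ng n0} n.+1 (t / n.+1%:R) c1 => [|k IH] s cs.
    by apply: cv_small; rewrite mul0r normr0 mul0r.
  rewrite -natr1 mulrDl mul1r.
  have [x cx] := IH s cs; have [y cy] := cs.
  by exists (x * y)%g; exact: cvD.
have [X HX] := choice cv_all.
have XN t : N (X t) <= B * `|t|.
  have c1 : (fun i => N (zexp (g i) (e t i))) @ FF --> N (X t).
    by apply: continuous_cvg; [exact: gnorm_continuous|exact: HX].
  have c2 : (fun i => `|t| * B + N (g i)) @ FF --> `|t| * B + 0.
    by apply: cvgD => //; exact: cvg_cst.
  rewrite mulrC -[leRHS]addr0; apply: (cvg_le c1 c2).
  by apply: filterS (eN t) => i; exact/le_trans/Nzexp.
exists X; split.
  split; last by exists B.
  by move=> s t; apply: (cvg_unique hG (HX (s + t))); exact: cvD.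
exists (2 * C * B ^+ 2), (r / (B + 1)); have B1 : 0 < B + 1 by rewrite ltr_wpDl.
split; first by rewrite divr_gt0.
move=> t tr.
have tB : `|t| * B < r.
  apply: (@le_lt_trans _ _ (`|t| * (B + 1))); first by rewrite ler_wpM2l // lerDl.
  by rewrite -ltr_pdivlMr.
have c1 : (fun i => F (zexp (g i) (e t i))) @ FF --> F (X t).
  by apply: (ah_cvg _ (HX t)); apply: le_lt_trans (XN t) _; rewrite mulrC.
have c2 : (fun i => (e t i)%:~R *: F (g i)) @ FF --> t *: v.
  have -> : (fun i => (e t i)%:~R *: F (g i)) =
     (fun i => t *: (m i *: F (g i)) + ((e t i)%:~R - t * m i) *: F (g i)).
    by apply/funext => i; rewrite scalerA -scalerDl addrC subrK.
  rewrite -[X in _ --> X]addr0; apply: cvgD.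
    by apply: cvgZr.
  apply/cvgr0Pnorm_le => eps eps0.
  have ec : 0 < eps / C by rewrite divr_gt0.
  pose proof (cvgr0_norm_le _ gN _ ec) as H1; pose proof (cvgr0_norm_lt _ gN _ r0) as H2.
  apply: filterS2 H1 H2 => i; rewrite !ger0_norm // => h1 h2.
  rewrite normrZ; have /andP[e1 e2] := eP t i.
  apply: (@le_trans _ _ (1 * `|F (g i)|)).
    by rewrite ler_wpM2r // ler_norml; apply/andP; split; lra.
  rewrite mul1r; apply: le_trans (ah_le HF h2) _.
  by rewrite -ler_pdivlMl // mulrC.
have c3 : (fun i => `|F (zexp (g i) (e t i)) - (e t i)%:~R *: F (g i)|) @ FF --> `|F (X t) - t *: v|.
  by apply: cvg_norm; apply: cvgB.
have c4 : (fun i => 2 * C * (`|t| * B + N (g i)) ^+ 2) @ FF --> 2 * C * (`|t| * B + 0) ^+ 2.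
  apply: cvgM; first exact: cvg_cst.
  by apply: cvgM; (apply: cvgD; [exact: cvg_cst|exact: gN]).
have -> : 2 * C * B ^+ 2 * t ^+ 2 = 2 * C * (`|t| * B + 0) ^+ 2.
  by rewrite addr0 exprMn real_normK ?num_real // -mulrA; congr (_ * _); rewrite mulrC.
apply: (cvg_le c3 c4).
have d0 : 0 < r - `|t| * B by rewrite subr_gt0.
pose proof (cvgr0_norm_lt _ gN _ d0) as H1.
apply: filterS2 H1 (eN t) => i; rewrite ger0_norm // => h1 h2.
have zr : `|e t i|%:~R * N (g i) < r by apply: le_lt_trans h2 _; lra.
apply: le_trans (ahZ zr) _; rewrite ler_wpM2l ?mulr_ge0 ?(ltW C0) //.
by rewrite ler_sqr ?nnegrE ?addr_ge0 ?mulr_ge0.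
Qed.

End AlmostHom.

End OneParameter.

Lemma mulmx_bounded (R : realType) d n (M : 'M[R]_(d, n)) :
  exists2 c, 0 <= c & forall x : 'rV[R]_d, `|x *m M| <= c * `|x|.
Proof.
exists (\sum_j \sum_i `|M i j|); first by rewrite sumr_ge0 // => j _; rewrite sumr_ge0.
move=> x; apply: rVnorm_le; first by rewrite mulr_ge0 // sumr_ge0 // => j _; rewrite sumr_ge0.
move=> j; rewrite mxE; apply: le_trans (ler_norm_sum _ _ _) _.
apply: (@le_trans _ _ ((\sum_i `|M i j|) * `|x|)).
  rewrite mulr_suml ler_sum // => i _; rewrite normrM mulrC ler_wpM2l //.
  exact: coord_le_rVnorm.
rewrite ler_wpM2r // (bigD1 j) //= lerDl sumr_ge0 // => k _; exact: sumr_ge0.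
Qed.

Lemma compact_closed_ballrV (R : realType) n (r : R) : compact [set v : 'rV[R]_n | `|v| <= r].
Proof.
apply: bounded_closed_compact.
  exists r; split; first exact: num_real.
  by move=> x rx y /= /le_trans; apply; exact: ltW.
apply: (@closed_comp _ _ (fun v : 'rV[R]_n => `|v|) [set x | x <= r]); last exact: closed_le.
by move=> x _; exact: norm_continuous.
Qed.

Lemma cvg_harmonic_ultra (R : realType) (FF : set_system nat) {UF : UltraFilter FF} (c : R) :
  \oo `<=` FF -> (fun i => c / i.+1%:R) @ FF --> (0 : R).
Proof.
move=> sub; apply/cvgr0Pnorm_le => e e0; apply: sub.
have : (fun i => c * harmonic i) @ \oo --> c * 0 by apply: cvgMr; exact: cvg_harmonic.
by rewrite mulr0 => /cvgr0_norm_le; apply.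
Qed.

(** * Coordinates adapted to one-parameter subgroups *)

Section Coordinates.
Variables (R : realType) (G : topGroupType) (N : G -> R) (K0 : set G).
Hypotheses (hG : hausdorff_space G) (HN : group_norm N)
  (cK0 : compact K0) (K01 : nbhs 1%g K0).
Let N0 := gn_ge0 HN.
Let NM := gnM HN.

Variables (d : nat) (F : G -> 'rV[R]_d) (C r : R).
Hypothesis HF : almost_hom N F C r.
Let C0 := ah_C HF.
Let r0 := ah_r HF.

Definition tangent_space v := exists X, one_param N X /\ is_tangent F X v.

(** A linearly independent family of tangent vectors of maximal size: a tangent vector outside its
    span would extend it. *)
Lemma tangent_basis : exists n (A : 'M[R]_(n, d)), [/\ row_free A,
  forall i, tangent_space (row i A) & forall v, tangent_space v -> (v <= A)%MS].
Proof.
pose P n := `[< exists A : 'M[R]_(n, d), row_free A /\ forall i, tangent_space (row i A) >].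
have P0 : exists n, P n.
  by exists 0%N; apply/asboolP; exists 0; split; [rewrite /row_free mxrank0|case].
have Pd n : P n -> (n <= d)%N.
  by move=> /asboolP[A [fA _]]; move: (rank_leq_col A); rewrite (eqP fA).
case: (ex_maxnP P0 Pd) => n /asboolP[A [fA tA]] max.
exists n, A; split=> // v tv; apply: contrapT => /negP nvA.
suff /max : P (1 + n)%N by rewrite ltnn.
apply/asboolP; exists (col_mx v A); split; last first.
  move=> i; case: (split_ordP i) => j ->; last by rewrite rowKd.
  by rewrite rowKu [row j v](_ : _ = v) //; apply/rowP => k; rewrite mxE ord1.
rewrite /row_free eqn_leq rank_leq_row /=.
suff : (\rank A < \rank (col_mx v A))%N by rewrite (eqP fA).
apply: rank_ltmx; rewrite ltmxE; apply/andP; split; first by rewrite -addsmxE addsmxSr.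
apply/negP => h; move/negP: nvA; apply; apply: submx_trans h.
by rewrite -addsmxE addsmxSl.
Qed.

(** Projecting [F] onto the span of the tangent vectors loses nothing near 1. Otherwise, for a
    sequence along which [a (g i)] is negligible against [N (g i)], the quotients
    [F (g i) / N (g i)] have a limit [v]. It is tangent by [one_param_limit], so it lies in the row
    space of [A]; it is also killed by [P], so it is 0, against [ah_ge]. *)
Lemma coordinates_exist : exists n (a : G -> 'rV[R]_n) (c s : R) (X : 'I_n -> R -> G),
  almost_hom N a c s /\ forall i, one_param N (X i) /\ is_tangent a (X i) 'e_i.
Proof.
have [n [A [fA tA Amax]]] := tangent_basis.
pose P := pinvmx A; pose a g := F g *m P.
have [cP cP0 bP] := mulmx_bounded P.
have key : exists2 k : nat, 0 < k.+1%:R^-1 :> R & forall g, N g < k.+1%:R^-1 -> N g <= k.+1%:R * `|a g|.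
  apply: contrapT => nk.
  have ex (i : nat) : exists x, N x < i.+1%:R^-1 /\ i.+1%:R * `|a x| < N x.
    apply: contrapT => ng; apply: nk; exists i; first by rewrite invr_gt0.
    by move=> g Ngi; rewrite leNgt; apply/negP => lt; apply: ng; exists g.
  have [g Hg] := choice ex.
  have Ng0 i : 0 < N (g i).
    by apply: le_lt_trans (Hg i).2; rewrite mulr_ge0.
  have [FF [UF sub]] := ultraFilterLemma (eventually_filter : ProperFilter \oo).
  have small (e c : R) : 0 < e -> \forall i \near FF, c / i.+1%:R < e.
    move=> e0; pose proof (cvgr0_norm_lt _ (@cvg_harmonic_ultra R FF UF c sub) _ e0) as H.
    by apply: filterS H => i; apply: le_lt_trans; exact: ler_norm.
  have gr : \forall i \near FF, N (g i) < r.
    apply: filterS (small _ 1 r0) => i; rewrite div1r; apply: lt_trans; exact: (Hg i).1.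
  pose w i := (N (g i))^-1 *: F (g i).
  have wb : \forall i \near FF, `|w i| <= C.
    apply: filterS gr => i gi; rewrite normrZ ger0_norm ?invr_ge0 //.
    by rewrite ler_pdivrMl // mulrC; exact: (ah_le HF gi).
  have := @compact_closed_ballrV R d C.
  rewrite compact_ultra => /(_ _ (ultra_fmap w UF) wb) [v [_ wv]].
  have [X [oX tX]] : exists X, one_param N X /\ is_tangent F X v.
    apply: (@one_param_limit R G N K0 hG HN cK0 K01 d F C r HF nat FF g (fun i => (N (g i))^-1) 1) => //.
    - apply/cvgr0Pnorm_le => e e0; apply: filterS (small _ 1 e0) => i; rewrite div1r => ie.
      by rewrite ger0_norm // ltW // (lt_trans (Hg i).1).
    - by apply: nearW => i; rewrite invr_ge0 mulVf // gt_eqF.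
  have vA : v = v *m P *m A by rewrite mulmxKpV //; apply: Amax; exists X.
  have vP0 : v *m P = 0.
    apply/eqP; rewrite -normr_le0; apply/ler_addgt0Pr => e e0; rewrite add0r.
    have e2 : 0 < e / 2 by rewrite divr_gt0.
    have ec : 0 < e / 2 / (cP + 1) by rewrite divr_gt0 // ltr_wpDl.
    pose proof (iffLR (cvgrPdist_le _ _) wv _ ec) as H1.
    have [i [h1 h2]] := filter_ex (filterI H1 (small _ 1 e2)).
    have -> : v *m P = (v - w i) *m P + w i *m P by rewrite mulmxBl subrK.
    apply: le_trans (ler_normD _ _) _; rewrite [leRHS](splitr e) lerD //.
      apply: le_trans (bP _) _; apply: (@le_trans _ _ ((cP + 1) * (e / 2 / (cP + 1)))).
        by apply: ler_pM => //; rewrite lerDl.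
      by rewrite mulrCA divff ?mulr1 // gt_eqF // ltr_wpDl.
    rewrite /w -scalemxAl normrZ ger0_norm ?invr_ge0 // -/(a _).
    rewrite ler_pdivrMl //; have [_ h3] := Hg i.
    apply: le_trans (_ : i.+1%:R^-1 * N (g i) <= _).
      by rewrite ler_pdivlMl //; exact: ltW.
    by rewrite mulrC ler_wpM2l // -[leLHS]div1r ltW.
  have v0 : v = 0 by rewrite vA vP0 mul0mx.
  have CV : 0 < (2 * C)^-1 by rewrite invr_gt0 mulr_gt0.
  pose proof (iffLR (cvgrPdist_le _ _) wv _ CV) as H1.
  have [i [h1 h2]] := filter_ex (filterI H1 gr).
  move: h1; rewrite v0 sub0r normrN /w normrZ ger0_norm ?invr_ge0 //.
  have := ah_ge HF h2; rewrite ler_pdivrMl // => h3 h4.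
  have := le_trans h3 (ler_wpM2l (ltW C0) h4).
  have -> : C * (N (g i) / (2 * C)) = N (g i) / 2 by field; rewrite gt_eqF.
  by have := Ng0 i; lra.
have [k k0 Hk] := key.
pose c := k.+1%:R + cP * C.
have cC : 0 <= cP * C by rewrite mulr_ge0 // ltW.
have kk : 1 <= k.+1%:R :> R by rewrite ler1n.
exists n, a, c, (Num.min r k.+1%:R^-1).
have [X HX] := choice tA.
exists X; split.
  split.
  - by rewrite ltr_pwDl.
  - by rewrite lt_min r0.
  - move=> g h; rewrite !lt_min => /andP[gr _] /andP[hr _].
    rewrite /a -!mulmxBl; apply: le_trans (bP _) _.
    apply: le_trans (ler_wpM2l cP0 (ahM HF gr hr)) _.
    by rewrite [leLHS]mulrA ler_wpM2r ?mulr_ge0 // lerDr.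
  - move=> g; rewrite lt_min => /andP[gr _]; apply: le_trans (bP _) _.
    apply: le_trans (ler_wpM2l cP0 (ah_le HF gr)) _.
    by rewrite [leLHS]mulrA ler_wpM2r // lerDr.
  - move=> g; rewrite lt_min => /andP[_ gk]; apply: le_trans (Hk g gk) _.
    by rewrite ler_wpM2r // lerDl.
move=> i; have [oX [q [s [s0 tX]]]] := HX i; split=> //.
exists (cP * q), s; split=> // t ts.
have -> : 'e_i = row i A *m P :> 'rV[R]_n by rewrite -row_mul mulmxVp // row1.
rewrite /a scalemxAl -mulmxBl; apply: le_trans (bP _) _.
by rewrite -mulrA ler_wpM2l // tX.
Qed.

End Coordinates.

(** * The exponential chart *)

Section Words.
Variables (R : realType) (G : topGroupType) (N : G -> R).
Hypotheses (hG : hausdorff_space G) (HN : group_norm N).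
Let N0 := gn_ge0 HN.
Let NV := gnV HN.
Let NM := gnM HN.

Lemma gn_eq1 g : N g = 0 -> g = 1%g.
Proof.
move=> Ng; apply/esym/hG => A B A1 Bg.
have [r r0 Hr] := gn_nbhs HN A1.
by exists g; split; [apply: Hr; rewrite Ng|exact: nbhs_singleton].
Qed.

Variables (n : nat) (a : G -> 'rV[R]_n) (C r : R) (X : 'I_n -> R -> G).
Hypotheses (Ha : almost_hom N a C r)
  (HX : forall i, one_param N (X i) /\ is_tangent a (X i) 'e_i).
Let C0 := ah_C Ha.
Let r0 := ah_r Ha.
Let a1 := ah1 HN Ha.

(** Expanding [a] on both sides of [p * y ^ p = y * p] bounds [a (y ^ p) - a y] by
    [C * N p * (N (y ^ p) + N y)]; for small [N p] the unknown [N (y ^ p)] is absorbed. *)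
Lemma conj_almost : exists c s, [/\ 0 < c, 0 < s & forall p y, N p < s -> N y < s ->
  `|a (y ^ p)%g - a y| <= c * (N p * N y) /\ N (y ^ p)%g <= c * N y].
Proof.
pose c := C * (2 * C ^+ 2 + 2) + (2 * C ^+ 2 + 1).
have C2 : 0 <= C ^+ 2 by rewrite sqr_ge0.
have C1 : 0 < 2 * C ^+ 2 + 1 by rewrite ltr_wpDl // mulr_ge0.
have cC : 0 <= C * (2 * C ^+ 2 + 2) by rewrite mulr_ge0 ?(ltW C0) // addr_ge0 // mulr_ge0.
exists c, (Num.min (r / 3) (2 * (C ^+ 2 + 1))^-1); split.
- by rewrite ltr_wpDl.
- by rewrite lt_min divr_gt0 // invr_gt0 mulr_gt0 // ltr_wpDl.
move=> p y; rewrite !lt_min => /andP[p1 p2] /andP[y1 _].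
have pr : N p < r by move: r0; lra.
have yr : N y < r by move: r0; lra.
have Np := N0 p; have Ny := N0 y; have Nyp := N0 (y ^ p)%g.
have ypr : N (y ^ p)%g < r.
  rewrite /conjg; apply: le_lt_trans (NM _ _) _; rewrite NV.
  by have := NM y p; lra.
have h1 := ahM Ha pr ypr; have h2 := ahM Ha yr pr.
have e1 : (p * y ^ p)%g = (y * p)%g by rewrite conjgE mulVKg.
rewrite e1 in h1.
have h3 : `|a (y ^ p)%g - a y| <= C * (N p * (N (y ^ p)%g + N y)).
  have -> : a (y ^ p)%g - a y = (a (y * p)%g - a y - a p) - (a (y * p)%g - a p - a (y ^ p)%g).
    by apply/rowP => i; rewrite !mxE; ring.
  apply: le_trans (ler_normB _ _) _; apply: le_trans (lerD h2 h1) _.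
  by rewrite le_eqVlt; apply/orP; left; apply/eqP; ring.
have h4 : N (y ^ p)%g <= C * `|a (y ^ p)%g| := ah_ge Ha ypr.
have h5 : `|a y| <= C * N y := ah_le Ha yr.
have h6 : `|a (y ^ p)%g| <= C * N y + C * (N p * (N (y ^ p)%g + N y)).
  rewrite -[a (y ^ p)%g](subrK (a y)) addrC; apply: le_trans (ler_normD _ _) _.
  exact: lerD.
have CC : C ^+ 2 * N p <= 1 / 2.
  apply: (@le_trans _ _ ((C ^+ 2 + 1) * N p)); first by rewrite ler_wpM2r // lerDl.
  have q0 : 0 < C ^+ 2 + 1 by rewrite ltr_wpDl.
  by move: p2; rewrite -[_^-1]div1r ltr_pdivlMr ?mulr_gt0 //; lra.
have h7 := le_trans h4 (ler_wpM2l (ltW C0) h6).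
have h8 : N (y ^ p)%g <= (2 * C ^+ 2 + 1) * N y.
  have e : C * (C * N y + C * (N p * (N (y ^ p)%g + N y))) =
    C ^+ 2 * N y + (C ^+ 2 * N p) * (N (y ^ p)%g + N y) by ring.
  rewrite e in h7.
  have := ler_wpM2r (addr_ge0 Nyp Ny) CC; lra.
split.
  apply: le_trans h3 _.
  apply: (@le_trans _ _ (C * (N p * ((2 * C ^+ 2 + 2) * N y)))).
    by rewrite ler_wpM2l ?(ltW C0) // ler_wpM2l //; lra.
  have -> : C * (N p * ((2 * C ^+ 2 + 2) * N y)) = C * (2 * C ^+ 2 + 2) * (N p * N y) by ring.
  by rewrite ler_wpM2r ?mulr_ge0 // lerDl ltW.
by apply: le_trans h8 _; rewrite ler_wpM2r // lerDr.
Qed.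

Variable m : nat.
Definition letter : Type := (G + ('I_n * 'cV[R]_m))%type.
Definition lin (c : 'cV[R]_m) (z : 'rV[R]_m) : R := (z *m c) 0 0.
Definition leval (z : 'rV[R]_m) (l : letter) : G :=
  match l with inl h => h | inr (i, c) => X i (lin c z) end.
Definition weval (z : 'rV[R]_m) (w : seq letter) : G := foldr (fun l g => leval z l * g)%g 1%g w.

Lemma linD c z v : lin c (z + v) = lin c z + lin c v.
Proof. by rewrite /lin mulmxDl mxE. Qed.

Lemma lin_bounded c : exists2 k, 0 <= k & forall z, `|lin c z| <= k * `|z|.
Proof.
have [k k0 Hk] := mulmx_bounded c; exists k => // z.
exact: le_trans (coord_le_rVnorm _ _) (Hk z).
Qed.

Lemma leval_diff z v i c : ((leval z (inr (i, c)))^-1 * leval (z + v) (inr (i, c)))%g = X i (lin c v).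
Proof.
have [oX _] := HX i; have [XD _] := oX.
by rewrite /= -(one_paramN _ oX) -XD linD addKr.
Qed.

(** Increments are read after left translation to 1. The increment of the head letter gets
    conjugated by the tail, which is the source of every [Ad] factor below. *)
Lemma weval_cons_diff z v l w :
  ((weval z (l :: w))^-1 * weval (z + v) (l :: w))%g =
  (((leval z l)^-1 * leval (z + v) l) ^ weval z w * ((weval z w)^-1 * weval (z + v) w))%g.
Proof. by rewrite /= invgM conjgE !mulgA mulgK. Qed.

(* First-order increment of a word: [b1, b2] are the increments of the tail and of
   the head letter, the latter already conjugated by the tail. *)
Lemma ah_mul_approx x y u v (b1 b2 e1 e2 V : R) : N x < r -> N y < r ->
  `|a x - u| <= e1 -> `|a y - v| <= e2 -> N x <= b1 * V -> N y <= b2 * V ->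
  `|a (x * y)%g - (u + v)| <= C * (b1 * b2) * V ^+ 2 + e1 + e2.
Proof.
move=> xr yr hu hv hx hy; have h := ahM Ha xr yr.
have -> : a (x * y)%g - (u + v) = (a (x * y)%g - a x - a y) + (a x - u) + (a y - v).
  by apply/rowP => i; rewrite !mxE; ring.
apply: le_trans (ler_normD _ _) _; rewrite lerD //.
apply: le_trans (ler_normD _ _) _; rewrite lerD //.
apply: le_trans h _; rewrite -mulrA ler_wpM2l ?(ltW C0) //.
have -> : b1 * b2 * V ^+ 2 = (b1 * V) * (b2 * V) by ring.
exact: ler_pM.
Qed.

Fixpoint wlin (w : seq letter) (v : 'rV[R]_m) : 'rV[R]_n :=
  match w with
  | [::] => 0
  | inl _ :: w' => wlin w' v
  | inr (i, c) :: w' => lin c v *: 'e_i + wlin w' v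
  end.

(** The value of a word without constants is near 1 when [z] is near 0, so conjugation by it
    perturbs an increment only by a factor of order [|z|]. Hence one linear map [wlin] serves at all
    nearby base points. *)
Lemma word_near0 (w : seq ('I_n * 'cV[R]_m)) : exists c s, [/\ 0 < c, 0 < s &
  forall z v, `|z| < s -> `|v| < s ->
  [/\ N (weval z (map inr w)) <= c * `|z|,
      N ((weval z (map inr w))^-1 * weval (z + v) (map inr w))%g <= c * `|v| &
      `|a ((weval z (map inr w))^-1 * weval (z + v) (map inr w))%g - wlin (map inr w) v|
        <= c * ((`|z| + `|v|) * `|v|)]].
Proof.
elim: w => [|[i l] w [c [s [c0 s0 IH]]]].
  exists 1, 1; split=> // z v _ _.
  by rewrite /= invg1 mulg1 a1 subrr normr0 (gn1 HN) !mul1r.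
have [oX [kX [sX [sX0 tX]]]] := HX i; have [XD [cX cX0 bX]] := oX.
have [k k0 Hk] := lin_bounded l.
have [cc [sc [cc0 sc0 Hc]]] := conj_almost.
have cXk : 0 <= cX * k by rewrite mulr_ge0.
pose b := cc * (cX * k) + 1.
have b0 : 0 < b by rewrite ltr_wpDl // mulr_ge0 // ltW.
have kX0 : 0 <= `|kX| by [].
pose c' := C * (b * c) + (cc * (c * (cX * k)) + `|kX| * k ^+ 2) + c + cX * k + b.
have ck2 : 0 <= `|kX| * k ^+ 2 by rewrite mulr_ge0 // sqr_ge0.
have t1 : 0 <= C * (b * c) by rewrite !mulr_ge0 // ltW.
have t2 : 0 <= cc * (c * (cX * k)) by rewrite !mulr_ge0 // ltW.
have c'0 : 0 < c' by rewrite /c'; lra.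
pose s' := Num.min s (Num.min (sX / (k + 1)) (Num.min (r / c') (sc / c'))).
have k1 : 0 < k + 1 by rewrite ltr_wpDl.
exists c', s'; split=> //.
  by rewrite !lt_min s0 !divr_gt0.
move=> z v; rewrite !lt_min => /and4P[z1 z2 z3 z4] /and4P[v1 v2 v3 v4].
have [h1 h2 h3] := IH z v z1 v1.
set w' := map inr w in h1 h2 h3 *.
rewrite !ltr_pdivlMr // in z2 z3 z4 v2 v3 v4.
have zn := normr_ge0 z; have vn := normr_ge0 v.
have small q (u : R) : 0 <= u -> 0 <= q -> q <= c' -> q * u <= u * c'.
  by move=> u0 q0 qc; rewrite mulrC ler_wpM2l.
have Nx : N (X i (lin l v)) <= cX * k * `|v|.
  by apply: le_trans (bX _) _; rewrite -mulrA ler_wpM2l.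
have c_le : c <= c' by rewrite /c'; lra.
have cXk_le : cX * k <= c' by rewrite /c'; lra.
have b_le : b <= c' by rewrite /c'; lra.
have Npz : N (weval z w') < sc.
  by apply: le_lt_trans h1 _; apply: le_lt_trans (small _ _ zn (ltW c0) c_le) _.
have Nxs : N (X i (lin l v)) < sc.
  by apply: le_lt_trans Nx _; apply: le_lt_trans (small _ _ vn cXk cXk_le) _.
have [g1 g2] := Hc _ _ Npz Nxs.
have g2' : N (X i (lin l v) ^ weval z w')%g <= b * `|v|.
  apply: le_trans g2 _; apply: (@le_trans _ _ (cc * (cX * k * `|v|))).
    by rewrite ler_wpM2l // ltW.
  by rewrite mulrA ler_wpM2r // lerDl.
have Nr1 : N (X i (lin l v) ^ weval z w')%g < r.
  by apply: le_lt_trans g2' _; apply: le_lt_trans (small _ _ vn (ltW b0) b_le) _.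
have Nr2 : N ((weval z w')^-1 * weval (z + v) w')%g < r.
  by apply: le_lt_trans h2 _; apply: le_lt_trans (small _ _ vn (ltW c0) c_le) _.
have lv : `|lin l v| < sX.
  apply: le_lt_trans (Hk v) _; apply: le_lt_trans v2.
  by rewrite mulrC ler_wpM2l // lerDl.
have h4 : `|a (X i (lin l v)) - lin l v *: 'e_i| <= `|kX| * k ^+ 2 * `|v| ^+ 2.
  apply: le_trans (tX _ lv) _.
  apply: (@le_trans _ _ (`|kX| * lin l v ^+ 2)).
    by rewrite ler_wpM2r ?sqr_ge0 // ler_norm.
  rewrite -mulrA ler_wpM2l //.
  rewrite -exprMn -[lin l v ^+ 2]real_normK ?num_real // ler_sqr ?nnegrE ?mulr_ge0 //.
rewrite map_cons weval_cons_diff leval_diff -/w'.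
split.
- apply: le_trans (NM _ _) _.
  apply: (@le_trans _ _ (cX * k * `|z| + c * `|z|)); last first.
    by rewrite -mulrDl ler_wpM2r // /c'; lra.
  rewrite lerD //; apply: le_trans (bX _) _; by rewrite -mulrA ler_wpM2l.
- apply: le_trans (NM _ _) _; apply: le_trans (lerD g2' h2) _.
  by rewrite -mulrDl ler_wpM2r // /c'; lra.
have g3 : `|a (X i (lin l v) ^ weval z w')%g - lin l v *: 'e_i| <=
   cc * (c * (cX * k)) * (`|z| * `|v|) + `|kX| * k ^+ 2 * `|v| ^+ 2.
  rewrite -[a (_ ^ _)%g](subrK (a (X i (lin l v)))) -addrA.
  apply: le_trans (ler_normD _ _) _; rewrite lerD //; apply: le_trans g1 _.
  rewrite -mulrA ler_wpM2l ?(ltW cc0) //.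
  have -> : c * (cX * k) * (`|z| * `|v|) = (c * `|z|) * (cX * k * `|v|) by ring.
  exact: ler_pM.
have := ah_mul_approx Nr1 Nr2 g3 h3 g2' h2; rewrite [wlin _ v]/= => /le_trans; apply.
have zv : 0 <= `|z| * `|v| by rewrite mulr_ge0.
have vv : 0 <= `|v| ^+ 2 by rewrite sqr_ge0.
have e : (`|z| + `|v|) * `|v| = `|z| * `|v| + `|v| ^+ 2 by ring.
rewrite e; move: zv vv; set A := _ * `|v|; set B := `|v| ^+ 2 => A0 B0.
have : 0 <= (c' - c - cc * (c * (cX * k))) * A by rewrite mulr_ge0 // /c'; lra.
have : 0 <= (c' - c - `|kX| * k ^+ 2 - C * (b * c)) * B by rewrite mulr_ge0 // /c'; lra.
lra.
Qed.

End Words.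

(** * Bi-Lipschitz bounds and openness of the exponential chart *)

Section ExponentialChart.
Variables (R : realType) (G : topGroupType) (N : G -> R).
Hypotheses (hG : hausdorff_space G) (HN : group_norm N).
Let N0 := gn_ge0 HN.
Let NV := gnV HN.
Let NM := gnM HN.

Variables (n : nat) (a : G -> 'rV[R]_n) (C r : R) (X : 'I_n -> R -> G).
Hypotheses (Ha : almost_hom N a C r)
  (HX : forall i, one_param N (X i) /\ is_tangent a (X i) 'e_i).
Let C0 := ah_C Ha.
Let r0 := ah_r Ha.

Definition Eword : seq ('I_n * 'cV[R]_n) := [seq (i, delta_mx i 0) | i <- enum 'I_n].
Definition E (t : 'rV[R]_n) : G := weval X t (map inr Eword).

Lemma lin_delta i (v : 'rV[R]_n) : lin (delta_mx i 0) v = v 0 i.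
Proof. by rewrite /lin -colE mxE. Qed.

Lemma wlin_E v : wlin (map (inr : _ -> letter R G n n) Eword) v = v.
Proof.
rewrite [RHS]row_sum_delta -big_enum /Eword /=; elim: (enum 'I_n) => [|i s IH] /=.
  by rewrite big_nil.
by rewrite big_cons IH lin_delta.
Qed.

Lemma E_chart : exists c s, [/\ 0 < c, 0 < s,
  (forall t t', `|t| < s -> `|t'| < s ->
     N ((E t)^-1 * E t')%g <= c * `|t' - t| /\ `|t' - t| <= c * N ((E t)^-1 * E t')%g),
  (forall t, `|t| < s -> exists2 e, 0 < e & forall h, N h < e ->
     exists2 t', `|t'| < s & E t' = (E t * h)%g) &
  (forall t v, `|t| < s -> `|v| < s -> N ((E t)^-1 * E (t + v))%g < r /\
     `|a ((E t)^-1 * E (t + v))%g - v| <= c * ((`|t| + `|v|) * `|v|))].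
Proof.
have [c [s [c0 s0 H0]]] := word_near0 HN Ha HX Eword.
have H z v : `|z| < s -> `|v| < s -> N ((E z)^-1 * E (z + v))%g <= c * `|v| /\
    `|a ((E z)^-1 * E (z + v))%g - v| <= c * ((`|z| + `|v|) * `|v|).
  by move=> zs vs; have [_ h1 h2] := H0 z v zs vs; rewrite wlin_E in h2.
pose q := C ^+ 2 * c + c + C * c + 1.
have Cc : 0 < C ^+ 2 * c by rewrite mulr_gt0 // exprn_gt0.
have Cc' : 0 < C * c by rewrite mulr_gt0.
have q0 : 0 < q by rewrite /q; lra.
(* The two-sided bounds hold on radius [2 * s1], the minimisation runs over radius [3 / 2 * s1], and
   the minimiser will lie within [s1], which leaves [s1 / 2] for a correction step. *)
pose s1 := Num.min (s / 4) (Num.min (r / (4 * q)) (1 / (16 * q))).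
have s10 : 0 < s1 by rewrite !lt_min !divr_gt0 // mulr_gt0.
have s1s : s1 <= s / 4 by rewrite ge_min lexx.
have s1r : s1 * (4 * q) <= r by rewrite -ler_pdivlMr ?mulr_gt0 // !ge_min lexx !orbT.
have s1q : s1 * (16 * q) <= 1 by rewrite -ler_pdivlMr ?mulr_gt0 // !ge_min lexx !orbT.
have qs u : 0 <= u -> c * u <= q * u by move=> u0; rewrite ler_wpM2r // /q; lra.
have upper t t' : `|t| < 2 * s1 -> `|t'| < 2 * s1 -> N ((E t)^-1 * E t')%g <= c * `|t' - t|.
  move=> ts ts'; have tt : `|t' - t| < s.
    by apply: le_lt_trans (ler_normB _ _) _; lra.
  by have [] := H t (t' - t) _ tt; [lra|rewrite addrC subrK].
have lower t t' : `|t| < 2 * s1 -> `|t'| < 2 * s1 ->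
    `|t' - t| <= 2 * C * N ((E t)^-1 * E t')%g.
  move=> ts ts'; have tt : `|t' - t| < 4 * s1.
    by apply: le_lt_trans (ler_normB _ _) _; lra.
  have [||] := H t (t' - t); [lra|lra|rewrite addrC subrK => h1 h2].
  have v0 := normr_ge0 (t' - t).
  have Nr : N ((E t)^-1 * E t')%g < r.
    apply: le_lt_trans h1 _; apply: le_lt_trans (qs _ v0) _.
    by apply: lt_le_trans s1r; rewrite mulrC mulrCA mulrA ltr_pM2r.
  have h3 := ah_le Ha Nr; have N1 := N0 ((E t)^-1 * E t')%g.
  move: h2 h3; set ak := a _ => h2 h3.
  have h4 : `|t' - t| <= `|ak| + `|ak - (t' - t)|.
    by rewrite -[X in `|X| <= _](subKr ak); apply: ler_normB.
  have h5 : c * (`|t| + `|t' - t|) <= 1 / 2.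
    apply: (@le_trans _ _ (q * (6 * s1))); last lra.
    by apply: ler_pM; rewrite ?(ltW c0) ?addr_ge0 // /q; lra.
  have := ler_wpM2r v0 h5; lra.
exists (c + 2 * C), s1; split=> //.
- by rewrite addr_gt0 // mulr_gt0.
- move=> t t' ts ts'; split.
    apply: le_trans (upper t t' _ _) _; [lra|lra|].
    by rewrite ler_wpM2r // lerDl mulr_ge0 // ltW.
  apply: le_trans (lower t t' _ _) _; [lra|lra|].
  by rewrite ler_wpM2r // lerDr ltW.
- move=> t0 ts0.
  have d0 : 0 < s1 - `|t0| by rewrite subr_gt0.
  pose e := Num.min ((s1 - `|t0|) / (4 * C + 1)) (Num.min (s1 / (2 * (C + 1))) (r / 2)).
  have C41 : 0 < 4 * C + 1 by rewrite addr_gt0 // mulr_gt0.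
  have C21 : 0 < 2 * (C + 1) by rewrite mulr_gt0 // addr_gt0.
  exists e; first by rewrite !lt_min !divr_gt0.
  move=> h; rewrite !lt_min => /and3P[e1 e2 e3].
  rewrite ltr_pdivlMr // in e1; rewrite ltr_pdivlMr // in e2.
  pose f t := N ((E t)^-1 * (E t0 * h))%g.
  pose A := [set t : 'rV[R]_n | `|t| <= 3 / 2 * s1].
  have At0 : A t0 by rewrite /A /=; lra.
  have cf : {within A, continuous f}.
    apply: continuous_in_subspaceT => t /set_mem At; rewrite /A /= in At.
    apply: (iffRL (@cvgrPdist_le _ _ _ (nbhs t) (nbhs_filter t) f (f t))) => eps eps0.
    have t2 : 0 < 2 * s1 - `|t| by lra.
    have ec : 0 < eps / c by rewrite divr_gt0.
    have nb d : 0 < d -> \forall t' \near t, `|t - t'| < d.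
      by move=> dp; pose proof (iffLR (cvgrPdist_lt _ _) (@cvg_id _ (nbhs t)) _ dp).
    near=> t'.
    have h1 : `|t - t'| < 2 * s1 - `|t| by near: t'; exact: nb.
    have h2 : `|t - t'| < eps / c by near: t'; exact: nb.
    have t's : `|t'| < 2 * s1.
      by have := ler_distD t t' 0; rewrite !subr0 (distrC t' t); lra.
    have ts : `|t| < 2 * s1 by lra.
    have b1 : N ((E t)^-1 * E t')%g <= eps.
      apply: le_trans (upper t t' ts t's) _; rewrite distrC -ler_pdivlMl // mulrC; exact: ltW.
    have := NM ((E t)^-1 * E t')%g ((E t')^-1 * (E t0 * h))%g.
    have := NM ((E t)^-1 * E t')^-1%g ((E t)^-1 * (E t0 * h))%g.
    have -> : (((E t)^-1 * E t')^-1 * ((E t)^-1 * (E t0 * h)) = (E t')^-1 * (E t0 * h))%g.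
      by rewrite invgM invgK -mulgA mulVKg.
    have -> : ((E t)^-1 * E t' * ((E t')^-1 * (E t0 * h)) = (E t)^-1 * (E t0 * h))%g.
      by rewrite -mulgA mulVKg.
    rewrite NV => u1 u2.
    by rewrite /f ler_norml; apply/andP; split; lra.
  have [t1 /set_mem At1 tmin] := EVT_min_rV (ex_intro _ t0 At0) (@compact_closed_ballrV R n _) cf.
  pose k := ((E t1)^-1 * (E t0 * h))%g.
  have Nkh : N k <= N h.
    have := tmin t0 (mem_set At0); rewrite {2}/f mulKg; exact.
  rewrite /A /= in At1.
  have t1s : `|t1| < s1.
    have l1 : `|t1 - t0| <= 2 * C * N ((E t0)^-1 * E t1)%g by apply: lower; lra.
    have e4 : ((E t0)^-1 * E t1 = h * k^-1)%g.
      by rewrite /k !invgM invgK !mulgA mulgV mul1g.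
    have := NM h k^-1%g; rewrite -e4 NV => u1.
    have u2 : 2 * C * N ((E t0)^-1 * E t1)%g <= 2 * C * (2 * N h).
      by rewrite ler_wpM2l ?mulr_ge0 ?(ltW C0) //; lra.
    have := ler_distD t0 t1 0; rewrite !subr0; have := N0 h; lra.
  exists t1 => //; apply/esym/eqP; rewrite -(mulVKg (E t1) (E t0 * h)%g) -/k.
  suff -> : k = 1%g by rewrite mulg1.
  apply: (gn_eq1 hG HN); apply/eqP; rewrite eq_le N0 andbT leNgt; apply/negP => Nk0.
  (* A Newton step: [v] cancels the residue [k] to first order, so the new residue [w] satisfies
     [N w <= N k / 4], which contradicts minimality since [N k > 0]. *)
  pose v := a k.
  have Nh0 := N0 h.
  have kr : N k < r by lra.
  have vk : `|v| <= C * N k := ah_le Ha kr.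
  have vs : `|v| < s1 / 2.
    apply: le_lt_trans vk _; apply: (@le_lt_trans _ _ (C * N h)).
      by rewrite ler_wpM2l // ltW.
    lra.
  have [||h1 h2] := H t1 v; [lra|lra|].
  move: h1 h2; set w0 := ((E t1)^-1 * E (t1 + v))%g => h1 h2.
  pose w := (w0^-1 * k)%g.
  have vn := normr_ge0 v; have tn := normr_ge0 t1.
  have h1' : N w0 <= r / 8.
    apply: le_trans h1 _; apply: le_trans (qs _ vn) _.
    apply: (@le_trans _ _ (q * (s1 / 2))); first by rewrite ler_wpM2l ?(ltW q0) // ltW.
    lra.
  have Nw : N w < r by apply: le_lt_trans (NM _ _) _; rewrite NV; lra.
  have w0r : N w0 < r by lra.
  have h3 := ahM Ha w0r Nw; rewrite mulVKg in h3.
  have h4 := ah_ge Ha Nw.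
  have h5 : `|a w| <= c * ((`|t1| + `|v|) * `|v|) + C * (c * `|v| * N w).
    have -> : a w = - ((a w0 - v) + (a k - a w0 - a w)).
      by rewrite -/v; apply/rowP => i; rewrite !mxE; ring.
    rewrite normrN; apply: le_trans (ler_normD _ _) _; rewrite lerD //.
    apply: le_trans h3 _; rewrite ler_wpM2l ?(ltW C0) //.
    by rewrite ler_wpM2r.
  have Nw0 := N0 w.
  have h6 : N w <= C * c * (`|t1| + `|v|) * `|v| + C ^+ 2 * c * `|v| * N w.
    apply: le_trans h4 _; apply: le_trans (ler_wpM2l (ltW C0) h5) _.
    by rewrite le_eqVlt; apply/orP; left; apply/eqP; ring.
  have h7 : C ^+ 2 * c * `|v| <= 1 / 2.
    apply: (@le_trans _ _ (q * (s1 / 2))); last lra.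
    by apply: ler_pM; rewrite ?(ltW Cc) ?(ltW vs) // /q; lra.
  have h8 := ler_wpM2r Nw0 h7.
  have h9 : C * c * (`|t1| + `|v|) * `|v| <= C * c * (2 * s1) * (C * N k).
    apply: ler_pM => //; first by rewrite mulr_ge0 ?(ltW Cc') // addr_ge0.
    by rewrite ler_wpM2l ?(ltW Cc') //; lra.
  have h10 : C * c * (2 * s1) * (C * N k) <= q * (2 * s1) * N k.
    have -> : C * c * (2 * s1) * (C * N k) = C ^+ 2 * c * (2 * s1) * N k by ring.
    rewrite ler_wpM2r ?(ltW Nk0) // ler_wpM2r ?mulr_ge0 ?(ltW s10) // /q; lra.
  have h11 : q * (2 * s1) * N k <= 1 / 8 * N k by rewrite ler_wpM2r ?(ltW Nk0) //; lra.
  have := tmin (t1 + v); rewrite /f.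
  have -> : ((E (t1 + v))^-1 * (E t0 * h) = w)%g.
    by rewrite /w /w0 /k invgM invgK -!mulgA mulVKg.
  rewrite -/k => tm; have : N k <= N w.
    apply: tm; apply: mem_set; rewrite /A /=.
    by apply: le_trans (ler_normD _ _) _; lra.
  move=> kw; have h12 := le_trans h9 (le_trans h10 h11).
  suff : N k <= 0 by rewrite leNgt Nk0.
  by lra.
move=> t v ts vs; have [||h1 h2] := H t v; [lra|lra|]; split.
  apply: le_lt_trans h1 _; apply: le_lt_trans (qs _ (normr_ge0 _)) _.
  have : q * `|v| < q * s1 by rewrite ltr_pM2l.
  by have := mulr_gt0 q0 s10; lra.
by apply: le_trans h2 _; rewrite ler_wpM2r ?mulr_ge0 ?addr_ge0 // lerDl mulr_ge0 // ltW.
Unshelve. all: by end_near. Qed.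

End ExponentialChart.

(** * The adjoint representation *)

(** The slope [b] is a limit of [m * f (1 / m)]. Adding up equal steps gives
    [|f (k * s) - k * f s| <= K * (k * s)^2], and multiples of [1 / m] approximate [t]. A negative
    [t] takes one more use of almost additivity, whence the factor 2. *)
Lemma almost_additive_lin (R : realType) (f : R -> R) (K d : R) : 0 < d -> 0 <= K ->
  (forall s t, `|s| < d -> `|t| < d -> `|f (s + t) - f s - f t| <= K * (`|s| * `|t|)) ->
  (forall t, `|t| < d -> `|f t| <= K * `|t|) ->
  exists b, forall t, `|t| < d -> `|f t - t * b| <= 2 * K * t ^+ 2.
Proof.
move=> d0 K0 fD fb.
have [FF [UF sub]] := ultraFilterLemma (eventually_filter : ProperFilter \oo).
pose u (i : nat) : R := i.+1%:R * f i.+1%:R^-1.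
have i0 (i : nat) : 0 < i.+1%:R :> R by rewrite ltr0n.
have iV0 (i : nat) : 0 < i.+1%:R^-1 :> R by rewrite invr_gt0.
have small (e c : R) : 0 < e -> \forall i \near FF, c / i.+1%:R < e.
  move=> e0; pose proof (cvgr0_norm_lt _ (@cvg_harmonic_ultra R FF UF c sub) _ e0) as H.
  by apply: filterS H => i; apply: le_lt_trans; exact: ler_norm.
have id_ : \forall i \near FF, i.+1%:R^-1 < d.
  by apply: filterS (small _ 1 d0) => i; rewrite div1r.
have ub : \forall i \near FF, `[- K, K]%classic (u i).
  apply: filterS id_ => i ild; rewrite /= in_itv /= -ler_norml /u normrM (ger0_norm (ltW (i0 i))).
  have fi : `|f i.+1%:R^-1| <= K * `|i.+1%:R^-1| by apply: fb; rewrite ger0_norm // ltW.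
  apply: le_trans (ler_wpM2l (ltW (i0 i)) fi) _.
  by rewrite ger0_norm ?(ltW (iV0 i)) // mulrCA divff ?mulr1 // gt_eqF.
have := @segment_compact R (- K) K.
rewrite compact_ultra => /(_ _ (ultra_fmap u UF) ub) [b [_ ub']].
exists b.
have f0 : f 0 = 0.
  by apply/eqP; rewrite -normr_le0; apply: le_trans (fb 0 _) _; rewrite normr0 ?mulr0.
have mult s k : 0 <= s -> k%:R * s < d -> `|f (k%:R * s) - k%:R * f s| <= K * (k%:R * s) ^+ 2.
  move=> s0; elim: k => [|k IH] ks.
    by rewrite !mul0r f0 subr0 normr0 expr0n mulr0.
  rewrite -natr1 mulrDl mul1r in ks *.
  have k0 : 0 <= k%:R * s by rewrite mulr_ge0.
  have h1 : `|f (k%:R * s + s) - f (k%:R * s) - f s| <= K * (k%:R * s * s).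
    by have := fD (k%:R * s) s; rewrite (ger0_norm k0) (ger0_norm s0); apply; lra.
  have {}IH : `|f (k%:R * s) - k%:R * f s| <= K * (k%:R * s) ^+ 2 by apply: IH; lra.
  have -> : f (k%:R * s + s) - (k%:R + 1) * f s =
    (f (k%:R * s + s) - f (k%:R * s) - f s) + (f (k%:R * s) - k%:R * f s) by ring.
  apply: le_trans (ler_normD _ _) _; apply: le_trans (lerD h1 IH) _.
  have p1 : 0 <= K * (k%:R * s * s) by rewrite !mulr_ge0.
  have p2 : 0 <= K * (s * s) by rewrite !mulr_ge0.
  have -> : K * (k%:R * s + s) ^+ 2 = K * (k%:R * s) ^+ 2 + 2 * (K * (k%:R * s * s)) + K * (s * s).
    by ring.
  lra.
have pos t : 0 <= t -> t < d -> `|f t - t * b| <= K * t ^+ 2.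
  move=> t0 td; apply/ler_addgt0Pr => e e0.
  have e3 : 0 < e / 3 by rewrite divr_gt0.
  have et : 0 < e / 3 / (t + 1) by rewrite divr_gt0 // ltr_wpDl.
  pose proof (iffLR (cvgrPdist_le _ _) ub' _ et) as H1.
  have [i [h1 [h2 [h3 h4]]]] := filter_ex (filterI H1 (filterI id_
    (filterI (small _ (K * (1 + d)) e3) (small _ `|b| e3)))).
  pose m : R := i.+1%:R; pose k := Num.truncn (t * m).
  rewrite -/m in h2 h3 h4.
  have m0 : 0 < m := i0 i; have mV0 : 0 < m^-1 := iV0 i.
  have /andP[k1 k2] : k%:R <= t * m < k.+1%:R by apply: truncn_itv; rewrite mulr_ge0 // ltW.
  pose s := k%:R * m^-1.
  have s0 : 0 <= s by rewrite mulr_ge0 // ltW.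
  have st : s <= t by rewrite /s ler_pdivrMr.
  have ts : t - s <= m^-1.
    have : t <= k.+1%:R / m by rewrite ler_pdivlMr // ltW.
    by rewrite lerBlDl -[k.+1%:R]natr1 mulrDl mul1r.
  have t0' : 0 <= t - s by rewrite subr_ge0.
  have sd : s < d := le_lt_trans st td.
  have tsd : t - s < d by apply: le_lt_trans td; rewrite gerBl.
  have g1 : `|f t - f s - f (t - s)| <= K * (s * (t - s)).
    have := fD s (t - s); rewrite (ger0_norm s0) (ger0_norm t0').
    by rewrite [s + (t - s)]addrC subrK; apply.
  have g2 : `|f (t - s)| <= K * (t - s).
    by have := fb (t - s); rewrite (ger0_norm t0'); apply.
  have g3 : `|f s - k%:R * f m^-1| <= K * s ^+ 2.
    by apply: mult; [exact: ltW|].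
  have e1 : k%:R * f m^-1 = s * u i by rewrite /s /u -/m mulrA mulfVK // gt_eqF.
  have g4 : `|s * u i - t * b| <= e / 3 + e / 3.
    have -> : s * u i - t * b = - (s * (b - u i) + (t - s) * b) by ring.
    rewrite normrN; apply: le_trans (ler_normD _ _) _; rewrite (normrM s) (normrM (t - s)) lerD //.
      apply: (@le_trans _ _ ((t + 1) * (e / 3 / (t + 1)))).
        apply: ler_pM => //.
        by rewrite (ger0_norm s0); apply: le_trans st _; rewrite lerDl.
      by rewrite mulrCA divff ?mulr1 // gt_eqF // ltr_wpDl.
    rewrite ger0_norm //; apply: le_trans (ltW h4); rewrite mulrC ler_wpM2l //.
  have g5 : K * (s * (t - s)) + K * (t - s) <= e / 3.
    apply: le_trans (ltW h3); have -> : K * (s * (t - s)) + K * (t - s) = K * ((s + 1) * (t - s)) by ring.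
    rewrite -mulrA ler_wpM2l //; apply: ler_pM => //; first by rewrite addr_ge0.
    by rewrite addrC lerD2l ltW.
  have g6 : K * s ^+ 2 <= K * t ^+ 2 by rewrite ler_wpM2l // ler_sqr ?nnegrE.
  have -> : f t - t * b = (f t - f s - f (t - s)) + f (t - s) + (f s - k%:R * f m^-1)
      + (s * u i - t * b) by rewrite e1; ring.
  apply: le_trans (ler_normD _ _) _; have := ler_normD (f t - f s - f (t - s) + f (t - s)) (f s - k%:R * f m^-1).
  have := ler_normD (f t - f s - f (t - s)) (f (t - s)); lra.
move=> t td; have [t0|t0] := leP 0 t.
  rewrite ger0_norm // in td; apply: le_trans (pos t t0 td) _.
  by rewrite ler_wpM2r ?sqr_ge0 //; lra.
have nt0 : 0 <= - t by rewrite oppr_ge0 ltW.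
have ntd : - t < d by rewrite -(ltr0_norm t0).
have h1 := pos _ nt0 ntd.
have h2 := fD t (- t); rewrite subrr f0 normrN sub0r in h2; have {}h2 := h2 td td.
have -> : f t - t * b = - ((f (- t) - - t * b) + (- f t - f (- t))) by ring.
rewrite normrN; apply: le_trans (ler_normD _ _) _; apply: le_trans (lerD h1 h2) _.
by rewrite sqrrN -expr2 real_normK ?num_real //; lra.
Qed.

(** Extracts an exact inequality between linear parts from an estimate with quadratic error, by
    dividing by [t] and letting it tend to 0. *)
Lemma small_linear_bound (R : realType) n (v : 'rV[R]_n) (k c s : R) : 0 < s ->
  (forall t, 0 < t -> t < s -> `|t *: v| <= k * t + c * t ^+ 2) -> `|v| <= k.
Proof.
move=> s0 H; apply/ler_addgt0Pr => e e0.
have c1 : 0 < `|c| + 1 by rewrite ltr_wpDl.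
pose t := Num.min (s / 2) (e / (`|c| + 1)).
have t0 : 0 < t by rewrite lt_min !divr_gt0.
have ts : t < s by apply: (@le_lt_trans _ _ (s / 2)); [rewrite ge_min lexx|lra].
have te : t * (`|c| + 1) <= e by rewrite -ler_pdivlMr // ge_min lexx orbT.
have := H t t0 ts; rewrite normrZ (ger0_norm (ltW t0)) => h.
have ct : c * t <= e.
  apply: le_trans te; rewrite mulrC ler_wpM2l ?(ltW t0) //.
  by apply: le_trans (ler_norm c) _; rewrite lerDl.
rewrite -(ler_pM2l t0); apply: le_trans h _.
have -> : k * t + c * t ^+ 2 = t * (k + c * t) by ring.
by rewrite ler_pM2l // lerD2l.
Qed.

Lemma coord_linear_bound (R : realType) n (M : 'M[R]_n) k :
  (forall i, `|row i M| <= k) -> forall i j, `|M i j| <= k.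
Proof.
by move=> H i j; apply: le_trans (H i); have := coord_le_rVnorm (row i M) j; rewrite mxE.
Qed.

Section Adjoint.
Variables (R : realType) (G : topGroupType) (N : G -> R).
Hypotheses (hG : hausdorff_space G) (HN : group_norm N).
Let N0 := gn_ge0 HN.
Let NM := gnM HN.

Variables (n : nat) (a : G -> 'rV[R]_n) (C r : R) (X : 'I_n -> R -> G).
Hypotheses (Ha : almost_hom N a C r)
  (HX : forall i, one_param N (X i) /\ is_tangent a (X i) 'e_i).
Let C0 := ah_C Ha.
Let r0 := ah_r Ha.

Lemma conj_near1 (h : G) (d : R) : 0 < d ->
  exists2 e, 0 < e & forall g, N g < e -> N (g ^ h)%g < d.
Proof.
move=> d0; apply: (gn_nbhs HN (W := [set g | N (g ^ h)%g < d])).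
have : nbhs (h^-1 * (1 * h))%g [set g | N g < d].
  by rewrite mul1g mulVg; exact: gn_small.
have cj : (fun g => h^-1 * (g * h))%g @ nbhs (1%g : G) --> (h^-1 * (1 * h))%g.
  by apply: cvgMg; [exact: cvg_cst|apply: cvgMg; [exact: cvg_id|exact: cvg_cst]].
by move/cj.
Qed.

(* Powers of [y] staying in a small ball add up almost linearly, which bounds [N y]
   by the inverse of the number of powers. *)
Lemma escape_bound y k (e : R) : e < r -> C ^+ 2 * e <= 1 / 2 ->
  (forall i, (i <= k)%N -> N (y ^+ i)%g < e) -> k%:R * N y <= 2 * C ^+ 2 * e.
Proof.
move=> er Ce Hy; have Ny := N0 y.
have e0 : 0 <= e by apply: le_trans (ltW (Hy 0%N isT)); exact: N0.
case: k Hy => [|k] Hy; first by rewrite mul0r !mulr_ge0 // ?exprn_ge0 // ltW.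
have y1 : N y < e by rewrite -[y]expg1; exact: Hy.
have yr := lt_trans y1 er.
have key i : (i <= k.+1)%N -> `|a (y ^+ i)%g - i%:R *: a y| <= i%:R * (C * (e * N y)).
  elim: i => [|i IH] ik; first by rewrite expg0 (ah1 HN Ha) scale0r subrr normr0 mul0r.
  have yi := Hy i (ltnW ik).
  have h1 := ahM Ha (lt_trans yi er) yr; rewrite -expgSr in h1.
  have -> : a (y ^+ i.+1)%g - i.+1%:R *: a y =
    (a (y ^+ i.+1)%g - a (y ^+ i)%g - a y) + (a (y ^+ i)%g - i%:R *: a y).
    by rewrite -natr1; apply/rowP => j; rewrite !mxE; ring.
  apply: le_trans (ler_normD _ _) _; rewrite -natr1 mulrDl mul1r addrC lerD //.
    exact/IH/ltnW.
  apply: le_trans h1 _; rewrite ler_wpM2l ?(ltW C0) // ler_wpM2r // ltW //.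
have h2 := key _ (leqnn _); have h3 := ah_le Ha (lt_trans (Hy _ (leqnn k.+1)) er).
have h4 := ah_ge Ha yr.
set K : R := k.+1%:R in h2 *; have K0 : 0 <= K by [].
have h5 : K * `|a y| <= C * e + K * (C * (e * N y)).
  rewrite -{1}(ger0_norm K0) -normrZ -[K *: a y](subKr (a (y ^+ k.+1)%g)).
  apply: le_trans (ler_normB _ _) _; rewrite lerD //.
  by apply: le_trans h3 _; rewrite ler_wpM2l ?(ltW C0) // ltW // Hy.
have h6 : K * N y <= C * (K * `|a y|) by rewrite mulrCA ler_wpM2l.
have h7 : C * (K * (C * (e * N y))) <= 1 / 2 * (K * N y).
  have -> : C * (K * (C * (e * N y))) = (C ^+ 2 * e) * (K * N y) by ring.
  by rewrite ler_wpM2r // mulr_ge0.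
have h8 := ler_wpM2l (ltW C0) h5.
have e1 : C * (C * e + K * (C * (e * N y))) = C ^+ 2 * e + C * (K * (C * (e * N y))) by ring.
rewrite e1 in h8.
lra.
Qed.

(** [conj_almost] only treats conjugation by elements near 1. For a fixed [h], continuity maps a
    ball of radius [d] into one of radius [e]. About [d / N g] powers of [g] stay in the first, so
    as many powers of [g ^ h] stay in the second, and [escape_bound] converts their number into a
    bound on [N (g ^ h)]. *)
Lemma conj_lipschitz h : exists c s, [/\ 0 < c, 0 < s & forall g, N g < s -> N (g ^ h)%g <= c * N g].
Proof.
have C2 : 0 < C ^+ 2 by rewrite exprn_gt0.
pose e := Num.min (r / 2) (1 / (2 * C ^+ 2)).
have e0 : 0 < e by rewrite lt_min !divr_gt0 // mulr_gt0.
have er : e < r by apply: (@le_lt_trans _ _ (r / 2)); [rewrite ge_min lexx|move: r0; lra].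
have Ce : C ^+ 2 * e <= 1 / 2.
  have : e * (2 * C ^+ 2) <= 1 by rewrite -ler_pdivlMr ?mulr_gt0 // ge_min lexx orbT.
  lra.
have [d d0 Hd] := conj_near1 h e0.
exists (4 * C ^+ 2 * e / d), (d / 2); split; rewrite ?divr_gt0 ?mulr_gt0 //.
move=> g gd; have [g0|g0] := eqVneq (N g) 0.
  by rewrite (gn_eq1 hG HN g0) conj1g (gn1 HN) mulr0.
have Ng : 0 < N g by rewrite lt_neqAle eq_sym g0 N0.
(* Rounded up so that [d <= k * (2 * N g)], while [N g < d / 2] still gives [k * N g < d]. *)
pose k := (Num.truncn (d / (2 * N g))).+1.
have dN : 0 <= d / (2 * N g) by rewrite divr_ge0 ?mulr_ge0 // ltW.
have /andP[k1 k2] := truncn_itv dN.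
have kN : k%:R * N g < d.
  rewrite /k -natr1 mulrDl mul1r.
  have := ler_wpM2r (ltW Ng) k1.
  have -> : d / (2 * N g) * N g = d / 2 by field; rewrite gt_eqF.
  lra.
have Hy i : (i <= k)%N -> N ((g ^ h) ^+ i)%g < e.
  move=> ik; rewrite -conjXg; apply: Hd; apply: le_lt_trans kN.
  by apply: le_trans (NX HN g i) _; rewrite ler_wpM2r // ler_nat.
have := escape_bound er Ce Hy.
have kd : d <= k%:R * (2 * N g) by rewrite -ler_pdivrMr ?mulr_gt0 // ltW.
have k0 : 0 < k%:R :> R by rewrite ltr0n.
rewrite -ler_pdivlMl // => /le_trans; apply.
rewrite ler_pdivrMl // [leRHS](_ : _ = 2 * C ^+ 2 * e * ((k%:R * (2 * N g)) / d)).
  apply: ler_peMr; last by rewrite ler_pdivlMr // mul1r.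
  by rewrite mulr_ge0 ?(ltW e0) // mulr_ge0 // ltW.
by field; rewrite gt_eqF.
Qed.

(** The matrix acts on row vectors from the right, in accordance with the right action [g ^ h], so
    [AdM] keeps the order of the factors. *)
Definition is_Ad (h : G) (M : 'M[R]_n) := exists c s, [/\ 0 < c, 0 < s &
  forall g, N g < s -> `|a (g ^ h)%g - a g *m M| <= c * N g ^+ 2].

Lemma one_param_conj_tangent h i : exists b : 'rV[R]_n, exists c s, [/\ 0 < c, 0 < s &
  forall t, `|t| < s -> `|a (X i t ^ h)%g - t *: b| <= c * t ^+ 2].
Proof.
have [ch [sh [ch0 sh0 Hh]]] := conj_lipschitz h.
have [[XD [cX cX0 bX]] _] := HX i.
pose q := ch * (cX + 1) ; have q0 : 0 < q by rewrite mulr_gt0 // ltr_wpDl.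
have cX1 : 0 < cX + 1 by rewrite ltr_wpDl.
pose d := Num.min (sh / (cX + 1)) (r / q).
have d0 : 0 < d by rewrite lt_min !divr_gt0.
have NX' t : `|t| < d -> N (X i t ^ h)%g <= q * `|t| /\ N (X i t ^ h)%g < r.
  rewrite lt_min => /andP[]; rewrite !ltr_pdivlMr // => t1 t2.
  have b1 : N (X i t) <= (cX + 1) * `|t|.
    by apply: le_trans (bX t) _; rewrite ler_wpM2r // lerDl.
  have b2 : N (X i t ^ h)%g <= q * `|t|.
    apply: le_trans (Hh _ _) _; last by rewrite /q -mulrA ler_wpM2l // ltW.
    by apply: le_lt_trans b1 _; rewrite mulrC.
  by split=> //; apply: le_lt_trans b2 _; rewrite mulrC.
pose K := C * q ^+ 2 + C * q.
have p1 : 0 <= C * q ^+ 2 by rewrite mulr_ge0 ?sqr_ge0 // ltW.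
have p2 : 0 < C * q by rewrite mulr_gt0.
have K0 : 0 <= K by rewrite addr_ge0 // ltW.
have ex (j : 'I_n) : exists b, forall t, `|t| < d -> `|a (X i t ^ h)%g 0 j - t * b| <= 2 * K * t ^+ 2.
  apply: (@almost_additive_lin R (fun t => a (X i t ^ h)%g 0 j) K d d0 K0).
    move=> s t /NX'[s1 s2] /NX'[t1 t2]; rewrite XD conjMg.
    have := coord_le_rVnorm (a (X i s ^ h * X i t ^ h)%g - a (X i s ^ h)%g - a (X i t ^ h)%g) j.
    rewrite !mxE => /le_trans; apply; apply: le_trans (ahM Ha s2 t2) _.
    apply: (@le_trans _ _ (C * (q * `|s| * (q * `|t|)))).
      by rewrite ler_wpM2l ?(ltW C0) //; apply: ler_pM.
    have -> : C * (q * `|s| * (q * `|t|)) = C * q ^+ 2 * (`|s| * `|t|) by ring.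
    by rewrite ler_wpM2r ?mulr_ge0 // lerDl ltW.
  move=> t /NX'[t1 t2]; apply: le_trans (coord_le_rVnorm _ _) _.
  apply: le_trans (ah_le Ha t2) _; apply: le_trans (ler_wpM2l (ltW C0) t1) _.
  by rewrite mulrA ler_wpM2r // lerDr.
have [b Hb] := choice ex.
exists (\row_j b j), (2 * K + 1), d; split=> //.
  by rewrite ltr_wpDl // mulr_ge0.
move=> t td; have p3 : 0 <= 2 * K * t ^+ 2 by rewrite mulr_ge0 ?sqr_ge0 // mulr_ge0.
apply: (@le_trans _ _ (2 * K * t ^+ 2)); last by rewrite ler_wpM2r ?sqr_ge0 // lerDl.
by apply: rVnorm_le => // j; rewrite !mxE; exact: Hb.
Qed.

(** The rows of [M] are the tangents of the conjugated one-parameter subgroups. Conjugation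
    distributes over words, so the expansion holds for words in the [X i], and by [E_chart] every
    [g] near 1 is such a word. *)
Lemma Ad_exists h : exists M, is_Ad h M.
Proof.
have [ch [sh [ch0 sh0 Hh]]] := conj_lipschitz h.
have [b Hb] := choice (one_param_conj_tangent h).
pose M : 'M[R]_n := \matrix_i b i.
have word_conj (w : seq ('I_n * 'cV[R]_n)) : exists c s, [/\ 0 < c, 0 < s & forall t, `|t| < s ->
    N (weval X t (map inr w) ^ h)%g <= c * `|t| /\
    `|a (weval X t (map inr w) ^ h)%g - wlin (map (inr : _ -> letter R G n n) w) t *m M| <= c * `|t| ^+ 2].
  elim: w => [|[i l] w [c [s [c0 s0 IH]]]].
    exists 1, 1; split=> // t _.
    by rewrite /= conj1g (gn1 HN) (ah1 HN Ha) mul0mx subrr normr0 !mul1r sqr_ge0.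
  have [[XD [cX cX0 bX]] _] := HX i.
  have [k k0 Hk] := lin_bounded l.
  have [ci [si [ci0 si0 Hi]]] := Hb i.
  pose q := ch * (cX * k).
  have q0 : 0 <= q by rewrite !mulr_ge0 // ltW.
  have k1 : 0 < k + 1 by rewrite ltr_wpDl.
  have ck0 : 0 <= ci * k ^+ 2 by rewrite mulr_ge0 ?sqr_ge0 // ltW.
  have Cqc : 0 <= C * (q * c) by rewrite !mulr_ge0 // ltW.
  have cXk : 0 <= cX * k by rewrite mulr_ge0.
  pose c' := C * (q * c) + ci * k ^+ 2 + c + q + cX * k + k + 1.
  have c'0 : 0 < c' by rewrite /c'; lra.
  pose s' := Num.min s (Num.min (si / c') (Num.min (r / c') (sh / c'))).
  exists c', s'; split=> //; first by rewrite !lt_min s0 !divr_gt0.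
  move=> t; rewrite !lt_min => /and4P[t1]; rewrite !ltr_pdivlMr // => t2 t3 t4.
  have [h1 h2] := IH t t1.
  have small u : u <= c' -> u * `|t| <= `|t| * c' by move=> uc; rewrite mulrC ler_wpM2l.
  have N1 : N (X i (lin l t)) <= cX * k * `|t|.
    by apply: le_trans (bX _) _; rewrite -mulrA ler_wpM2l.
  have N2 : N (X i (lin l t) ^ h)%g <= q * `|t|.
    apply: le_trans (Hh _ _) _; last by rewrite /q -mulrA ler_wpM2l // ltW.
    by apply: le_lt_trans N1 _; apply: le_lt_trans t4; apply: small; rewrite /c'; lra.
  have r1 : N (X i (lin l t) ^ h)%g < r.
    by apply: le_lt_trans N2 _; apply: le_lt_trans t3; apply: small; rewrite /c'; lra.
  have r2 : N (weval X t (map inr w) ^ h)%g < r.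
    by apply: le_lt_trans h1 _; apply: le_lt_trans t3; apply: small; rewrite /c'; lra.
  have h3 : `|a (X i (lin l t) ^ h)%g - lin l t *: b i| <= ci * k ^+ 2 * `|t| ^+ 2.
    apply: le_trans (Hi _ _) _.
      apply: le_lt_trans (Hk t) _; apply: le_lt_trans t2; apply: small; rewrite /c'; lra.
    rewrite -mulrA ler_wpM2l ?(ltW ci0) // -exprMn -[lin l t ^+ 2]real_normK ?num_real //.
    by rewrite ler_sqr ?nnegrE ?mulr_ge0.
  rewrite /= conjMg; split.
    apply: le_trans (NM _ _) _; apply: le_trans (lerD N2 h1) _.
    by rewrite -mulrDl ler_wpM2r // /c'; lra.
  rewrite mulmxDl -scalemxAl -rowE rowK.
  apply: le_trans (ah_mul_approx HN Ha r1 r2 h3 h2 N2 h1) _.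
  by rewrite -!mulrDl ler_wpM2r ?sqr_ge0 // /c'; lra.
have [cE [sE [cE0 sE0 E1 E2 E3]]] := E_chart hG HN Ha HX.
have [cw [sw [cw0 sw0 Hw]]] := word_conj (Eword R n).
have [cM cM0 HM] := mulmx_bounded M.
have z0 : `|0 : 'rV[R]_n| < sE by rewrite normr0.
have E0 : E X 0 = 1%g.
  rewrite /E; elim: (Eword R n) => //= -[i c] w ->; rewrite mulg1.
  by rewrite /lin mul0mx mxE (one_param0 (HX i).1).
have [e e0 He] := E2 0 z0.
pose c' := cw * cE ^+ 2 + cM * (cE * cE ^+ 2) + 1.
have p1 : 0 <= cw * cE ^+ 2 by rewrite mulr_ge0 ?sqr_ge0 // ltW.
have p2 : 0 <= cM * (cE * cE ^+ 2) by rewrite !mulr_ge0 ?sqr_ge0 // ltW.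
exists M, c', (Num.min e (sw / cE)); split.
- by rewrite ltr_wpDl // addr_ge0.
- by rewrite lt_min e0 divr_gt0.
move=> g; rewrite lt_min => /andP[ge gs]; rewrite ltr_pdivlMr // mulrC in gs.
have [t ts Et] := He g ge; rewrite E0 mul1g in Et.
have [_ tN] := E1 0 t z0 ts; rewrite E0 invg1 mul1g Et subr0 in tN.
have [_ ag] := E3 0 t z0 ts; rewrite E0 invg1 mul1g add0r Et normr0 add0r -expr2 in ag.
have [_] := Hw t (le_lt_trans tN gs); rewrite -/(E X t) Et wlin_E => ah.
have tsq : `|t| ^+ 2 <= cE ^+ 2 * N g ^+ 2.
  by rewrite -exprMn ler_sqr ?nnegrE ?mulr_ge0 // ltW.
have -> : a (g ^ h)%g - a g *m M = (a (g ^ h)%g - t *m M) - (a g - t) *m M.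
  by rewrite mulmxBl opprB addrA subrK.
apply: le_trans (ler_normB _ _) _.
have g1 : `|a (g ^ h)%g - t *m M| <= cw * cE ^+ 2 * N g ^+ 2.
  by apply: le_trans ah _; rewrite -mulrA ler_wpM2l // ltW.
have g2 : `|(a g - t) *m M| <= cM * (cE * cE ^+ 2) * N g ^+ 2.
  have -> : cM * (cE * cE ^+ 2) * N g ^+ 2 = cM * (cE * (cE ^+ 2 * N g ^+ 2)) by ring.
  apply: le_trans (HM _) _; rewrite ler_wpM2l //.
  by apply: le_trans ag _; rewrite ler_wpM2l ?(ltW cE0).
apply: le_trans (lerD g1 g2) _; rewrite -mulrDl ler_wpM2r ?sqr_ge0 // /c'; lra.
Qed.

End Adjoint.

(** * Multiplicativity and derivatives of [Ad], and the differential of a word *)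

Section AdjointHom.
Variables (R : realType) (G : topGroupType) (N : G -> R).
Hypotheses (hG : hausdorff_space G) (HN : group_norm N).
Let N0 := gn_ge0 HN.
Let NM := gnM HN.

Variables (n : nat) (a : G -> 'rV[R]_n) (C r : R) (X : 'I_n -> R -> G).
Hypotheses (Ha : almost_hom N a C r)
  (HX : forall i, one_param N (X i) /\ is_tangent a (X i) 'e_i).
Let C0 := ah_C Ha.
Let r0 := ah_r Ha.

Variable Ad : G -> 'M[R]_n.
Hypothesis HAd : forall h, is_Ad N a h (Ad h).

Lemma Ad_tangent h i : exists c s, [/\ 0 < c, 0 < s & forall t, `|t| < s ->
  `|a (X i t ^ h)%g - t *: row i (Ad h)| <= c * t ^+ 2].
Proof.
have [cA [sA [cA0 sA0 H]]] := HAd h.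
have [[_ [cX cX0 bX]] [kX [sX [sX0 tX]]]] := HX i.
have [cM cM0 HM] := mulmx_bounded (Ad h).
have cX1 : 0 < cX + 1 by rewrite ltr_wpDl.
have q1 : 0 <= cA * (cX + 1) ^+ 2 by rewrite mulr_ge0 ?sqr_ge0 // ltW.
have q2 : 0 <= cM * `|kX| by rewrite mulr_ge0.
exists (cA * (cX + 1) ^+ 2 + cM * `|kX| + 1), (Num.min sX (sA / (cX + 1))); split.
- by rewrite ltr_wpDl // addr_ge0.
- by rewrite lt_min sX0 divr_gt0.
move=> t; rewrite lt_min => /andP[t1]; rewrite ltr_pdivlMr // => t2.
have b1 : N (X i t) <= (cX + 1) * `|t|.
  by apply: le_trans (bX t) _; rewrite ler_wpM2r // lerDl.
have h1 := H (X i t) (le_lt_trans b1 (_ : _ < sA)).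
have {}h1 : `|a (X i t ^ h)%g - a (X i t) *m Ad h| <= cA * N (X i t) ^+ 2.
  by apply: h1; rewrite mulrC.
have -> : a (X i t ^ h)%g - t *: row i (Ad h) =
  (a (X i t ^ h)%g - a (X i t) *m Ad h) + (a (X i t) - t *: 'e_i) *m Ad h.
  by rewrite mulmxBl -scalemxAl -rowE addrA subrK.
apply: le_trans (ler_normD _ _) _; rewrite -addrA mulrDl lerD //.
  apply: le_trans h1 _; rewrite -mulrA ler_wpM2l ?(ltW cA0) //.
  by rewrite -[t ^+ 2]real_normK ?num_real // -exprMn ler_sqr ?nnegrE ?mulr_ge0 // ltW.
apply: le_trans (HM _) _; apply: le_trans (ler_wpM2l cM0 (tX t t1)) _.
rewrite mulrA ler_wpM2r ?sqr_ge0 //.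
apply: (@le_trans _ _ (cM * `|kX|)); last by rewrite lerDl.
by rewrite ler_wpM2l // ler_norm.
Qed.

(** Tested on the [X i t], whose tangents are the standard basis vectors. *)
Lemma Ad_unique h M : is_Ad N a h M -> Ad h = M.
Proof.
move=> [cM [sM [cM0 sM0 HM]]]; apply/row_matrixP => i.
apply/eqP; rewrite -subr_eq0 -normr_le0.
have [c1 [s1 [c10 s10 H1]]] := Ad_tangent h i.
have [[_ [cX cX0 bX]] [kX [sX [sX0 tX]]]] := HX i.
have [k k0 Hk] := mulmx_bounded M.
have cX1 : 0 < cX + 1 by rewrite ltr_wpDl.
apply: (@small_linear_bound R n _ 0 (c1 + cM * (cX + 1) ^+ 2 + k * `|kX|)
  (Num.min s1 (Num.min sX (sM / (cX + 1))))).
  by rewrite !lt_min s10 sX0 divr_gt0.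
move=> t t0; rewrite !lt_min => /and3P[t1 t2]; rewrite ltr_pdivlMr // => t3.
have tn : `|t| = t by rewrite gtr0_norm.
have h1 := H1 t; rewrite tn in h1; have {}h1 := h1 t1.
have b1 : N (X i t) <= (cX + 1) * t.
  by rewrite -{2}tn; apply: le_trans (bX t) _; rewrite ler_wpM2r // lerDl.
have h2 : `|a (X i t ^ h)%g - a (X i t) *m M| <= cM * N (X i t) ^+ 2.
  by apply: HM; apply: le_lt_trans b1 _; rewrite mulrC.
have h3 := tX t; rewrite tn in h3; have {}h3 := h3 t2.
rewrite mul0r add0r.
have -> : t *: (row i (Ad h) - row i M) =
  - (a (X i t ^ h)%g - t *: row i (Ad h)) + (a (X i t ^ h)%g - a (X i t) *m M)
  + (a (X i t) - t *: 'e_i) *m M.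
  rewrite mulmxBl -scalemxAl -rowE; apply/rowP => j; rewrite !mxE; ring.
have g2 : cM * N (X i t) ^+ 2 <= cM * (cX + 1) ^+ 2 * t ^+ 2.
  by rewrite -mulrA ler_wpM2l ?(ltW cM0) // -exprMn ler_sqr ?nnegrE ?mulr_ge0 ?(ltW cX1) ?(ltW t0).
have g3 : `|(a (X i t) - t *: 'e_i) *m M| <= k * `|kX| * t ^+ 2.
  apply: le_trans (Hk _) _; rewrite -mulrA ler_wpM2l //; apply: le_trans h3 _.
  by rewrite ler_wpM2r ?sqr_ge0 // ler_norm.
apply: le_trans (ler_normD _ _) _; rewrite mulrDl lerD //.
apply: le_trans (ler_normD _ _) _; rewrite mulrDl lerD // ?normrN //.
exact: le_trans h2 g2.
Qed.

Lemma AdM h k : Ad (h * k)%g = Ad h *m Ad k.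
Proof.
apply: Ad_unique.
have [c1 [s1 [c10 s10 H1]]] := HAd h; have [c2 [s2 [c20 s20 H2]]] := HAd k.
have [c3 [s3 [c30 s30 H3]]] := conj_lipschitz hG HN Ha h.
have [c4 c40 H4] := mulmx_bounded (Ad k).
have q1 : 0 < c2 * c3 ^+ 2 by rewrite mulr_gt0 // exprn_gt0.
exists (c2 * c3 ^+ 2 + c4 * c1), (Num.min s1 (Num.min s3 (s2 / c3))); split.
- by rewrite ltr_pwDl // mulr_ge0 // ltW.
- by rewrite !lt_min s10 s30 divr_gt0.
move=> g; rewrite !lt_min => /and3P[g1 g2]; rewrite ltr_pdivlMr // => g3.
have Ng := N0 g; have b1 := H3 g g2.
rewrite conjgM mulmxA.
have -> : a ((g ^ h) ^ k)%g - a g *m Ad h *m Ad k =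
  (a ((g ^ h) ^ k)%g - a (g ^ h)%g *m Ad k) + (a (g ^ h)%g - a g *m Ad h) *m Ad k.
  by rewrite mulmxBl addrA subrK.
apply: le_trans (ler_normD _ _) _; rewrite mulrDl lerD //.
  apply: le_trans (H2 _ _) _; first by apply: le_lt_trans b1 _; rewrite mulrC.
  rewrite -mulrA ler_wpM2l ?(ltW c20) // -exprMn ler_sqr ?nnegrE ?mulr_ge0 ?(ltW c30) //.
by apply: le_trans (H4 _) _; rewrite -mulrA ler_wpM2l // H1.
Qed.

(** Dividing the estimate of [conj_almost] for [X i t] by [t] controls the row of index [i]. *)
Lemma Ad_near1 : exists k s, [/\ 0 < k, 0 < s &
  forall h, N h < s -> forall i j, `|(Ad h - 1%:M) i j| <= k * N h].
Proof.
have [c [s [c0 s0 Hc]]] := conj_almost HN Ha.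
have [Kx HK] : exists Kx, forall i t, N (X i t) <= Kx * `|t|.
  have ex (i : 'I_n) : exists c, forall t, N (X i t) <= c * `|t|.
    by have [[_ [cX _ bX]] _] := HX i; exists cX.
  have [f Hf] := choice ex; exists (\sum_i `|f i|) => i t.
  apply: le_trans (Hf i t) _; rewrite ler_wpM2r //; apply: le_trans (ler_norm _) _.
  by rewrite (bigD1 i) //= lerDl sumr_ge0.
pose K := `|Kx| + 1; have K0 : 0 < K by rewrite ltr_wpDl.
have {}HK i t : N (X i t) <= K * `|t|.
  apply: le_trans (HK i t) _; rewrite ler_wpM2r //; apply: le_trans (ler_norm _) _.
  by rewrite lerDl.
exists (c * K), s; split=> //; first by rewrite mulr_gt0.
move=> h hs; apply: coord_linear_bound => i; rewrite linearB /= row1.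
have [c1 [s1 [c10 s10 H1]]] := Ad_tangent h i.
have [_ [kX [sX [sX0 tX]]]] := HX i.
apply: (@small_linear_bound R n _ _ (c1 + `|kX|) (Num.min s1 (Num.min sX (s / K)))).
  by rewrite !lt_min s10 sX0 divr_gt0.
move=> t t0; rewrite !lt_min => /and3P[t1 t2]; rewrite ltr_pdivlMr // => t3.
have tn : `|t| = t by rewrite gtr0_norm.
have h1 := H1 t; rewrite tn in h1; have {}h1 := h1 t1.
have h3 := tX t; rewrite tn in h3; have {}h3 := h3 t2.
have b1 : N (X i t) <= K * t by rewrite -{2}tn.
have Xs : N (X i t) < s by apply: le_lt_trans b1 _; rewrite mulrC.
have [h2 _] := Hc h (X i t) hs Xs.
have -> : t *: (row i (Ad h) - 'e_i) =
  - (a (X i t ^ h)%g - t *: row i (Ad h)) + (a (X i t ^ h)%g - a (X i t))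
  + (a (X i t) - t *: 'e_i).
  by apply/rowP => j; rewrite !mxE; ring.
have g2 : c * (N h * N (X i t)) <= c * K * N h * t.
  have -> : c * K * N h * t = c * (N h * (K * t)) by ring.
  by rewrite ler_wpM2l ?(ltW c0) // ler_wpM2l.
have g3 : kX * t ^+ 2 <= `|kX| * t ^+ 2 by rewrite ler_wpM2r ?sqr_ge0 // ler_norm.
apply: le_trans (ler_normD _ _) _; have := ler_normD (- (a (X i t ^ h)%g - t *: row i (Ad h))) (a (X i t ^ h)%g - a (X i t)).
rewrite normrN; lra.
Qed.

(** The defect of additivity of [Ad (X i t) - 1] is the product
    [(Ad (X i t) - 1) *m (Ad (X i u) - 1)], of order [|t| * |u|], so [almost_additive_lin] applies
    to each coefficient. *)
Lemma AdX_diff0 i p q : exists b k s, [/\ 0 <= k, 0 < s &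
  forall t, `|t| < s -> `|Ad (X i t) p q - (p == q)%:R - t * b| <= k * t ^+ 2].
Proof.
have [k [s [k0 s0 H]]] := Ad_near1.
have [[XD [cX cX0 bX]] _] := HX i.
have cX1 : 0 < cX + 1 by rewrite ltr_wpDl.
pose d := s / (cX + 1); have d0 : 0 < d by rewrite divr_gt0.
pose f p q t := (Ad (X i t) - 1%:M) p q.
pose q1 := k * (cX + 1); have q10 : 0 <= q1 by rewrite mulr_ge0 // ltW.
have fb p' q' t : `|t| < d -> `|f p' q' t| <= q1 * `|t|.
  rewrite ltr_pdivlMr // => td.
  have b1 : N (X i t) <= (cX + 1) * `|t|.
    by apply: le_trans (bX t) _; rewrite ler_wpM2r // lerDl.
  apply: le_trans (H _ _ p' q') _; first by apply: le_lt_trans b1 _; rewrite mulrC.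
  by rewrite /q1 -mulrA ler_wpM2l // ltW.
pose K := n%:R * q1 ^+ 2 + q1.
have K0 : 0 <= K by rewrite addr_ge0 // mulr_ge0 // sqr_ge0.
have fD t u : `|t| < d -> `|u| < d -> `|f p q (t + u) - f p q t - f p q u| <= K * (`|t| * `|u|).
  move=> td ud; have -> : f p q (t + u) - f p q t - f p q u =
      ((Ad (X i t) - 1%:M) *m (Ad (X i u) - 1%:M)) p q.
    rewrite /f XD AdM mulmxBl !mulmxBr mulmx1 !mul1mx !mxE; ring.
  rewrite mxE; apply: le_trans (ler_norm_sum _ _ _) _.
  apply: (@le_trans _ _ (\sum_(j < n) q1 ^+ 2 * (`|t| * `|u|))).
    apply: ler_sum => j _; rewrite normrM.
    have -> : q1 ^+ 2 * (`|t| * `|u|) = (q1 * `|t|) * (q1 * `|u|) by ring.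
    by apply: ler_pM => //; exact: fb.
  rewrite sumr_const card_ord -mulr_natl mulrA ler_wpM2r ?mulr_ge0 //.
  by rewrite lerDl.
have fb' t : `|t| < d -> `|f p q t| <= K * `|t|.
  move=> td; apply: le_trans (fb p q t td) _; rewrite ler_wpM2r // lerDr.
  by rewrite mulr_ge0 // sqr_ge0.
have [b Hb] := almost_additive_lin d0 K0 fD fb'.
exists b, (2 * K), d; split=> //; first by rewrite mulr_ge0.
by move=> t td; have := Hb t td; rewrite /f !mxE.
Qed.

(** [Ad (X i (t + u))] factors as [Ad (X i t) *m Ad (X i u)], which carries the expansion at 0 to
    every [t] with the same [D]. *)
Lemma AdX_diff i : exists D : 'M[R]_n, forall t p q, exists k s, [/\ 0 <= k, 0 < s &
  forall u, `|u| < s -> `|Ad (X i (t + u)) p q - Ad (X i t) p q - u * (Ad (X i t) *m D) p q|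
    <= k * u ^+ 2].
Proof.
have ex (pq : 'I_n * 'I_n) := AdX_diff0 i pq.1 pq.2.
have [b Hb] := choice ex.
exists (\matrix_(p, q) b (p, q)) => t p q.
have [k Hk] := choice (fun j : 'I_n => Hb (j, q)).
have [s Hs] := choice Hk.
have [[XD _] _] := HX i.
have [s' s'0 Hs'] : exists2 s', 0 < s' & forall j, s' <= s j.
  exists (\big[Num.min/1]_j s j); first by apply: lt_bigmin => // j _; case: (Hs j).
  by move=> j; apply: bigmin_le_cond.
exists (\sum_j `|Ad (X i t) p j| * k j), s'; split=> //.
  by rewrite sumr_ge0 // => j _; have [k0 _ _] := Hs j; rewrite mulr_ge0.
move=> u us.
have -> : Ad (X i (t + u)) p q - Ad (X i t) p q - u * (Ad (X i t) *m (\matrix_(p, q) b (p, q))) p q =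
  \sum_j Ad (X i t) p j * (Ad (X i u) j q - (j == q)%:R - u * b (j, q)).
  rewrite XD AdM -{2}[Ad (X i t)]mulmx1 !mxE mulr_sumr -!sumrB; apply: eq_bigr => j _.
  by rewrite !mxE; ring.
apply: le_trans (ler_norm_sum _ _ _) _; rewrite mulr_suml ler_sum // => j _.
rewrite normrM -mulrA ler_wpM2l //; have [_ _] := Hs j; apply.
exact: lt_le_trans us (Hs' j).
Qed.

Variable m : nat.

(** The differential of a word after left translation to 1: a variable letter contributes its linear
    form times the tangent of [X i] conjugated by the tail. A constant has no increment and enters
    only through the tails. *)
Fixpoint Dw (w : seq (letter R G n m)) (z : 'rV[R]_m) : 'M[R]_(m, n) :=
  match w with
  | [::] => 0
  | inl _ :: w' => Dw w' z
  | inr (i, c) :: w' => c *m row i (Ad (weval X z w')) + Dw w' z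
  end.

Lemma word_diff (w : seq (letter R G n m)) z : exists c s, [/\ 0 < c, 0 < s & forall v, `|v| < s ->
  [/\ N ((weval X z w)^-1 * weval X (z + v) w)%g <= c * `|v|,
      N ((weval X z w)^-1 * weval X (z + v) w)%g < r &
      `|a ((weval X z w)^-1 * weval X (z + v) w)%g - v *m Dw w z| <= c * `|v| ^+ 2]].
Proof.
elim: w => [|[h|[i l]] w [c [s [c0 s0 IH]]]].
- exists 1, 1; split=> // v _.
  by rewrite /= mulVg (gn1 HN) (ah1 HN Ha) mulmx0 subrr normr0 !mul1r sqr_ge0.
- exists c, s; split=> // v vs; rewrite weval_cons_diff mulVg conj1g mul1g.
  exact: IH.
set p := weval X z w.
have [[XD [cX cX0 bX]] _] := HX i.
have [k k0 Hk] := lin_bounded l.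
have [cA [sA [cA0 sA0 HA]]] := Ad_tangent p i.
have [ch [sh [ch0 sh0 Hh]]] := conj_lipschitz hG HN Ha p.
pose q := ch * (cX * k).
have q0 : 0 <= q by rewrite !mulr_ge0 // ltW.
have ck0 : 0 <= cA * k ^+ 2 by rewrite mulr_ge0 ?sqr_ge0 // ltW.
have Cqc : 0 <= C * (q * c) by rewrite !mulr_ge0 // ltW.
have cXk : 0 <= cX * k by rewrite mulr_ge0.
pose c' := C * (q * c) + cA * k ^+ 2 + c + q + cX * k + k + 1.
have c'0 : 0 < c' by rewrite /c'; lra.
have [l1 l2 l3 l4] : [/\ k <= c', cX * k <= c', q <= c' & q + c <= c'] by rewrite /c'; split; lra.
have l5 : C * (q * c) + cA * k ^+ 2 + c <= c' by rewrite /c'; lra.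
exists c', (Num.min s (Num.min (sA / c') (Num.min (r / c') (sh / c')))); split=> //.
  by rewrite !lt_min s0 !divr_gt0.
move=> v; rewrite !lt_min => /and4P[v1]; rewrite !ltr_pdivlMr // => v2 v3 v4.
have [h1 h2 h3] := IH v v1.
have small u : u <= c' -> u * `|v| <= `|v| * c' by move=> uc; rewrite mulrC ler_wpM2l.
have N1 : N (X i (lin l v)) <= cX * k * `|v|.
  by apply: le_trans (bX _) _; rewrite -mulrA ler_wpM2l.
have N2 : N (X i (lin l v) ^ p)%g <= q * `|v|.
  apply: le_trans (Hh _ _) _; last by rewrite /q -mulrA ler_wpM2l // ltW.
  by apply: le_lt_trans N1 _; apply: le_lt_trans v4; exact: small.
have r1 : N (X i (lin l v) ^ p)%g < r.
  by apply: le_lt_trans N2 _; apply: le_lt_trans v3; exact: small.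
have g3 : `|a (X i (lin l v) ^ p)%g - lin l v *: row i (Ad p)| <= cA * k ^+ 2 * `|v| ^+ 2.
  apply: le_trans (HA _ _) _.
    by apply: le_lt_trans (Hk v) _; apply: le_lt_trans v2; exact: small.
  rewrite -mulrA ler_wpM2l ?(ltW cA0) // -exprMn -[lin l v ^+ 2]real_normK ?num_real //.
  by rewrite ler_sqr ?nnegrE ?mulr_ge0.
rewrite weval_cons_diff (leval_diff HX) -/p.
have N3 : N (X i (lin l v) ^ p * (p^-1 * weval X (z + v) w))%g <= (q + c) * `|v|.
  by rewrite mulrDl; apply: le_trans (NM _ _) _; exact: lerD.
split.
- by apply: le_trans N3 _; rewrite ler_wpM2r.
- by apply: le_lt_trans N3 _; apply: le_lt_trans v3; exact: small.
have -> : v *m Dw (inr (i, l) :: w) z = lin l v *: row i (Ad p) + v *m Dw w z.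
  rewrite /= mulmxDr mulmxA -/p; congr (_ + _).
  by rewrite {1}[v *m l]mx11_scalar mul_scalar_mx.
apply: le_trans (ah_mul_approx HN Ha r1 h2 g3 h3 N2 h1) _.
by rewrite -!mulrDl ler_wpM2r ?sqr_ge0.
Qed.

End AdjointHom.

(** * Smoothness of maps given by words *)

Lemma nbhs_rV_norm (R : realType) m (D : set 'rV[R]_m) (z : 'rV[R]_m) : nbhs z D ->
  exists2 s, 0 < s & forall v, `|v| < s -> D (z + v).
Proof.
move=> /nbhs_ballP[s s0 Hs]; exists s => // v vs; apply: Hs.
by rewrite -ball_normE /= opprD addNKr normrN.
Qed.

Lemma nbhs_rV_normV (R : realType) m (D : set 'rV[R]_m) (z : 'rV[R]_m) s : 0 < s ->
  (forall v, `|v| < s -> D (z + v)) -> nbhs z D.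
Proof.
move=> s0 H; apply/nbhs_ballP; exists s => //= y; rewrite -ball_normE /= => yz.
by rewrite -[y](subrK z) addrC; apply: H; rewrite distrC.
Qed.

Lemma lin_col (R : realType) m n (M : 'M[R]_(m, n)) j v : lin (col j M) v = (v *m M) 0 j.
Proof. by rewrite /lin !mxE; apply: eq_bigr => i _; rewrite mxE. Qed.

Section QuadraticRemainder.
Variables (R : realType) (m : nat).
Implicit Types (h : 'rV[R]_m -> R) (z v : 'rV[R]_m) (l : 'cV[R]_m).

(** Stronger than differentiability at [z], with constants that may depend on [z]; this is the form
    in which [word_diff] and [AdX_diff] deliver their estimates. *)
Definition qd h z l := exists K s, [/\ 0 <= K, 0 < s &
  forall v, `|v| < s -> `|h (z + v) - h z - lin l v| <= K * `|v| ^+ 2].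

Lemma lin_lin l1 l2 (a b : R) v : lin (a *: l1 + b *: l2) v = a * lin l1 v + b * lin l2 v.
Proof. by rewrite /lin mulmxDr -!scalemxAr !mxE. Qed.

Lemma qd_const c z : qd (fun=> c) z 0.
Proof.
exists 0, 1; split=> // v _.
by rewrite subrr /lin mulmx0 mxE subr0 normr0 mul0r.
Qed.

Lemma qdD h1 h2 z l1 l2 : qd h1 z l1 -> qd h2 z l2 -> qd (fun z => h1 z + h2 z) z (l1 + l2).
Proof.
move=> [K1 [s1 [K10 s10 H1]]] [K2 [s2 [K20 s20 H2]]].
exists (K1 + K2), (Num.min s1 s2); split; rewrite ?addr_ge0 ?lt_min ?s10 //.
move=> v; rewrite lt_min => /andP[v1 v2].
have -> : h1 (z + v) + h2 (z + v) - (h1 z + h2 z) - lin (l1 + l2) v =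
  (h1 (z + v) - h1 z - lin l1 v) + (h2 (z + v) - h2 z - lin l2 v).
  by rewrite -[l1]scale1r -[l2]scale1r lin_lin; rewrite !scale1r; ring.
by apply: le_trans (ler_normD _ _) _; rewrite [leRHS]mulrDl lerD ?H1 ?H2.
Qed.

Lemma qd_lipschitz h z l : qd h z l -> exists k s, [/\ 0 <= k, 0 < s &
  forall v, `|v| < s -> `|h (z + v) - h z| <= k * `|v|].
Proof.
move=> [K [s [K0 s0 H]]]; have [k k0 Hk] := lin_bounded l.
exists (K * s + k), s; split=> //; first by rewrite addr_ge0 // mulr_ge0 // ltW.
move=> v vs; rewrite -[h (z + v) - h z](subrK (lin l v)).
apply: le_trans (ler_normD _ _) _; rewrite [leRHS]mulrDl lerD //.
apply: le_trans (H v vs) _; rewrite expr2 mulrA ler_wpM2r // ler_wpM2l // ltW //.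
Qed.

(* [phi] is only required to have a quadratic remainder at the point [h z]. *)
Lemma qd_comp (phi : R -> R) h z l (b k s : R) : qd h z l -> 0 <= k -> 0 < s ->
  (forall u, `|u| < s -> `|phi (h z + u) - phi (h z) - u * b| <= k * u ^+ 2) ->
  qd (fun z => phi (h z)) z (b *: l).
Proof.
move=> qh k0 s0 Hp; have [K [s1 [K0 s10 H]]] := qh.
have [q [s2 [q0 s20 Hq]]] := qd_lipschitz qh.
have q1 : 0 < q + 1 by rewrite ltr_wpDl.
exists (k * q ^+ 2 + `|b| * K), (Num.min s1 (Num.min s2 (s / (q + 1)))); split.
- by rewrite addr_ge0 ?mulr_ge0 // sqr_ge0.
- by rewrite !lt_min s10 s20 divr_gt0.
move=> v; rewrite !lt_min => /and3P[v1 v2]; rewrite ltr_pdivlMr // => v3.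
have h1 := H v v1; have h2 := Hq v v2.
pose u := h (z + v) - h z.
have us : `|u| < s.
  apply: le_lt_trans h2 _; apply: le_lt_trans v3; rewrite mulrC ler_wpM2l // lerDl //.
have h3 := Hp u us.
have e : h z + u = h (z + v) by rewrite /u addrC subrK.
rewrite e in h3.
have -> : phi (h (z + v)) - phi (h z) - lin (b *: l) v =
  (phi (h (z + v)) - phi (h z) - u * b) + b * (u - lin l v).
  have -> : lin (b *: l) v = b * lin l v by rewrite /lin -scalemxAr mxE.
  by ring.
apply: le_trans (ler_normD _ _) _; rewrite [leRHS]mulrDl lerD //.
  apply: le_trans h3 _; rewrite -mulrA ler_wpM2l //.
  by rewrite -[u ^+ 2]real_normK ?num_real // -exprMn ler_sqr ?nnegrE ?mulr_ge0.
by rewrite normrM -mulrA ler_wpM2l.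
Qed.

Lemma qdM h1 h2 z l1 l2 : qd h1 z l1 -> qd h2 z l2 ->
  qd (fun z => h1 z * h2 z) z (h2 z *: l1 + h1 z *: l2).
Proof.
move=> q1 q2; have [K1 [s1 [K10 s10 H1]]] := q1; have [K2 [s2 [K20 s20 H2]]] := q2.
have [k1 [t1 [k10 t10 L1]]] := qd_lipschitz q1.
have [k2 [t2 [k20 t20 L2]]] := qd_lipschitz q2.
exists (`|h2 z| * K1 + `|h1 z| * K2 + k1 * k2), (Num.min (Num.min s1 s2) (Num.min t1 t2)); split.
- by rewrite !addr_ge0 ?mulr_ge0.
- by rewrite !lt_min s10 s20 t10 t20.
move=> v; rewrite !lt_min => /andP[/andP[v1 v2] /andP[v3 v4]].
have a1 := H1 v v1; have a2 := H2 v v2; have b1 := L1 v v3; have b2 := L2 v v4.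
have -> : h1 (z + v) * h2 (z + v) - h1 z * h2 z - lin (h2 z *: l1 + h1 z *: l2) v =
  h2 z * (h1 (z + v) - h1 z - lin l1 v) + h1 z * (h2 (z + v) - h2 z - lin l2 v)
  + (h1 (z + v) - h1 z) * (h2 (z + v) - h2 z) by rewrite lin_lin; ring.
apply: le_trans (ler_normD _ _) _; rewrite [leRHS]mulrDl lerD //; last first.
  rewrite normrM; have -> : k1 * k2 * `|v| ^+ 2 = (k1 * `|v|) * (k2 * `|v|) by ring.
  exact: ler_pM.
apply: le_trans (ler_normD _ _) _; rewrite [leRHS]mulrDl lerD //.
  by rewrite normrM -mulrA ler_wpM2l.
by rewrite normrM -mulrA ler_wpM2l.
Qed.

Lemma qdV h z l : qd h z l -> h z != 0 -> qd (fun z => (h z)^-1) z (- (h z)^-1 ^+ 2 *: l).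
Proof.
move=> qh hz; pose x := h z; have x0 : 0 < `|x| by rewrite normr_gt0.
apply: (qd_comp (phi := GRing.inv) (k := 2 / `|x| ^+ 3) (s := `|x| / 2) qh).
- by rewrite divr_ge0 // exprn_ge0.
- by rewrite divr_gt0.
move=> u us; rewrite -/x.
have xu : `|x| / 2 <= `|x + u|.
  have := ler_normB (x + u) u; rewrite addrK; lra.
have xu0 : x + u != 0 by rewrite -normr_gt0; apply: lt_le_trans xu; rewrite divr_gt0.
have -> : (x + u)^-1 - x^-1 - u * - x^-1 ^+ 2 = u ^+ 2 / (x ^+ 2 * (x + u)).
  by field; rewrite hz xu0.
rewrite normrM normrX normfV normrM normrX real_normK ?num_real // [leRHS]mulrC.
rewrite ler_wpM2l ?sqr_ge0 //.
have x3 : 0 < `|x| ^+ 3 by rewrite exprn_gt0.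
have -> : 2 / `|x| ^+ 3 = (`|x| ^+ 2 * (`|x| / 2))^-1.
  by field; rewrite gt_eqF // normr_gt0.
have x2 : 0 < `|x| ^+ 2 by rewrite exprn_gt0.
rewrite lef_pV2 ?posrE ?mulr_gt0 ?divr_gt0 ?normr_gt0 //.
by rewrite ler_wpM2l // ltW.
Qed.

Lemma qd_lin c z : qd (lin c) z c.
Proof.
exists 0, 1; split=> // v _; rewrite linD.
have -> : lin c z + lin c v - lin c z - lin c v = 0 by ring.
by rewrite normr0 mul0r.
Qed.

Lemma qd_cvg h z l v : qd h z l ->
  (fun t : R => t^-1 *: (h (t *: v + z) - h z)) @ 0^' --> lin l v.
Proof.
move=> [K [s [K0 s0 H]]]; apply/cvgrPdist_le => e e0.
have v1 : 0 < `|v| + 1 by rewrite ltr_wpDl.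
have k1 : 0 < K * `|v| ^+ 2 + 1 by rewrite ltr_wpDl // mulr_ge0 // sqr_ge0.
have d0 : 0 < Num.min (s / (`|v| + 1)) (e / (K * `|v| ^+ 2 + 1)) by rewrite lt_min !divr_gt0.
apply: filterS2 (dnbhs0_lt d0) (nbhs_dnbhs_neq 0) => t.
rewrite lt_min => /andP[]; rewrite !ltr_pdivlMr // => t1 t2 t0.
have tv : `|t *: v| < s.
  by rewrite normrZ; apply: le_lt_trans t1; rewrite ler_wpM2l // lerDl.
have := H _ tv; have -> : lin l (t *: v) = t * lin l v by rewrite /lin -scalemxAl mxE.
rewrite [z + _]addrC normrZ exprMn => h1.
have -> : lin l v - t^-1 *: (h (t *: v + z) - h z) =
  - (t^-1 * (h (t *: v + z) - h z - t * lin l v)).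
  by rewrite /GRing.scale /=; field.
rewrite normrN normrM normfV ler_pdivrMl ?normr_gt0 //.
apply: le_trans h1 _.
have -> : K * (`|t| ^+ 2 * `|v| ^+ 2) = `|t| * (`|t| * (K * `|v| ^+ 2)) by ring.
rewrite ler_wpM2l //; apply: le_trans (ltW t2).
by rewrite ler_wpM2l // lerDl.
Qed.

Lemma qd_continuous h z l : qd h z l -> h @ z --> h z.
Proof.
move=> /qd_lipschitz[k [s [k0 s0 H]]]; apply: (iffRL (@cvgrPdist_le _ _ _ (nbhs z) (nbhs_filter z) h (h z))) => e e0.
have k1 : 0 < k + 1 by rewrite ltr_wpDl.
apply: (@nbhs_rV_normV R m _ z (Num.min s (e / (k + 1)))); first by rewrite lt_min s0 divr_gt0.
move=> v; rewrite lt_min ltr_pdivlMr // => /andP[v1 v2].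
rewrite /= distrC; apply: le_trans (H v v1) _; apply: le_trans (ltW v2).
by rewrite mulrC ler_wpM2l // lerDl.
Qed.

End QuadraticRemainder.

(** * Differential of a map given by a word in the chart *)

Section ChartDifferential.
Variables (R : realType) (G : topGroupType) (N : G -> R).
Hypotheses (hG : hausdorff_space G) (HN : group_norm N).
Let N0 := gn_ge0 HN.

Variables (n : nat) (a : G -> 'rV[R]_n) (C r : R) (X : 'I_n -> R -> G).
Hypotheses (Ha : almost_hom N a C r)
  (HX : forall i, one_param N (X i) /\ is_tangent a (X i) 'e_i).
Let C0 := ah_C Ha.

Variable Ad : G -> 'M[R]_n.
Hypothesis HAd : forall h, is_Ad N a h (Ad h).

Variables (c s : R).
Hypotheses (c0 : 0 < c)
  (E_low : forall t t', `|t| < s -> `|t'| < s -> `|t' - t| <= c * N ((E X t)^-1 * E X t')%g).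

Definition J (y : 'rV[R]_n) : 'M[R]_n := Dw X Ad (map inr (Eword R n)) y.

(** Along a kernel vector [v] the point [E (y + t *: v)] would stay within [O(t^2)] of [E y],
    against the lower Lipschitz bound. *)
Lemma J_unit y : `|y| < s -> J y \in unitmx.
Proof.
move=> ys; suff inj (v : 'rV[R]_n) : v *m J y = 0 -> v = 0.
  rewrite -row_free_unit -kermx_eq0; apply/eqP/row_matrixP => i; rewrite row0.
  by apply: inj; rewrite -row_mul mulmx_ker row0.
move=> vJ; have [k [s1 [k0 s10 H]]] := word_diff hG HN Ha HX HAd (map inr (Eword R n)) y.
apply/eqP; rewrite -normr_le0.
have v1 : 0 < `|v| + 1 by rewrite ltr_wpDl.
have d0 : 0 < s - `|y| by rewrite subr_gt0.
apply: (@small_linear_bound R n v 0 (c * (C * (k * `|v| ^+ 2)))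
  (Num.min (s1 / (`|v| + 1)) ((s - `|y|) / (`|v| + 1)))).
  by rewrite lt_min !divr_gt0.
move=> t t0; rewrite !lt_min => /andP[]; rewrite !ltr_pdivlMr // => t1 t2.
have tv : `|t *: v| <= t * (`|v| + 1).
  by rewrite normrZ gtr0_norm // ler_wpM2l ?lerDl // ltW.
have [h1 h2 h3] := H (t *: v) (le_lt_trans tv t1).
rewrite -scalemxAl vJ scaler0 subr0 in h3.
have ytv : `|y + t *: v| < s.
  apply: le_lt_trans (ler_normD _ _) _; move: (le_lt_trans tv t2); lra.
have := E_low ys ytv; rewrite addrC addKr => /le_trans; apply.
rewrite mul0r add0r -mulrA ler_wpM2l ?(ltW c0) //.
apply: le_trans (ah_ge Ha h2) _; rewrite -mulrA ler_wpM2l ?(ltW C0) //.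
apply: le_trans h3 _; rewrite normrZ gtr0_norm // exprMn.
by rewrite le_eqVlt; apply/orP; left; apply/eqP; ring.
Qed.

Variables (m : nat) (D : set 'rV[R]_m) (f : 'rV[R]_m -> 'rV[R]_n) (w : seq (letter R G n m)).
Hypotheses (oD : forall z, D z -> nbhs z D)
  (Hf : forall z, D z -> `|f z| < s /\ E X (f z) = weval X z w).

(** Both sides of [E X (f z) = weval X z w] are expanded. The increment [d] of [f] is [O(|v|)] by
    [E_low], so [d *m J (f z)] and [v *m Dw w z] agree up to [O(|v|^2)], and [J (f z)] can be
    inverted. *)
Lemma chart_map_qd z j : D z ->
  qd (fun z => f z 0 j) z (col j (Dw X Ad w z *m invmx (J (f z)))).
Proof.
move=> Dz; have [fz Ez] := Hf Dz.
have [kw [sw [kw0 sw0 Hw]]] := word_diff hG HN Ha HX HAd w z.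
have [kE [sE [kE0 sE0 HE]]] := word_diff hG HN Ha HX HAd (map inr (Eword R n)) (f z).
have [s1 s10 Hs1] := nbhs_rV_norm (oD Dz).
have uJ := J_unit fz; set Ji := invmx (J (f z)).
have [k k0 Hk] := mulmx_bounded Ji.
pose q := c * kw; have q0 : 0 < q by rewrite mulr_gt0.
exists (k * (kE * q ^+ 2 + kw)), (Num.min sw (Num.min s1 (sE / q))); split.
- by rewrite mulr_ge0 // addr_ge0 ?mulr_ge0 ?sqr_ge0 ?ltW.
- by rewrite !lt_min sw0 s10 divr_gt0.
move=> v; rewrite !lt_min => /and3P[v1 v2]; rewrite ltr_pdivlMr // => v3.
have [fzv Ezv] := Hf (Hs1 v v2).
have [h1 h2 h3] := Hw v v1.
pose d := f (z + v) - f z.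
have dq : `|d| <= q * `|v|.
  by apply: le_trans (E_low fz fzv) _; rewrite Ez Ezv /q -mulrA ler_wpM2l // ltW.
have dsE : `|d| < sE by apply: le_lt_trans dq _; rewrite mulrC.
have [_ _ h4] := HE d dsE.
rewrite -/(J (f z)) -/(E X (f z)) -/(E X (f z + d)) in h4.
have fd : f z + d = f (z + v) by rewrite /d addrC subrK.
rewrite fd Ez Ezv in h4.
have h5 : `|d *m J (f z) - v *m Dw X Ad w z| <= (kE * q ^+ 2 + kw) * `|v| ^+ 2.
  set ak := a _ in h3 h4.
  have -> : d *m J (f z) - v *m Dw X Ad w z = - (ak - d *m J (f z)) + (ak - v *m Dw X Ad w z).
    by rewrite opprB addrA subrK.
  apply: le_trans (ler_normD _ _) _; rewrite normrN [leRHS]mulrDl lerD //.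
  apply: le_trans h4 _; rewrite -mulrA ler_wpM2l ?(ltW kE0) // -exprMn.
  by rewrite ler_sqr ?nnegrE ?mulr_ge0 // ltW.
have e1 : d - v *m (Dw X Ad w z *m Ji) = (d *m J (f z) - v *m Dw X Ad w z) *m Ji.
  by rewrite mulmxBl mulmxK // mulmxA.
have -> : f (z + v) 0 j - f z 0 j - lin (col j (Dw X Ad w z *m Ji)) v =
  (d - v *m (Dw X Ad w z *m Ji)) 0 j.
  by rewrite lin_col [RHS]mxE [X in _ = _ + X]mxE /d [X in _ = X + _]mxE [X in _ = _ + X + _]mxE.
apply: le_trans (coord_le_rVnorm _ _) _; rewrite e1; apply: le_trans (Hk _) _.
by rewrite -mulrA ler_wpM2l.
Qed.

End ChartDifferential.

Lemma cvg_rV (R : realType) (T : Type) (F : set_system T) (FF : Filter F) n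
    (g : T -> 'rV[R]_n) (l : 'rV[R]_n) :
  (forall j, (fun t => g t 0 j) @ F --> l 0 j) -> g @ F --> l.
Proof.
move=> H; apply: (iffRL (@cvgrPdist_le _ _ _ F FF g l)) => e e0.
have h (j : 'I_n) : \forall t \near F, `|l 0 j - g t 0 j| <= e.
  exact: (iffLR (@cvgrPdist_le _ _ _ F FF (fun t => g t 0 j) (l 0 j)) (H j) e e0).
have h' := @filter_forall T 'I_n _ F FF h.
apply: filterS h' => t Ht.
by apply: rVnorm_le => [|j]; [exact: ltW | rewrite !mxE; exact: Ht].
Qed.

(** * Algebras of functions stable under differentiation *)

Section Subalgebra.
Variables (R : realType) (V : Type).
Implicit Types (P : (V -> R) -> Prop).

Definition subalgebra P := [/\ forall c : R, P (fun=> c),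
  forall h1 h2, P h1 -> P h2 -> P (fun z => h1 z + h2 z) &
  forall h1 h2, P h1 -> P h2 -> P (fun z => h1 z * h2 z)].

Variable P : (V -> R) -> Prop.
Hypothesis HP : subalgebra P.

Lemma subalg_sum (I : Type) (s : seq I) (Q : pred I) (h : I -> V -> R) :
  (forall i, P (h i)) -> P (fun z => \sum_(i <- s | Q i) h i z).
Proof.
move=> H; have [Pc PD PM] := HP; elim: s => [|i s IH].
  have -> : (fun z => \sum_(i <- [::] | Q i) h i z) = (fun=> 0); last exact: Pc.
  by apply/funext => z; rewrite big_nil.
have -> : (fun z => \sum_(i <- i :: s | Q i) h i z) =
  (fun z => (if Q i then h i z else 0) + \sum_(i <- s | Q i) h i z).
  by apply/funext => z; rewrite big_cons; case: ifP => // _; rewrite add0r.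
by apply: (PD (fun z => if Q i then h i z else 0)) => //; case: (Q i) => //; exact: Pc.
Qed.

Lemma subalg_prod (I : Type) (s : seq I) (Q : pred I) (h : I -> V -> R) :
  (forall i, P (h i)) -> P (fun z => \prod_(i <- s | Q i) h i z).
Proof.
move=> H; have [Pc PD PM] := HP; elim: s => [|i s IH].
  have -> : (fun z => \prod_(i <- [::] | Q i) h i z) = (fun=> 1); last exact: Pc.
  by apply/funext => z; rewrite big_nil.
have -> : (fun z => \prod_(i <- i :: s | Q i) h i z) =
  (fun z => (if Q i then h i z else 1) * \prod_(i <- s | Q i) h i z).
  by apply/funext => z; rewrite big_cons; case: ifP => // _; rewrite mul1r.
by apply: (PM (fun z => if Q i then h i z else 1)) => //; case: (Q i) => //; exact: Pc.
Qed.

Definition subalg_mx p q (M : V -> 'M[R]_(p, q)) := forall i j, P (fun z => M z i j).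

Lemma subalg_mx_const p q (M : 'M[R]_(p, q)) : subalg_mx (fun=> M).
Proof. by case: HP => Pc _ _ i j; exact: Pc. Qed.

Lemma subalg_mxD p q (M M' : V -> 'M[R]_(p, q)) :
  subalg_mx M -> subalg_mx M' -> subalg_mx (fun z => M z + M' z).
Proof.
case: HP => _ PD _ H H' i j.
under eq_fun do rewrite mxE.
exact: (PD (fun z => M z i j)).
Qed.

Lemma subalg_mulmx p q k (M : V -> 'M[R]_(p, q)) (M' : V -> 'M[R]_(q, k)) :
  subalg_mx M -> subalg_mx M' -> subalg_mx (fun z => M z *m M' z).
Proof.
case: HP => _ _ PM H H' i j.
under eq_fun do rewrite mxE.
by apply: subalg_sum => l; exact: (PM (fun z => M z i l)).
Qed.

Lemma subalg_mxZ p q (g : V -> R) (M : V -> 'M[R]_(p, q)) :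
  P g -> subalg_mx M -> subalg_mx (fun z => g z *: M z).
Proof.
case: HP => _ _ PM H H' i j.
under eq_fun do rewrite mxE.
exact: (PM g).
Qed.

Lemma subalg_det p (M : V -> 'M[R]_p) : subalg_mx M -> P (fun z => \det (M z)).
Proof.
case: HP => Pc _ PM H; rewrite /determinant.
apply: subalg_sum => s; apply: (PM (fun=> _)); first exact: Pc.
by apply: subalg_prod => i; exact: H.
Qed.

Lemma subalg_adj p (M : V -> 'M[R]_p) : subalg_mx M -> subalg_mx (fun z => \adj (M z)).
Proof.
case: HP => Pc _ PM H i j.
under eq_fun do rewrite mxE /cofactor.
apply: (PM (fun=> _)); first exact: Pc.
apply: subalg_det => a b.
under eq_fun do rewrite !mxE.
exact: H.
Qed.

End Subalgebra.

Section StableStep.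
Variables (R : realType) (m : nat) (D : set 'rV[R]_m) (P : ('rV[R]_m -> R) -> Prop).

(** Members of [P] are functions on the whole space; only their expansions are confined to [D]. *)
Definition stable_on := forall h, P h -> exists dh : 'I_m -> 'rV[R]_m -> R,
  (forall i, P (dh i)) /\ forall z, D z -> qd h z (\col_i dh i z).

Hypotheses (oD : open D) (HP : subalgebra P) (Pd : stable_on).

Lemma stable_derive k (F : 'rV[R]_m -> 'rV[R]_k) (hs : 'I_k -> 'rV[R]_m -> R) :
    (forall j, P (hs j)) -> (forall z, D z -> F z = \row_j hs j z) ->
  [/\ forall z v, D z -> derivable F z v,
      forall z, D z -> F @ z --> F z &
      forall v, exists hs', (forall j, P (hs' j)) /\
        forall z, D z -> 'D_v F z = \row_j hs' j z].
Proof.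
move=> Phs HF.
have [dh Hdh] := choice (fun j => Pd (Phs j)).
have nr z : D z -> \forall z' \near z, D z' by move=> Dz; exact: open_nbhs_nbhs.
have cv z v : D z -> (fun t : R => t^-1 *: (F (t *: v + z) - F z)) @ 0^' -->
    \row_j lin (\col_i dh j i z) v.
  move=> Dz; apply: cvg_rV => j; rewrite mxE.
  have [_ /(_ z Dz) H] := Hdh j.
  pose proof (@qd_cvg R m _ _ _ v H) as H1.
  apply: cvg_trans H1; apply: near_eq_cvg.
  have [s s0 Hs] := nbhs_rV_norm (nr z Dz).
  have v1 : 0 < `|v| + 1 by rewrite ltr_wpDl.
  apply: filterS (dnbhs0_lt (divr_gt0 s0 v1)) => t; rewrite ltr_pdivlMr // => tv.
  have Dt : D (t *: v + z).
    rewrite addrC; apply: Hs; rewrite normrZ; apply: le_lt_trans tv.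
    by rewrite ler_wpM2l // lerDl.
  by rewrite !mxE !HF // !mxE.
split.
- by move=> z v Dz; apply/cvg_ex; exists (\row_j lin (\col_i dh j i z) v); exact: cv.
- move=> z Dz; apply: (@cvg_rV R _ _ (nbhs_filter z)) => j; rewrite HF // mxE.
  have [_ /(_ z Dz) H] := Hdh j.
  pose proof (qd_continuous H) as H1.
  apply: cvg_trans H1; apply: near_eq_cvg.
  apply: (@filterS _ _ (nbhs_filter z) _ _ _ (nr z Dz)) => z' Dz'.
  by rewrite HF // mxE.
move=> v; exists (fun j z => lin (\col_i dh j i z) v); split.
  move=> j; rewrite /lin.
  under eq_fun do rewrite mxE.
  apply: (subalg_sum HP) => i; case: (HP) => Pc _ PM.
  apply: (PM (fun=> _)); first exact: Pc.
  under eq_fun do rewrite mxE.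
  by case: (Hdh j).
move=> z Dz; apply: cvg_lim => //.
exact: cv.
Qed.

End StableStep.

Lemma stable_smooth (m : nat) (D : set 'rV[RR]_m) (P : ('rV[RR]_m -> RR) -> Prop)
    k (f : 'rV[RR]_m -> 'rV[RR]_k) :
  open D -> subalgebra P -> stable_on D P ->
  (forall j, P (fun z => f z 0 j)) -> smooth_on D f.
Proof.
move=> oD HP Pd Pf.
have all vs : exists hs : 'I_k -> 'rV[RR]_m -> RR, (forall j, P (hs j)) /\
    forall z, D z -> iderive f vs z = \row_j hs j z.
  elim: vs => [|v vs [hs [Phs HF]]].
    exists (fun j z => f z 0 j); split=> // z _.
    by apply/rowP => j; rewrite mxE.
  by have [_ _ /(_ v)] := stable_derive oD HP Pd Phs HF.
split=> //.
- move=> vs v x Dx; have [hs [Phs HF]] := all vs.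
  by have [H _ _] := stable_derive oD HP Pd Phs HF; exact: H.
- move=> vs; have [hs [Phs HF]] := all vs.
  have [_ H _] := stable_derive oD HP Pd Phs HF.
  by apply: continuous_in_subspaceT => z /set_mem Dz; exact: H.
Qed.

(** * The algebra generated by adjoint coefficients and the inverse Jacobian *)

Section ChartAlgebra.
Variables (R : realType) (G : topGroupType) (N : G -> R).
Hypotheses (hG : hausdorff_space G) (HN : group_norm N).

Variables (n : nat) (a : G -> 'rV[R]_n) (C r : R) (X : 'I_n -> R -> G).
Hypotheses (Ha : almost_hom N a C r)
  (HX : forall i, one_param N (X i) /\ is_tangent a (X i) 'e_i).

Variable Ad : G -> 'M[R]_n.
Hypothesis HAd : forall h, is_Ad N a h (Ad h).

(** [u] is general because it is the identity for the word and [f] for the Jacobian; [P] is general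
    because it is first the algebra itself, then the predicate [has_d]. *)
Lemma Dw_subalg (V : Type) k (u : V -> 'rV[R]_k) (P : (V -> R) -> Prop) :
  subalgebra P -> (forall i l p q, P (fun z => Ad (X i (lin l (u z))) p q)) ->
  forall w : seq (letter R G n k), subalg_mx P (fun z => Ad (weval X (u z) w)) /\
    subalg_mx P (fun z => Dw X Ad w (u z)).
Proof.
move=> HP Pg; elim=> [|[h|[i l]] w [IH1 IH2]].
- by split=> /=; exact: (subalg_mx_const HP).
- split=> //.
  have -> : (fun z => Ad (weval X (u z) (inl h :: w))) =
    (fun z => Ad h *m Ad (weval X (u z) w)).
    by apply/funext => z; rewrite -(AdM hG HN Ha HX HAd).
  by apply: (subalg_mulmx HP (M := fun=> Ad h)) => //; exact: (subalg_mx_const HP).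
have IH3 : subalg_mx P (fun z => row i (Ad (weval X (u z) w))).
  by move=> p q; have := IH1 i q; congr P; apply/funext => z; rewrite mxE.
split.
  have -> : (fun z => Ad (weval X (u z) (inr (i, l) :: w))) =
    (fun z => Ad (X i (lin l (u z))) *m Ad (weval X (u z) w)).
    by apply/funext => z; rewrite -(AdM hG HN Ha HX HAd).
  exact: (subalg_mulmx HP (Pg i l) IH1).
apply: (subalg_mxD HP) => //.
by apply: (subalg_mulmx HP (M := fun=> l)) => //; exact: (subalg_mx_const HP).
Qed.

Variables (c s : R).
Hypotheses (c0 : 0 < c)
  (E_low : forall t t', `|t| < s -> `|t'| < s -> `|t' - t| <= c * N ((E X t)^-1 * E X t')%g).

Variables (m : nat) (D : set 'rV[R]_m) (f : 'rV[R]_m -> 'rV[R]_n) (w : seq (letter R G n m)).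
Hypotheses (oD : forall z, D z -> nbhs z D)
  (Hf : forall z, D z -> `|f z| < s /\ E X (f z) = weval X z w).

(* Closed under differentiation: by [chart_map_qd] the differential of [f] is a
   polynomial in the adjoint coefficients and the inverse Jacobian of the chart. *)
Inductive chart_alg : ('rV[R]_m -> R) -> Prop :=
| ca_const b : chart_alg (fun=> b)
| ca_add h1 h2 : chart_alg h1 -> chart_alg h2 -> chart_alg (fun z => h1 z + h2 z)
| ca_mul h1 h2 : chart_alg h1 -> chart_alg h2 -> chart_alg (fun z => h1 z * h2 z)
| ca_lin l : chart_alg (lin l)
| ca_var i l p q : chart_alg (fun z => Ad (X i (lin l z)) p q)
| ca_chart i l p q : chart_alg (fun z => Ad (X i (lin l (f z))) p q)
| ca_coord j : chart_alg (fun z => f z 0 j)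
| ca_det : chart_alg (fun z => (\det (J X Ad (f z)))^-1).

Lemma chart_alg_subalgebra : subalgebra chart_alg.
Proof. by split; constructor. Qed.

(** Members of the algebra that have a gradient in the algebra. As these form a subalgebra,
    [subalg_det] differentiates the determinant of the Jacobian. *)
Let has_d h := chart_alg h /\ exists dh : 'I_m -> 'rV[R]_m -> R,
  (forall i, chart_alg (dh i)) /\ forall z, D z -> qd h z (\col_i dh i z).

Let has_d_subalgebra : subalgebra has_d.
Proof.
split.
- move=> b; split; first exact: ca_const.
  exists (fun _ _ => 0); split=> [i|z _]; first exact: ca_const.
  have -> : \col_(i < m) 0 = 0 :> 'cV[R]_m by apply/colP => i; rewrite !mxE.
  exact: qd_const.
- move=> h1 h2 [A1 [d1 [P1 Q1]]] [A2 [d2 [P2 Q2]]]; split; first exact: ca_add.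
  exists (fun i z => d1 i z + d2 i z); split=> [i|z Dz]; first exact: ca_add.
  have -> : \col_i (d1 i z + d2 i z) = (\col_i d1 i z) + (\col_i d2 i z).
    by apply/colP => i; rewrite !mxE.
  by apply: qdD; [exact: Q1|exact: Q2].
move=> h1 h2 [A1 [d1 [P1 Q1]]] [A2 [d2 [P2 Q2]]]; split; first exact: ca_mul.
exists (fun i z => h2 z * d1 i z + h1 z * d2 i z); split=> [i|z Dz].
  by apply: ca_add; apply: ca_mul.
have -> : \col_i (h2 z * d1 i z + h1 z * d2 i z) =
  h2 z *: (\col_i d1 i z) + h1 z *: (\col_i d2 i z).
  by apply/colP => i; rewrite !mxE.
by apply: qdM; [exact: Q1|exact: Q2].
Qed.

Let has_d_Ad i p q h : (forall p q, chart_alg (fun z => Ad (X i (h z)) p q)) ->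
  has_d h -> has_d (fun z => Ad (X i (h z)) p q).
Proof.
move=> AA [_ [dh [Pd Q]]]; split=> //.
have [B HB] := AdX_diff hG HN Ha HX HAd i.
exists (fun k z => (Ad (X i (h z)) *m B) p q * dh k z); split=> [k|z Dz].
  apply: ca_mul => //.
  by apply: (subalg_mulmx chart_alg_subalgebra) => // k1 k2; exact: ca_const.
have [k [s' [k0 s'0 H]]] := HB (h z) p q.
have -> : \col_k ((Ad (X i (h z)) *m B) p q * dh k z) =
  (Ad (X i (h z)) *m B) p q *: (\col_k dh k z).
  by apply/colP => j; rewrite [in LHS]mxE [RHS]mxE [X in _ = _ * X]mxE.
exact: (qd_comp (phi := fun t => Ad (X i t) p q) (Q z Dz) k0 s'0 H).
Qed.

Let chart_alg_J : subalg_mx chart_alg (fun z => J X Ad (f z)).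
Proof.
by have [] := Dw_subalg chart_alg_subalgebra ca_chart (map inr (Eword R n)).
Qed.

(** The inverse Jacobian is spelled as reciprocal determinant times adjugate, whose entries belong
    to the algebra on the whole space; on [D] it agrees with [invmx]. *)
Let has_d_coord j : has_d (fun z => f z 0 j).
Proof.
split; first exact: ca_coord.
exists (fun k z => (Dw X Ad w z *m
  ((\det (J X Ad (f z)))^-1 *: \adj (J X Ad (f z)))) k j); split=> [k|z Dz].
  apply: (subalg_mulmx chart_alg_subalgebra).
    by have [] := Dw_subalg (u := id) chart_alg_subalgebra ca_var w.
  apply: (subalg_mxZ chart_alg_subalgebra); first exact: ca_det.
  exact: (subalg_adj chart_alg_subalgebra chart_alg_J).
have [fz _] := Hf Dz; have uJ := J_unit hG HN Ha HX HAd c0 E_low fz.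
have -> : \col_k (Dw X Ad w z *m ((\det (J X Ad (f z)))^-1 *: \adj (J X Ad (f z)))) k j =
  col j (Dw X Ad w z *m invmx (J X Ad (f z))).
  by apply/colP => k; rewrite [LHS]mxE [RHS]mxE /invmx uJ.
exact: (chart_map_qd hG HN Ha HX HAd c0 E_low oD Hf).
Qed.

Lemma chart_alg_stable : stable_on D chart_alg.
Proof.
suff H h : chart_alg h -> has_d h by move=> h /H[].
have [Hc HD HM] := has_d_subalgebra.
have Hlin l : has_d (lin l).
  split; first exact: ca_lin.
  exists (fun k _ => l k 0); split=> [k|z _]; first exact: ca_const.
  have -> : \col_k l k 0 = l by apply/colP => k; rewrite mxE.
  exact: qd_lin.
have Hchart i l p q : has_d (fun z => Ad (X i (lin l (f z))) p q).
  apply: (@has_d_Ad _ _ _ (fun z => lin l (f z)) _); first by move=> p' q'; exact: ca_chart.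
  have -> : (fun z => lin l (f z)) = (fun z => \sum_k f z 0 k * l k 0).
    by apply/funext => z; rewrite /lin mxE.
  apply: (@subalg_sum R _ _ has_d_subalgebra _ _ _ (fun k z => f z 0 k * l k 0)) => k.
  apply: (HM (fun z => f z 0 k)); [exact: has_d_coord | exact: (Hc (l k 0))].
elim=> [b|h1 h2 _ H1 _ H2|h1 h2 _ H1 _ H2|l|i l p q|i l p q|j|].
- exact: Hc.
- exact: HD.
- exact: HM.
- exact: Hlin.
- by apply: (@has_d_Ad _ _ _ (lin l) _) => // p' q'; exact: ca_var.
- exact: Hchart.
- exact: has_d_coord.
(* The remaining generator is a reciprocal: its determinant is covered by closure and does not
   vanish on [D] by [J_unit]. *)
have [_ [dh [Pd Q]]] : has_d (fun z => \det (J X Ad (f z))).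
  apply: (subalg_det has_d_subalgebra).
  by have [] := Dw_subalg (u := f) has_d_subalgebra Hchart (map inr (Eword R n)).
split; first exact: ca_det.
exists (fun k z => - (\det (J X Ad (f z)))^-1 ^+ 2 * dh k z); split=> [k|z Dz].
  apply: ca_mul => //.
  have -> : (fun z => - (\det (J X Ad (f z)))^-1 ^+ 2) =
    (fun z => (-1) * ((\det (J X Ad (f z)))^-1 * (\det (J X Ad (f z)))^-1)).
    by apply/funext => z; rewrite mulN1r expr2.
  apply: (ca_mul (ca_const _)); apply: ca_mul; exact: ca_det.
have -> : \col_k (- (\det (J X Ad (f z)))^-1 ^+ 2 * dh k z) =
  - (\det (J X Ad (f z)))^-1 ^+ 2 *: \col_k dh k z.
  by apply/colP => k; rewrite [in LHS]mxE [RHS]mxE [X in _ = _ * X]mxE.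
apply: (qdV (Q z Dz)); have [fz _] := Hf Dz.
by rewrite -unitfE -unitmxE; exact: (J_unit hG HN Ha HX HAd c0 E_low fz).
Qed.

End ChartAlgebra.

(** * The Lie group atlas *)

Section LieAtlas.
Variables (G : topGroupType) (N : G -> RR).
Hypotheses (hG : hausdorff_space G) (HN : group_norm N).

Variables (n : nat) (a : G -> 'rV[RR]_n) (C r : RR) (X : 'I_n -> RR -> G).
Hypotheses (Ha : almost_hom N a C r)
  (HX : forall i, one_param N (X i) /\ is_tangent a (X i) 'e_i).

Lemma weval_nbhs m (w : seq (letter RR G n m)) z (U : set G) :
  nbhs (weval X z w) U -> nbhs z [set z' | U (weval X z' w)].
Proof.
have [Ad HAd] := choice (Ad_exists hG HN Ha HX).
have [k [s [k0 s0 H]]] := word_diff hG HN Ha HX HAd w z.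
rewrite -{1}[weval X z w]mulg1 => /nbhs_mulgl/(gn_nbhs HN)[e e0 He].
apply: (@nbhs_rV_normV RR m _ z (Num.min s (e / k))); first by rewrite lt_min s0 divr_gt0.
move=> v; rewrite lt_min ltr_pdivlMr // => /andP[v1 v2].
have [h1 _ _] := H v v1; rewrite /= -[weval X (z + v) w](mulVKg (weval X z w)).
by apply: He; apply: le_lt_trans h1 _; rewrite mulrC.
Qed.

Lemma weval_cat m z (w1 w2 : seq (letter RR G n m)) :
  weval X z (w1 ++ w2) = (weval X z w1 * weval X z w2)%g.
Proof. by elim: w1 => [|l w1 IH] /=; rewrite ?mul1g // IH mulgA. Qed.

(** Substitutes a linear map into the letters of the chart, so that chart values at different blocks
    of variables can occur in one word. *)
Definition pull m (A : 'M[RR]_(m, n)) : seq (letter RR G n m) :=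
  [seq inr (ic.1, A *m ic.2) | ic <- Eword RR n].

Lemma weval_pull m (A : 'M[RR]_(m, n)) z : weval X z (pull A) = E X (z *m A).
Proof.
rewrite /pull /E; elim: (Eword RR n) => [//|[i l] w IH] /=.
by rewrite [in LHS]/weval /= -/(weval X z _) IH /lin mulmxA.
Qed.

Definition pullV m (A : 'M[RR]_(m, n)) : seq (letter RR G n m) :=
  [seq inr (ic.1, - (A *m ic.2)) | ic <- rev (Eword RR n)].

Lemma weval_pullV m (A : 'M[RR]_(m, n)) z : weval X z (pullV A) = (E X (z *m A))^-1%g.
Proof.
rewrite /pullV /E; elim: (Eword RR n) => [|[i l] w IH] /=; first by rewrite invg1.
rewrite rev_cons map_rcons -cats1 weval_cat IH /= mulg1 invgM; congr (_ * _)%g.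
have [oX _] := HX i.
by rewrite -(one_paramN _ oX) /lin mulmxN mulmxA mxE.
Qed.

Variables (c s : RR).
Hypotheses (c0 : 0 < c) (s0 : 0 < s)
  (E_low : forall t t', `|t| < s -> `|t'| < s -> `|t' - t| <= c * N ((E X t)^-1 * E X t')%g)
  (E_open : forall t, `|t| < s -> exists2 e, 0 < e & forall h, N h < e ->
     exists2 t', `|t'| < s & E X t' = (E X t * h)%g).

Lemma chart_map_smooth m D (f : 'rV[RR]_m -> 'rV[RR]_n) w : open D ->
  (forall z, D z -> `|f z| < s /\ E X (f z) = weval X z w) -> smooth_on D f.
Proof.
move=> oD Hf; have [Ad HAd] := choice (Ad_exists hG HN Ha HX).
have oD' z : D z -> nbhs z D by move=> Dz; exact: open_nbhs_nbhs.
apply: (stable_smooth oD (chart_alg_subalgebra X Ad f)).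
  exact: (chart_alg_stable hG HN Ha HX HAd c0 E_low oD' Hf).
by move=> j; exact: ca_coord.
Qed.

Lemma E_nbhs t : nbhs (E X t) `<=` (fun U => nbhs t [set t' | U (E X t')]).
Proof. by move=> U; exact: weval_nbhs. Qed.

Lemma E0 : E X 0 = 1%g.
Proof.
rewrite /E; elim: (Eword RR n) => [//|[i l] w IH].
change (X i (lin l 0) * weval X 0 (map inr w) = 1)%g.
rewrite IH mulg1 /lin mul0mx mxE.
by have [oX _] := HX i; exact: one_param0 oX.
Qed.

Definition chart_image : set G := E X @` [set t | `|t| < s].

Lemma E_inj t t' : `|t| < s -> `|t'| < s -> E X t = E X t' -> t = t'.
Proof.
move=> ts t's e; apply/esym/eqP; rewrite -subr_eq0 -normr_le0.
by have := E_low ts t's; rewrite e mulVg (gn1 HN) mulr0.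
Qed.

(** Off [chart_image] the value is the default 0, so the domains below include membership in
    [chart_image]. *)
Definition chart_log (g : G) : 'rV[RR]_n := xget 0 [set t | `|t| < s /\ E X t = g].

Lemma chart_logP g : chart_image g -> `|chart_log g| < s /\ E X (chart_log g) = g.
Proof.
move=> [t ts e]; have := @xgetPex _ 0 [set t | `|t| < s /\ E X t = g].
by apply; exists t.
Qed.

Lemma chart_logK t : `|t| < s -> chart_log (E X t) = t.
Proof.
move=> ts; have [|ls] := @chart_logP (E X t); first by exists t.
exact: E_inj.
Qed.

Lemma chart_image_nbhs g : chart_image g -> nbhs g chart_image.
Proof.
move=> [t ts <-]; have [e e0 He] := E_open ts.
have : nbhs ((E X t)^-1 * E X t)%g [set h | N h < e].
  by rewrite mulVg; exact: gn_small.
move=> /nbhs_mulgl; apply: filterS => h /= hN.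
by have [t' t's e'] := He _ hN; exists t' => //; rewrite e' mulVKg.
Qed.

Lemma word_chart_open m (D0 : set 'rV[RR]_m) w : open D0 ->
  open [set z | D0 z /\ chart_image (weval X z w)].
Proof.
move=> oD; rewrite openE => z [Dz Ez].
apply: (@filterI _ _ (nbhs_filter z)); first exact: open_nbhs_nbhs.
exact/weval_nbhs/chart_image_nbhs.
Qed.

Lemma word_chart_smooth m (D0 : set 'rV[RR]_m) w (f : 'rV[RR]_m -> 'rV[RR]_n) : open D0 ->
  (forall z, f z = chart_log (weval X z w)) ->
  smooth_on [set z | D0 z /\ chart_image (weval X z w)] f.
Proof.
move=> oD Hf; apply: (@chart_map_smooth _ _ _ w); first exact: word_chart_open.
by move=> z [_ Ez]; rewrite Hf; exact: chart_logP.
Qed.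

Lemma open_mulmx_ball m (A : 'M[RR]_(m, n)) : open [set z : 'rV[RR]_m | `|z *m A| < s].
Proof.
rewrite openE => z /= zA; have [k k0 Hk] := mulmx_bounded A.
have k1 : 0 < k + 1 by rewrite ltr_wpDl.
apply: (@nbhs_rV_normV RR m _ z ((s - `|z *m A|) / (k + 1))).
  by rewrite divr_gt0 // subr_gt0.
move=> v; rewrite ltr_pdivlMr // => vs /=; rewrite mulmxDl.
apply: le_lt_trans (ler_normD _ _) _; rewrite -ltrBrDl.
apply: le_lt_trans (Hk v) _; apply: le_lt_trans vs.
by rewrite mulrC ler_wpM2l // lerDl.
Qed.

Variables (S : topologicalType) (mul : S -> S -> S) (inv : S -> S) (A : set S) (v : G -> S).
Hypotheses (v_in : forall g, A (v g)) (v_surj : forall x, A x -> exists g, v g = x)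
  (v_inj : injective v) (vM : forall g h, v (g * h)%g = mul (v g) (v h))
  (vV : forall g, v (g^-1)%g = inv (v g))
  (v_nbhs : forall g (U : set G), nbhs g U <->
     exists O : set S, [/\ open O, O (v g) & v @^-1` O `<=` U]).

Definition lift_to (x : S) : G := xget 1%g [set g | v g = x].

Lemma lift_toK g : lift_to (v g) = g.
Proof.
apply: v_inj; exact: (@xgetPex _ 1%g [set h | v h = v g] (ex_intro _ g erefl)).
Qed.

Definition chart_dom (g : G) : set S := [set x | A x /\ chart_image (g^-1 * lift_to x)%g].
Definition chart_phi (g : G) (x : S) := chart_log (g^-1 * lift_to x)%g.
Definition chart_psi (g : G) (y : 'rV[RR]_n) := v (g * E X y)%g.

Lemma chart_phi_im g : chart_phi g @` chart_dom g = [set t | `|t| < s].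
Proof.
apply/seteqP; split => [_ [x [Ax Ex] <-]|t ts] /=; first by have [] := chart_logP Ex.
exists (chart_psi g t).
  by split; [exact: v_in | rewrite /chart_psi lift_toK mulKg; exists t].
by rewrite /chart_phi /chart_psi lift_toK mulKg chart_logK.
Qed.

(** The charts are the left translates of [E], one for each [g]. The coordinate expression of a
    transition, a product or an inverse is then [chart_log] of a single word, and what remains is to
    match the domains for [word_chart_smooth]. *)
Lemma nss_Lie_group : Lie_group mul inv A.
Proof.
exists n, G, chart_dom, chart_phi, chart_psi.
have oB : open [set t : 'rV[RR]_n | `|t| < s].
  have := @open_mulmx_ball n 1%:M; congr open; apply/seteqP.
  by split=> t /=; rewrite mulmx1.
split; [|split; [|split; [|split; [|split; [|split]]]]].
- move=> _ _ /v_surj[g <-] /v_surj[h <-] gh.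
  have /eqP gh' : g <> h by move=> e; apply: gh; rewrite e.
  move: hG; rewrite open_hausdorff => /(_ g h gh')[[U V] /= [/set_mem Ug /set_mem Vh]].
  move=> [oU oV /eqP UV].
  have /v_nbhs[ O [oO Og OU]] : nbhs g U by exact: open_nbhs_nbhs.
  have /v_nbhs[ O' [oO' Oh OV]] : nbhs h V by exact: open_nbhs_nbhs.
  exists O, O'; split=> //; apply/seteqP; split=> // x [[Ox O'x] /v_surj[k e]].
  have : (U `&` V) k by split; [apply: OU | apply: OV]; rewrite /= e.
  by rewrite UV.
- move=> g.
  (* Relative openness: every point of the domain gets its own ambient open set, and their union is
     taken over the points of the domain only. *)
  have ex (h : G) : exists O : set S, chart_image (g^-1 * h)%g ->
      [/\ open O, O (v h) & v @^-1` O `<=` [set k | chart_image (g^-1 * k)%g]].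
    have [Eh|nE] := pselect (chart_image (g^-1 * h)%g); last by exists setT.
    have /v_nbhs[ O HO] := nbhs_mulgl (chart_image_nbhs Eh).
    by exists O.
  have [ O HO] := choice ex.
  exists (\bigcup_(h in [set h | chart_image (g^-1 * h)%g]) O h); split.
    by apply: bigcup_open => h Eh; have [] := HO h Eh.
  apply/seteqP; split=> [x [Ax Ex]|x [[h Eh Ohx] Ax]].
    have [k ek] := v_surj Ax; rewrite -ek lift_toK in Ex *.
    by split=> //; exists k => //; have [] := HO k Ex.
  have [k ek] := v_surj Ax; rewrite -ek in Ohx *; split=> //.
  by rewrite lift_toK; have [_ _] := HO h Eh; exact.
- move=> _ /v_surj[g <-]; exists g => //; split=> //.
  by rewrite lift_toK mulVg -E0; exists 0 => //=; rewrite normr0.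
- move=> g; rewrite chart_phi_im; split=> //.
  + move=> x [Ax Ex]; rewrite /chart_psi /chart_phi; have [_ ->] := chart_logP Ex.
    by have [k <-] := v_surj Ax; rewrite lift_toK mulVKg.
  + by move=> y ys; rewrite /chart_phi /chart_psi lift_toK mulKg chart_logK.
  + apply/subspace_continuousP => x [Ax Ex]; have [k ek] := v_surj Ax.
    apply: (iffRL (@cvgrPdist_le _ _ _ _ (within_filter _ (nbhs_filter x)) (chart_phi g) (chart_phi g x))).
    move=> e e0; have : nbhs (k^-1 * k)%g [set h | N h < e / c].
      by rewrite mulVg; apply: (gn_small HN); exact: divr_gt0.
    move=> /nbhs_mulgl/v_nbhs[ O [oO Ok OU]].
    have : nbhs x O by rewrite -ek; exact: open_nbhs_nbhs.
    apply: (@filterS _ _ (nbhs_filter x)) => x' Ox' [Ax' Ex'].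
    have [k' ek'] := v_surj Ax'; rewrite distrC /chart_phi.
    have [l1 l2] := chart_logP Ex; have [l3 l4] := chart_logP Ex'.
    apply: le_trans (E_low l1 l3) _; rewrite l2 l4 -ek -ek' !lift_toK invgM invgK mulgA mulgK.
    rewrite -ler_pdivlMl // mulrC ltW //; apply: OU.
    by rewrite /= ek'.
  + apply: continuous_subspaceT => t; move=> O.
    rewrite /= => Onb; have : nbhs (g * E X t)%g (v @^-1` O).
      apply/v_nbhs; move: Onb; rewrite nbhsE => -[ O' [oO' O't] O'O].
      by exists O'; split=> // k /= /O'O.
    by move=> /nbhs_mulgl/E_nbhs.
- move=> g h; pose w := inl (h^-1 * g)%g :: pull 1%:M.
  have e y : weval X y w = (h^-1 * (g * E X y))%g.
    by rewrite /w {1}/weval /= -/(weval X y _) weval_pull mulmx1 mulgA.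
  have := @word_chart_smooth _ _ w (chart_phi h \o chart_psi g) oB.
  set D := [set z | _ /\ _].
  have -> : D = chart_phi g @` (chart_dom g `&` chart_dom h).
    apply/seteqP; split=> [y [ys]|_ [x [[Ax Ex] [_ Ex']] <-]].
      rewrite e => Ey; exists (chart_psi g y).
        split; split; rewrite /chart_psi ?lift_toK ?mulKg //.
        by exists y.
      by rewrite /chart_phi /chart_psi lift_toK mulKg chart_logK.
    have [l1 l2] := chart_logP Ex; split=> //.
    by rewrite e l2 mulVKg.
  by apply => y; rewrite e /= /chart_phi /chart_psi lift_toK.
- move=> g h k.
  (* The two halves of [z] are linear in [z], so both factors of the product are spelled over the
     same variable. *)
  pose A1 : 'M[RR]_(n + n, n) := col_mx 1%:M 0; pose A2 : 'M[RR]_(n + n, n) := col_mx 0 1%:M.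
  have eL (z : 'rV[RR]_(n + n)) : z *m A1 = lsubmx z.
    by rewrite -{1}[z]hsubmxK mul_row_col mulmx1 mulmx0 addr0.
  have eR (z : 'rV[RR]_(n + n)) : z *m A2 = rsubmx z.
    by rewrite -{1}[z]hsubmxK mul_row_col mulmx1 mulmx0 add0r.
  pose w := inl (k^-1 * g)%g :: pull A1 ++ inl h :: pull A2.
  have e z : weval X z w = (k^-1 * (g * E X (lsubmx z) * (h * E X (rsubmx z))))%g.
    rewrite /w {1}/weval /= -/(weval X z _) weval_cat weval_pull eL.
    by rewrite [X in (_ * (_ * X))%g]/weval /= -/(weval X z _) weval_pull eR !mulgA.
  have oD := openI (@open_mulmx_ball _ A1) (@open_mulmx_ball _ A2).
  have := @word_chart_smooth _ _ w
    (fun z => chart_phi k (mul (chart_psi g (lsubmx z)) (chart_psi h (rsubmx z)))) oD.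
  rewrite !chart_phi_im.
  set D := [set z | _ /\ _]; set D' := [set z | [/\ _, _ & _]].
  have -> : D = D'.
    apply/seteqP; split=> z.
      move=> [[z1 z2]]; rewrite e => Ez; rewrite /= eL in z1; rewrite /= eR in z2; split=> //.
      by rewrite /chart_psi -vM; split=> //; rewrite lift_toK.
    move=> [z1 z2]; rewrite /chart_psi -vM => -[_]; rewrite lift_toK => Ez.
    by split; [split; rewrite /= ?eL ?eR | rewrite e].
  by apply => z; rewrite e /chart_phi /chart_psi -vM lift_toK.
move=> g h; rewrite chart_phi_im.
pose w := inl (h^-1)%g :: pullV 1%:M ++ [:: inl (g^-1)%g].
have e y : weval X y w = (h^-1 * (g * E X y)^-1)%g.
  rewrite /w {1}/weval /= -/(weval X y _) weval_cat weval_pullV mulmx1.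
  by rewrite /weval /= mulg1 invgM.
have := @word_chart_smooth _ _ w (fun y => chart_phi h (inv (chart_psi g y))) oB.
set D := [set z | _ /\ _]; set D' := [set z | _ /\ _].
have -> : D = D'.
  apply/seteqP; split=> y [ys].
    rewrite e => Ey; split=> //; rewrite /chart_psi -vV; split=> //.
    by rewrite lift_toK.
  by rewrite /chart_psi -vV => -[_]; rewrite lift_toK => Ey; split; [|rewrite e].
by apply => y; rewrite e /chart_phi /chart_psi -vV lift_toK.
Qed.

End LieAtlas.

(** * Maximal subgroups of a Clifford semigroup *)

(** The intersection of all neighbourhoods of 1 is a subgroup inside [W], hence trivial, and two
    points that cannot be separated differ by an element of it. *)
Lemma nss_hausdorff (G : topGroupType) (W : set G) :
  nbhs 1%g W -> nss_set W -> hausdorff_space G.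
Proof.
move=> W1 nssW p q pq; pose H := [set g : G | forall U, nbhs 1%g U -> U g].
suff Hpq : H (p^-1 * q)%g.
  have /(_ (p^-1 * q)%g Hpq)/= e : H `<=` [set 1%g].
    apply: nssW.
    - by move=> U; exact: nbhs_singleton.
    - move=> x y Hx Hy U /nbhs1_mul[V [V1 VU]].
      by apply: VU; [exact: Hx | exact: Hy].
    - by move=> x Hx U /nbhs1_inv; exact: Hx.
    - by move=> x; exact.
  by rewrite -[q](mulVKg p) e mulg1.
move=> U /nbhs1_mul[V [V1 VU]].
have V1' := filterI V1 (nbhs1_inv V1).
have nb g : nbhs g [set h | (V `&` [set x | V x^-1%g]) (g^-1 * h)%g].
  by apply: nbhs_mulgl; rewrite mulVg; exact: V1'.
have [h [[h1 _] [_ h2]]] := pq _ _ (nb p) (nb q).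
have -> : (p^-1 * q = p^-1 * h * (q^-1 * h)^-1)%g by rewrite invgM invgK mulgA mulgK.
exact: VU.
Qed.

Section CliffordMaximalSubgroup.
Variables (S : topologicalType) (mul : S -> S -> S) (inv : S -> S).
Hypotheses (hS : clifford_semigroup mul inv) (hT : topological_ops mul inv).

Let mulA x y z : mul x (mul y z) = mul (mul x y) z. Proof. by case: hS. Qed.
Let mulVx x : mul (mul x (inv x)) x = x. Proof. by case: hS => _ + _ _ _. Qed.
Let Vmulx x : mul (mul (inv x) x) (inv x) = inv x. Proof. by case: hS => _ _ + _ _. Qed.
Let inv_uniq x y : mul (mul x y) x = x -> mul (mul y x) y = y -> y = inv x.
Proof. by case: hS => _ _ _ + _; exact. Qed.
Let mul_invC x : mul x (inv x) = mul (inv x) x. Proof. by case: hS. Qed.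

Let invK x : inv (inv x) = x. Proof. by apply/esym/inv_uniq; [exact: Vmulx | exact: mulVx]. Qed.

Variable e : S.
Hypothesis he : idempotents mul e.

Lemma Gmax_e : Gmax mul inv e e.
Proof.
have e1 : mul (mul e e) e = e by have e2 : mul e e = e := he; rewrite !e2.
by rewrite /Gmax /= -(inv_uniq e1 e1); exact: he.
Qed.

Lemma Gmax_mule x : Gmax mul inv e x -> mul e x = x.
Proof. by move=> <-. Qed.

Lemma Gmax_muler x : Gmax mul inv e x -> mul x e = x.
Proof. by move=> <-; rewrite mul_invC mulA. Qed.

Lemma Gmax_inv x : Gmax mul inv e x -> Gmax mul inv e (inv x).
Proof. by rewrite /Gmax /= invK -mul_invC. Qed.

Lemma Gmax_mul x y : Gmax mul inv e x -> Gmax mul inv e y -> Gmax mul inv e (mul x y).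
Proof.
move=> Gx Gy.
have xy : mul (mul x y) (mul (inv y) (inv x)) = e.
  by rewrite mulA -(mulA x) Gy Gmax_muler.
suff e1 : mul (inv y) (inv x) = inv (mul x y) by rewrite /Gmax /= -e1.
apply: inv_uniq; rewrite ?xy.
  by rewrite mulA Gmax_mule.
by rewrite -mulA xy -mulA Gmax_muler //; exact: Gmax_inv.
Qed.

Lemma closed_Gmax : hausdorff_subspace (idempotents mul) -> closed (Gmax mul inv e).
Proof.
move=> hE x clx; apply: contrapT => nx.
have idem y : idempotents mul (mul y (inv y)).
  by rewrite /idempotents /= mulA mulVx.
have [U [V [oU oV Ux Ve UV]]] := hE _ _ (idem x) he nx.
have c : continuous (fun y => mul y (inv y)).
  move=> y; have [cm ci] := hT.
  by apply: (@continuous2_cvg _ _ _ _ _ _ id inv mul y (inv y) (cm (y, inv y))); [exact: cvg_id | exact: ci].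
have /clx[y [Gy Uy]] : nbhs x [set y | U (mul y (inv y))].
  by apply: c; exact: open_nbhs_nbhs.
rewrite /= Gy in Uy.
by have : (U `&` V `&` idempotents mul) e by []; rewrite UV.
Qed.

(* The hypotheses are phantom arguments, on which the group instance depends. *)
Definition Gmax_group of clifford_semigroup mul inv & topological_ops mul inv &
  idempotents mul e : Type := set_type (Gmax mul inv e).

Local Notation G := (Gmax_group hS hT he).
HB.instance Definition _ := Topological.copy G (set_type (Gmax mul inv e)).

Definition Gmax_val (g : G) : S := val g.
Local Notation v := Gmax_val.

Lemma Gmax_valP g : Gmax mul inv e (v g).
Proof. exact: set_mem (valP g). Qed.

Definition Gmax_sub x (Gx : Gmax mul inv e x) : G := exist _ x (mem_set Gx).

Lemma Gmax_val_inj : injective v.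
Proof. exact: val_inj. Qed.

Lemma Gmax_nbhs (g : G) (U : set G) : nbhs g U <->
  exists O : set S, [/\ open O, O (v g) & v @^-1` O `<=` U].
Proof.
split=> [[_ /= [[ O oO <-] Og] OU]|[ O [oO Og OU]]]; first by exists O.
by exists (v @^-1` O); split=> //; exists O.
Qed.

Let mulG (g h : G) := Gmax_sub (Gmax_mul (Gmax_valP g) (Gmax_valP h)).
Let invG (g : G) := Gmax_sub (Gmax_inv (Gmax_valP g)).
Let oneG := Gmax_sub Gmax_e.

Let mulGA : associative mulG.
Proof. by move=> x y z; apply: Gmax_val_inj; exact: mulA. Qed.
Let mul1G : left_id oneG mulG.
Proof. by move=> x; apply: Gmax_val_inj; exact: Gmax_mule (Gmax_valP x). Qed.
Let mulG1 : right_id oneG mulG.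
Proof. by move=> x; apply: Gmax_val_inj; exact: Gmax_muler (Gmax_valP x). Qed.
Let mulVG : left_inverse oneG invG mulG.
Proof.
move=> x; apply: Gmax_val_inj; rewrite /Gmax_val /= -mul_invC.
exact: (Gmax_valP x).
Qed.
Let mulGV : right_inverse oneG invG mulG.
Proof. by move=> x; apply: Gmax_val_inj; exact: (Gmax_valP x). Qed.

HB.instance Definition _ := isGroup.Build G mulGA mul1G mulG1 mulVG mulGV.

Lemma Gmax_valM (g h : G) : v (g * h)%g = mul (v g) (v h). Proof. by []. Qed.
Lemma Gmax_valV (g : G) : v (g^-1)%g = inv (v g). Proof. by []. Qed.
Lemma Gmax_val1 : v (1%g : G) = e. Proof. by []. Qed.

Lemma Gmax_val_continuous : continuous v.
Proof.
move=> g U; rewrite nbhsE => -[ O [oO Og] OU].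
by apply/Gmax_nbhs; exists O; split=> // h /OU.
Qed.

Let mulG_continuous : continuous (fun p : G * G => (p.1 * p.2)%g).
Proof.
move=> [g h] U /Gmax_nbhs[ O [oO Ogh OU]]; have [cm _] := hT.
have : (fun p : G * G => mul (v p.1) (v p.2)) @ (g, h) --> mul (v g) (v h).
  apply: (@continuous2_cvg _ _ _ _ _ _ (fun p : G * G => v p.1) (fun p => v p.2) mul (v g) (v h) (cm (v g, v h))).
    by apply: cvg_comp; [exact: cvg_fst | exact: Gmax_val_continuous].
  by apply: cvg_comp; [exact: cvg_snd | exact: Gmax_val_continuous].
move=> /(_ O (open_nbhs_nbhs (conj oO Ogh))) H.
by apply: (@filterS _ _ (nbhs_filter (g, h)) _ _ _ H) => p; exact: (OU (p.1 * p.2)%g).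
Qed.

Let invG_continuous : continuous (fun g : G => g^-1%g).
Proof.
move=> g U /Gmax_nbhs[ O [oO Og OU]]; have [_ ci] := hT.
have : (inv \o v) @ g --> inv (v g).
  by apply: continuous_comp; [exact: Gmax_val_continuous | exact: ci].
move=> /(_ O (open_nbhs_nbhs (conj oO Og))) H.
by apply: (@filterS _ _ (nbhs_filter g) _ _ _ H) => h; exact: (OU (h^-1)%g).
Qed.

HB.instance Definition _ := Group_isTopGroup.Build G mulG_continuous invG_continuous.

(** Since [Gmax] is closed in [S], it meets [K] in a compact set; a cluster point there of the image
    filter is one for the subspace topology. *)
Lemma Gmax_compact (K : set S) : hausdorff_subspace (idempotents mul) ->
  compact K -> compact (v @^-1` K).
Proof.
move=> hE cK F PF FK.
have cKG := compact_closedI cK (closed_Gmax hE).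
have [x [[Kx Gx] clx]] : (K `&` Gmax mul inv e) `&` cluster (v @ F) !=set0.
  have PvF := fmap_proper_filter v PF.
  have FKG : F (v @^-1` (K `&` Gmax mul inv e)).
    by apply: filterS FK => g Kg; split; [exact: Kg | exact: Gmax_valP].
  exact: (cKG _ PvF FKG).
exists (Gmax_sub Gx); split=> // A B FA /Gmax_nbhs[ O [oO Ox OB]].
have FvA : F (v @^-1` (v @` A)) by apply: filterS FA => g Ag; exists g.
have [_ [[g Ag <-] Og]] := clx _ _ FvA (open_nbhs_nbhs (conj oO Ox)).
by exists g; split=> //; exact: OB.
Qed.

Lemma Gmax_nss (U : set S) :
  (forall H : set S, is_subgroup_of_Gmax mul inv e H ->
    H `<=` U `&` Gmax mul inv e -> H = [set e]) -> nss_set (v @^-1` U).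
Proof.
move=> HU H H1 HM HV HW h Hh; apply: Gmax_val_inj; rewrite Gmax_val1.
have HE : v @` H = [set e].
  apply: HU => [|_ [g Hg <-]]; last by split; [exact: HW | exact: Gmax_valP].
  split.
  - by move=> _ [g _ <-]; exact: Gmax_valP.
  - by exists 1%g.
  - by move=> _ _ [g Hg <-] [k Hk <-]; exists (g * k)%g => //; exact: HM.
  - by move=> _ [g Hg <-]; exists (g^-1)%g => //; exact: HV.
have : (v @` H) (v h) by exists h.
by rewrite HE.
Qed.

End CliffordMaximalSubgroup.

Theorem theorem5p7 (S : topologicalType) (mul : S -> S -> S) (inv : S -> S) :
  clifford_semigroup mul inv ->
  topological_ops mul inv ->
  locally_compact_space S ->
  (forall e, idempotents mul e -> NSS_Gmax mul inv e) ->
  hausdorff_subspace (idempotents mul) ->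
  forall e, idempotents mul e -> Lie_group mul inv (Gmax mul inv e).
Proof.
move=> hS hT lcS nssS hE e he.
pose G : topGroupType := Gmax_group hS hT he.
pose v : G -> S := @Gmax_val _ _ _ hS hT e he.
have [U [oU Ue HU]] := nssS e he.
have nssU : nss_set (v @^-1` U) by exact: Gmax_nss.
have vN (A : set S) : nbhs e A -> nbhs (1%g : G) (v @^-1` A).
  by move=> Ae; exact: (@Gmax_val_continuous _ _ _ hS hT e he 1%g A Ae).
have U1 := vN U (open_nbhs_nbhs (conj oU Ue)).
(* Only [E(S)] is given as Hausdorff, so the separation of the group is drawn from NSS. *)
have hG := nss_hausdorff U1 nssU.
have [K [cK Ke]] := lcS e.
have cK' : compact (v @^-1` K) by exact: Gmax_compact.
have [N [HN [d [F [C [r HF]]]]]] := nss_group_norm RR hG cK' (vN K Ke) U1 nssU.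
have [n [a [c [s [X [Ha HX]]]]]] := coordinates_exist hG HN cK' (vN K Ke) HF.
have [c' [s' [c'0 s'0 Hlip Hopen _]]] := E_chart hG HN Ha HX.
apply: (nss_Lie_group hG HN Ha HX c'0 s'0 _ Hopen (v := v)).
- by move=> t t' ts t's; have [] := Hlip t t' ts t's.
- exact: Gmax_valP.
- by move=> x Gx; exists (Gmax_sub hS hT he Gx).
- exact: Gmax_val_inj.
- exact: Gmax_valM.
- exact: Gmax_valV.
- exact: Gmax_nbhs.
Qed.
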